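(* Let $G$ be a connected real Lie group, $\kappa\in\mathbb R$, and $R,R'\in\mathbb R$ with $R+R'\ge1$. (i) For every $\hbar\in\mathbb C$ the $\kappa$-Neumaier operator $N_\kappa\colon\mathrm{Pol}_{R,R'}(T^*G)\to\mathrm{Pol}_{R,R'}(T^*G)$ is well-defined and continuous. (ii) $N_\kappa$ extends by continuity to $N_\kappa\colon\widehat{\mathrm{Pol}}_{R,R'}(T^*G)\to\widehat{\mathrm{Pol}}_{R,R'}(T^*G)$, and its explicit formula extends to the completion order by order, i.e. $N_\kappa(P)=\sum_{\ell=0}^\infty\frac{(-\mathrm i\kappa\hbar)^\ell}{\ell!}\Delta^\ell(P)$ for $P\in\widehat{\mathrm{Pol}}_{R,R'}(T^*G)$, with $\Delta^\ell$ extended continuously. (iii) For all $P\in\widehat{\mathrm{Pol}}_{R,R'}(T^*G)$ the map $\mathbb C\ni\hbar\mapsto N_\kappa(P)\in\widehat{\mathrm{Pol}}_{R,R'}(T^*G)$ is entire. (iv) If in addition $R\ge0$ and $R'\ge1$, the $\kappa$-ordered star product extends to a continuous multiplication $\star_\kappa\colon\widehat{\mathrm{Pol}}_{R,R'}(T^*G)\times\widehat{\mathrm{Pol}}_{R,R'}(T^*G)\to\widehat{\mathrm{Pol}}_{R,R'}(T^*G)$. (v) If $R\ge0$ and $R'\ge1$, then for all $P,Q\in\widehat{\mathrm{Pol}}_{R,R'}(T^*G)$ the map $\mathbb C\ni\hbar\mapsto P\star_\kappa Q\in\widehat{\mathrm{Pol}}_{R,R'}(T^*G)$ is entire.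
   Context: All functions are complex-valued. $G$ is a connected real Lie group of dimension $n$ with Lie algebra $\mathfrak g$, unit $\mathrm e$ and fixed basis $(e_1,\dots,e_n)$ of $\mathfrak g$; for $\xi\in\mathfrak g$, $X_\xi$ is the left-invariant vector field with $X_\xi(\mathrm e)=\xi$, and $X_i=X_{e_i}$. For $\alpha\in\{1,\dots,n\}^k$ put $\mathcal L_{X_\alpha}=\mathcal L_{X_{\alpha_1}}\cdots\mathcal L_{X_{\alpha_k}}$. For $R\in\mathbb R$ set $$q_{R,c}(\phi)=\sum_{k\ge0}k!^{R-1}c^k\sum_{\alpha\in\{1,\dots,n\}^k}|(\mathcal L_{X_\alpha}\phi)(\mathrm e)|,$$ and $\mathscr E_R(G)=\{\phi\in C^\omega(G):q_{R,c}(\phi)<\infty\ \forall c\ge0\}$ ($C^\omega$ = real-analytic), topologized by all $q_{R,c}$. $\mathrm{Sym}_{R'}(\mathfrak g)$ is the (complexified) symmetric algebra, with product $\vee$, topologized by $p_{R',c}(v)=\sum_{k}k!^{R'}c^k\,p^k(v_k)$, $c\ge0$, where $v=\sum_kv_k$ with $v_k\in\mathrm{Sym}^k(\mathfrak g)$, $p$ is the $\ell^1$-norm on $\mathfrak g$ for the chosen basis and $p^k$ its $k$-fold projective tensor power on $\mathrm{Sym}^k(\mathfrak g)\subseteq\mathfrak g^{\otimes k}$. $\mathrm{Pol}_{R,R'}(T^*G)=\mathscr E_R(G)\otimes\mathrm{Sym}_{R'}(\mathfrak g)$ carries the projective tensor product topology, and $\widehat{\mathrm{Pol}}_{R,R'}(T^*G)$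 is its completion. A map from $\mathbb C$ into a complete locally convex space is entire if it is holomorphic on $\mathbb C$. Neumaier operator: on $C^\infty(G)\otimes\mathrm{Sym}^\bullet(\mathfrak g)$ let $\Delta(\phi\otimes\xi_1\vee\dots\vee\xi_k)=\sum_{\ell=1}^k\mathcal L_{X_{\xi_\ell}}\phi\otimes\xi_1\vee\dots\widehat{\xi_\ell}\dots\vee\xi_k$ (omit $\xi_\ell$), and $N_\kappa=\exp(-\mathrm i\kappa\hbar\Delta)$ (a finite sum on each element, since $\Delta$ lowers the symmetric degree by one). Star products, for $\hbar\in\mathbb C$ and $z=\hbar/\mathrm i$: the Gutt star product $\star_{\mathfrak g}$ on $\mathrm{Sym}^\bullet(\mathfrak g)$ is, for $z\neq0$, $\xi\star_{\mathfrak g}\eta=\mathfrak q_z^{-1}(\mathfrak q_z(\xi)\mathfrak q_z(\eta))$, where $\mathfrak q_z\colon\mathrm{Sym}^\bullet(\mathfrak g)\to\mathrm U_{\mathbb C}(\mathfrak g)$ is the linear isomorphism onto the complexified universal enveloping algebra with $\mathfrak q_z(\xi_1\vee\dots\vee\xi_k)=\frac{z^k}{k!}\sum_{\sigma\in S_k}\xi_{\sigma(1)}\cdots\xi_{\sigma(k)}$; the result is polynomial in $z$ and equals $\xi\vee\eta$ at $z=0$. The standard-ordered star product is $$(\phi\otimes\xi_1\vee\dots\vee\xi_k)\star_{\mathrm{std}}(\psi\otimes\eta)=\sum_{p=0}^k\Bigl(\frac{\hbar}{\mathrm i}\Bigr)^p\frac1{p!\,(k-p)!}\sum_{\sigma\in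 S_k}\bigl(\phi\cdot\mathcal L_{X_{\xi_{\sigma(1)}}}\cdots\mathcal L_{X_{\xi_{\sigma(p)}}}\psi\bigr)\otimes\bigl((\xi_{\sigma(p+1)}\vee\dots\vee\xi_{\sigma(k)})\star_{\mathfrak g}\eta\bigr),$$ and the $\kappa$-ordered star product is $P\star_\kappa Q=N_{-\kappa}\bigl((N_\kappa P)\star_{\mathrm{std}}(N_\kappa Q)\bigr)$. *)

(* Defs.v *)
From HB Require Import structures.
From mathcomp Require Import all_boot all_order all_algebra perm.
From mathcomp Require Import complex.
From mathcomp Require Import all_classical all_reals all_analysis.

Set Implicit Arguments.
Unset Strict Implicit.
Unset Printing Implicit Defensive.

Import Order.TTheory GRing.Theory Num.Theory.
Import numFieldNormedType.Exports.

Local Open Scope classical_set_scope.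
Local Open Scope complex_scope.
Local Open Scope ring_scope.

(* f is near x the sum of an absolutely convergent power series.  Monomials of
   degree k are indexed by words of length k in the variables, so several
   words may give the same monomial; this does not change the notion. *)
Definition analytic_at (R : realType) (m : nat) (f : 'rV[R]_m -> R)
    (x : 'rV[R]_m) : Prop :=
  exists (a : seq 'I_m -> R) (r : R), 0 < r /\
    forall h : 'rV[R]_m, (forall i, `|h 0 i| < r) ->
      cvgn (series (fun k =>
        \sum_(w : k.-tuple 'I_m) `|a w * \prod_(i <- w) h 0 i|)) /\
      series (fun k =>
        \sum_(w : k.-tuple 'I_m) a w * \prod_(i <- w) h 0 i) @ \oo
        --> f (x + h).

(* Only the values of [cfun] on [cdom] and of [cinv] on [cfun @` cdom] matter. *)
Record chart (R : realType) (n : nat) (G : Type) := Chart {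
  cdom : set G;
  cfun : G -> 'rV[R]_n;
  cinv : 'rV[R]_n -> G
}.

Definition is_chart (R : realType) (n : nat) (G : topologicalType)
    (c : chart R n G) : Prop :=
  [/\ open (cdom c), open (cfun c @` cdom c),
      (forall g, cdom c g -> cinv c (cfun c g) = g),
      {within cdom c, continuous (cfun c)} &
      {within cfun c @` cdom c, continuous (cinv c)}].

(* Every Lie group carries exactly one real-analytic structure for which its
   operations are analytic, and this is the structure recorded here. *)
HB.mixin Record isLieGroup (R : realType) (n : nat) G
    & Topological G & Group G := {
  lie_atlas : set (chart R n G);
  lie_hausdorff : hausdorff_space G;
  lie_second_countable : @second_countable G;
  lie_charts : forall c, lie_atlas c -> is_chart c;
  lie_cover : forall g : G, exists2 c, lie_atlas c & cdom c g;
  lie_transition : forall c c', lie_atlas c -> lie_atlas c' ->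
    forall g, cdom c g -> cdom c' g -> forall k,
    analytic_at (fun x => cfun c' (cinv c x) 0 k) (cfun c g);
  lie_mul_continuous : continuous (fun x : G * G => (x.1 * x.2)%g);
  lie_inv_continuous : continuous (fun x : G => (x^-1)%g);
  lie_mul_analytic : forall c c' d, lie_atlas c -> lie_atlas c' ->
    lie_atlas d -> forall g h : G, cdom c g -> cdom c' h -> cdom d (g * h)%g ->
    forall k, analytic_at
      (fun u : 'rV[R]_(n + n) =>
         cfun d (cinv c (lsubmx u) * cinv c' (rsubmx u))%g 0 k)
      (row_mx (cfun c g) (cfun c' h));
  lie_inv_analytic : forall c d, lie_atlas c -> lie_atlas d ->
    forall g : G, cdom c g -> cdom d (g^-1)%g ->
    forall k, analytic_at (fun x => cfun d ((cinv c x)^-1)%g 0 k) (cfun c g)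
}.

#[short(type="lieGroupType")]
HB.structure Definition LieGroup (R : realType) (n : nat) :=
  { G of isLieGroup R n G & Topological G & Group G }.

Section LeftInvariant.
Context (R : realType) (n : nat) (G : lieGroupType R n).
Local Notation C := (R[i]^o).

Definition analytic (f : G -> R) : Prop :=
  forall c : chart R n G, lie_atlas c -> forall g, cdom c g ->
    analytic_at (f \o cinv c) (cfun c g).

Definition Canalytic (phi : G -> C) : Prop :=
  analytic (fun g => complex.Re (phi g)) /\ analytic (fun g => complex.Im (phi g)).

(* A chart [c] around the unit identifies T_e G with 'rV[R]_n, and the rows of
   an invertible matrix [B] are the basis e_1, ..., e_n. *)
Context (c : chart R n G) (B : 'M[R]_n).

(* X_xi(g) is the image of xi under the differential of h |-> g h at e, i.e.
   the velocity at t = 0 of g gamma(t), with gamma(t) the curve of chart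
   coordinates c(e) + t xi. *)
Definition lie_der (xi : 'rV[R]_n) (f : G -> R) (g : G) : R :=
  derive1 (fun t : R => f (g * cinv c (cfun c 1%g + t *: xi))%g : R^o) 0.

Definition lie_derC (xi : 'rV[R]_n) (phi : G -> C) (g : G) : C :=
  lie_der xi (fun h => complex.Re (phi h)) g +i* lie_der xi (fun h => complex.Im (phi h)) g.

Definition lie_word (w : seq 'I_n) (phi : G -> C) : G -> C :=
  foldr (fun i psi => lie_derC (row i B) psi) phi w.

(* k-th chart coordinate of [xi, eta] = [X_xi, X_eta](e) : the vector field
   [X_xi, X_eta], as a derivation, applied to the k-th coordinate function. *)
Definition lie_bracket (xi eta : 'rV[R]_n) : 'rV[R]_n :=
  \row_k (let x := fun g => cfun c g 0 k in
          lie_der xi (lie_der eta x) 1%g - lie_der eta (lie_der xi x) 1%g).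

Definition structure_const (i j : 'I_n) : 'rV[R]_n :=
  lie_bracket (row i B) (row j B) *m invmx B.

Definition q_norm (r cc : R) (phi : G -> C) : \bar R :=
  \sum_(0 <= k <oo)
    ((k`!%:R `^ (r - 1)) * cc ^+ k *
      \sum_(w : k.-tuple 'I_n) Normc.normc (lie_word w phi 1%g))%:E.

Definition entire_fun (r : R) (phi : G -> C) : Prop :=
  Canalytic phi /\ forall cc, 0 <= cc -> (q_norm r cc phi < +oo)%E.

End LeftInvariant.

(* A tensor over the complexification of g is given by its coefficients: [t w]
   is the coefficient of e_{w_1} (x) ... (x) e_{w_k}, k = size w.  The same type
   with coefficients in functions on G hosts C^oo(G) (x) Sym(g). *)
Section Tensors.
Context (R : realType) (n : nat).
Local Notation C := (R[i]^o).

(* Sym^k(g) is the space of symmetric tensors inside the k-fold tensor power. *)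
Definition is_sym (t : seq 'I_n -> C) : Prop :=
  (exists d : nat, forall w, (d < size w)%N -> t w = 0) /\
  forall w w', perm_eq w w' -> t w = t w'.

Definition permute (w : seq 'I_n) (s : 'S_(size w)) : seq 'I_n :=
  [seq tnth (in_tuple w) (s i) | i : 'I_(size w)].

Definition word (w : seq 'I_n) : seq 'I_n -> C := fun u => (u == w)%:R.

(* e_{w_1} \/ ... \/ e_{w_k}, embedded as the average over S_k of the permuted
   tensor products. *)
Definition vee (w : seq 'I_n) : seq 'I_n -> C :=
  ((size w)`!%:R)^-1 *: \sum_(s : 'S_(size w)) word (permute s).

(* In the next definitions a symmetric tensor [t] is expanded as the sum over
   all words w of [t w] times [vee w]. *)
Definition sym_prod (a b : seq 'I_n -> C) : seq 'I_n -> C :=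
  \sum_(w \in [set: seq 'I_n]) \sum_(u \in [set: seq 'I_n])
    (a w * b u) *: vee (w ++ u).

Definition tensor_prod (a b : seq 'I_n -> C) : seq 'I_n -> C :=
  fun w => \sum_(k < (size w).+1) a (take k w) * b (drop k w).

(* Complexified projective tensor power of the l^1-norm, on the degree k part;
   the scalar factors only matter for k = 0. *)
Definition l1norm (x : 'rV[C]_n) : R := \sum_i Normc.normc (x 0 i).

Definition proj_power (k : nat) (t : seq 'I_n -> C) : \bar R :=
  ereal_inf [set y : \bar R | exists s : seq (C * (k.-tuple 'rV[C]_n)),
    (forall w : k.-tuple 'I_n,
      t w = \sum_(x <- s) x.1 * \prod_(i < k) (tnth x.2 i) 0 (tnth w i)) /\
    y = (\sum_(x <- s)
          Normc.normc x.1 * \prod_(i < k) l1norm (tnth x.2 i))%:E].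

Definition p_norm (r cc : R) (v : seq 'I_n -> C) : \bar R :=
  (\sum_(0 <= k <oo) ((k`!%:R `^ r) * cc ^+ k)%:E * proj_power k v)%E.

(* U_C(g) is the tensor algebra modulo the two-sided ideal generated by the
   e_i e_j - e_j e_i - [e_i, e_j]; [br i j] holds the coordinates of
   [e_i, e_j] with respect to (e_1, ..., e_n). *)
Context (br : 'I_n -> 'I_n -> 'rV[R]_n).

Definition env_relator (i j : 'I_n) : seq 'I_n -> C :=
  word [:: i; j] - word [:: j; i]
    - \sum_k ((br i j 0 k)%:C : R[i]) *: word [:: k].

Definition env_ideal (t : seq 'I_n -> C) : Prop :=
  exists s : seq (C * (seq 'I_n * seq 'I_n) * ('I_n * 'I_n)),
    t = \sum_(x <- s) x.1.1 *:
      tensor_prod (tensor_prod (word x.1.2.1) (env_relator x.2.1 x.2.2))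
                  (word x.1.2.2).

(* Representative in the tensor algebra of q_z(v). *)
Definition quant (z : C) (v : seq 'I_n -> C) : seq 'I_n -> C :=
  \sum_(w \in [set: seq 'I_n])
    (v w * (z ^+ size w / (size w)`!%:R)) *:
      \sum_(s : 'S_(size w)) word (permute s).

(* For z != 0, q_z is bijective from Sym(g) onto U_C(g), so [xget] picks the
   unique preimage of q_z(a) q_z(b). *)
Definition gutt (z : C) (a b : seq 'I_n -> C) : seq 'I_n -> C :=
  if z == 0 then sym_prod a b
  else xget 0 [set v : seq 'I_n -> C | is_sym v /\
    env_ideal (quant z v - tensor_prod (quant z a) (quant z b))].

End Tensors.

Section Pol.
Context (R : realType) (n : nat) (G : lieGroupType R n).
Context (c : chart R n G) (B : 'M[R]_n).
Local Notation C := (R[i]^o).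
Local Notation tens := (seq 'I_n -> C).

(* Hosts C^oo(G) (x) Sym(g); the elementary tensor phi (x) v is [elem phi v]. *)
Definition pol : Type := seq 'I_n -> G -> C.
HB.instance Definition _ := GRing.Lmodule.on pol.

Definition elem (phi : G -> C) (v : tens) : pol := fun w g => phi g * v w.

Definition elem_sum (s : seq ((G -> C) * tens)) : pol :=
  \sum_(x <- s) elem x.1 x.2.

Definition elem_in (r : R) (s : seq ((G -> C) * tens)) : Prop :=
  forall x, x \in s -> entire_fun c B r x.1 /\ is_sym x.2.

(* E_r(G) (x) Sym(g), realized as the span of the elementary tensors; as a
   vector space it does not depend on R'. *)
Definition is_pol (r : R) (P : pol) : Prop :=
  exists2 s, elem_in r s & P = elem_sum s.

(* Projective tensor product of q_{r,cc} and p_{r',cc'}. *)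
Definition pol_norm (r r' cc cc' : R) (P : pol) : \bar R :=
  ereal_inf [set y : \bar R | exists s, [/\ elem_in r s, P = elem_sum s &
    y = (\sum_(x <- s) q_norm c B r cc x.1 * p_norm r' cc' x.2)%E]].

(* Neighborhood filter of P in the locally convex space Pol_{r,r'}(T^*G),
   pushed to [pol]. *)
Definition pol_nbhs (r r' : R) (P : pol) : set_system pol :=
  [set A | exists (s : seq (R * R)) (e : R),
    [/\ 0 < e, (forall x, x \in s -> 0 <= x.1 /\ 0 <= x.2) &
      forall Q, is_pol r Q ->
        (forall x, x \in s -> (pol_norm r r' x.1 x.2 (Q - P)%R < e%:E)%E) ->
        A Q]].

Definition maps_pol (r : R) (f : pol -> pol) : Prop :=
  forall P, is_pol r P -> is_pol r (f P).

Definition continuous_pol (r r' : R) (f : pol -> pol) : Prop :=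
  forall P, is_pol r P -> forall A, pol_nbhs r r' (f P) A ->
    pol_nbhs r r' P (f @^-1` A).

(* P is expanded as the sum over words w of P_w (x) e_{w_1} \/ ... \/ e_{w_k},
   and the formulas on such elements are extended (bi)linearly. *)
Definition neumaier_Delta (P : pol) : pol :=
  \sum_(w \in [set: seq 'I_n]) \sum_(l < size w)
    elem (lie_derC c (row (tnth (in_tuple w) l) B) (P w))
         (vee R (take l w ++ drop l.+1 w)).

Definition neumaier_coef (kappa : R) (hbar : C) (l : nat) : C :=
  (- ('i%C * (kappa%:C : R[i]) * hbar)) ^+ l / l`!%:R.

Definition neumaier (kappa : R) (hbar : C) (P : pol) : pol :=
  \sum_(l \in [set: nat])
    neumaier_coef kappa hbar l *: iter l neumaier_Delta P.

Definition star_std_gen (hbar : C) (phi : G -> C) (w : seq 'I_n)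
    (psi : G -> C) (eta : tens) : pol :=
  \sum_(p < (size w).+1)
    ((hbar / 'i%C) ^+ p / (p`! * (size w - p)`!)%:R) *:
    \sum_(s : 'S_(size w))
      elem (fun g => phi g * lie_word c B (take p (permute s)) psi g)
           (gutt (structure_const c B) (hbar / 'i%C)
              (vee R (drop p (permute s))) eta).

Definition star_std (hbar : C) (P Q : pol) : pol :=
  \sum_(w \in [set: seq 'I_n]) \sum_(u \in [set: seq 'I_n])
    star_std_gen hbar (P w) w (Q u) (vee R u).

Definition star_kappa (kappa : R) (hbar : C) (P Q : pol) : pol :=
  neumaier (- kappa) hbar
    (star_std hbar (neumaier kappa hbar P) (neumaier kappa hbar Q)).

End Pol.

Section Completion.
Context (R : realType) (n : nat) (G : lieGroupType R n).
Context (c : chart R n G) (B : 'M[R]_n).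
Local Notation C := (R[i]^o).
Local Notation pol := (pol G).

(* The Cauchy condition is the one of the additive group: the uniform structure
   carried by a [tvsType] is not required to be translation invariant. *)
Definition tvs_complete (H : tvsType R[i]) : Prop :=
  forall F : set_system H, ProperFilter F ->
    (forall U : set H, nbhs 0 U -> exists2 A, F A &
       forall x y, A x -> A y -> U (x - y)) ->
    exists l : H, F --> l.

(* (H, j) is a (Hausdorff) completion of Pol_{r,r'}(T^*G); only the values of
   j on Pol matter. *)
Record is_completion (r r' : R) (H : tvsType R[i]) (j : pol -> H) : Prop := {
  compl_hausdorff : hausdorff_space H;
  compl_complete : tvs_complete H;
  compl_linear : forall (a : C) P Q, is_pol c B r P -> is_pol c B r Q ->
    j (a *: P + Q) = a *: j P + j Q;
  compl_embedding : forall P, is_pol c B r P -> forall A : set pol,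
    pol_nbhs c B r r' P A <->
    exists2 U : set H, nbhs (j P) U &
      forall Q, is_pol c B r Q -> U (j Q) -> A Q;
  compl_dense : dense (j @` [set P | is_pol c B r P])
}.

Definition Clinear (H : tvsType R[i]) (f : H -> H) : Prop :=
  forall (a : R[i]) x y, f (a *: x + y) = a *: f x + f y.

(* F is the continuous linear extension of f : Pol -> Pol to the completion. *)
Definition extends_to (r : R) (H : tvsType R[i]) (j : pol -> H)
    (f : pol -> pol) (F : H -> H) : Prop :=
  [/\ maps_pol c B r f, continuous F, Clinear F &
      forall P, is_pol c B r P -> F (j P) = j (f P)].

(* M is a continuous bilinear extension of f : Pol x Pol -> Pol. *)
Definition extends_to2 (r : R) (H : tvsType R[i]) (j : pol -> H)
    (f : pol -> pol -> pol) (M : H -> H -> H) : Prop :=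
  [/\ forall P Q, is_pol c B r P -> is_pol c B r Q -> is_pol c B r (f P Q),
      continuous (fun x : H * H => M x.1 x.2),
      (forall x, Clinear (M x)) /\ (forall y, Clinear (fun x => M x y)) &
      forall P Q, is_pol c B r P -> is_pol c B r Q ->
        M (j P) (j Q) = j (f P Q)].

Definition entire (H : tvsType R[i]) (f : C -> H) : Prop :=
  forall z : C, exists l : H,
    (fun h : C => (h^-1 : R[i]) *: (f (z + h) - f z)) @ 0^' --> l.

End Completion.

(* Main.v *)
(* Expanding along words in the basis identifies Pol with the finitely supported
   symmetric families (P_w) of elements of E_R(G), and its topology is given by
   the norms nu_c(P) = sum_w |w|!^R' c^|w| q_{R,c}(P_w), because the projective
   power of an l^1-norm is the l^1-norm of the coefficients.  The Leibniz rule
   gives q_c(f g) <= q_c'(f) q_c'(g) for R >= 0, and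
   q_c(L_w f) <= |w|!^(1 - R) q_c'(f) for all R, whence
   T^l nu_c(Delta^l P / l!) <= nu_c'(P) for every T as soon as R + R' >= 1.
   A quantitative Poincare-Birkhoff-Witt theorem bounds the coefficient of z^m in
   the Gutt product of two symmetrized words a and b by K^(|a| + |b|) m!; its
   uniqueness part pairs tensors with left-invariant differential operators
   applied to products of coordinates.  Hence N_kappa and the star product are
   power series in hbar whose coefficients M_m satisfy
   T^m nu_c(M_m(P, Q)) <= nu_c'(P) nu_c'(Q) for every T.  Such series extend to
   the completion coefficient by coefficient and have entire sums there. *)
Require Import Defs.
From mathcomp Require Import all_boot all_order all_algebra perm.
From mathcomp Require Import ring lra zify.
From mathcomp Require Import complex.
From mathcomp Require Import all_classical all_reals all_analysis.

Set Implicit Arguments.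
Unset Strict Implicit.
Unset Printing Implicit Defensive.

Import Order.TTheory GRing.Theory Num.Theory.
Import numFieldNormedType.Exports.

Local Open Scope classical_set_scope.
Local Open Scope ring_scope.
Local Notation is_sym := Defs.is_sym.

(** * Sums over words *)

(** Continuity for each fixed [hbar] would not give entire dependence, and a bound with one
    geometric factor would only give a disc; hence the estimates for whole families of coefficients,
    with a free [T] and a seminorm chosen before the index. The Gutt product is defined separately
    at [z = 0] and by a choice elsewhere, so a formula polynomial in [z] needs existence and
    uniqueness in the enveloping algebra. Existence must come with norms: letters are multiplied
    onto a symmetric tensor one at a time, and the product is solved for by a recursion in [ad]. The
    shares of the contractions add up to at most 1, so a step that lowers the degree by [j] costs
    only [bnorm ^ j] and a falling factorial. In the end [k ^_ m <= 2 ^ k * m!], and this [m!] is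
    what the weight [m!^r'] can absorb, like the [p!] left by [p] derivatives once the sum over
    permutations has cancelled the denominators. The completion is given by its defining properties
    only, without seminorms; extensions to it are limits along sequences, which suffice because
    countably many norms generate the topology. *)

Section WordSums.
Context (n : nat).
Local Notation W := (seq 'I_n).

(** Recursion on the length, instead of a sum over [k.-tuple 'I_n], lets letters be peeled off and
    words be concatenated without casts between tuple types. *)
Fixpoint wsum (V : nmodType) (k : nat) (F : W -> V) : V :=
  if k is k'.+1 then \sum_i wsum k' (fun w => F (i :: w)) else F [::].

Lemma wsum_tuple (V : nmodType) k (F : W -> V) :
  \sum_(w : k.-tuple 'I_n) F w = wsum k F.
Proof.
elim: k F => [|k IH] F /=.
  rewrite (big_pred1 [tuple]) //= => w; apply/esym/eqP.
  by rewrite tuple0.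
under [RHS]eq_bigr do rewrite -IH.
rewrite pair_big /=.
rewrite (reindex (fun p : 'I_n * k.-tuple 'I_n => [tuple of p.1 :: p.2])) //=.
exists (fun w => (thead w, [tuple of behead w])) => [[i w] _|w _] /=.
  by congr pair; apply: val_inj.
by rewrite [RHS]tuple_eta; apply: val_inj.
Qed.

Lemma wsumS (V : nmodType) k (F : W -> V) :
  wsum k.+1 F = \sum_i wsum k (fun w => F (i :: w)).
Proof. by []. Qed.

Lemma eq_wsum (V : nmodType) k (F F' : W -> V) :
  (forall w, size w = k -> F w = F' w) -> wsum k F = wsum k F'.
Proof.
elim: k F F' => [|k IH] F F' E /=; first exact: E.
by apply: eq_bigr => i _; apply: IH => w sw; apply: E; rewrite /= sw.
Qed.

Lemma wsum0 (V : nmodType) k : wsum k (fun=> 0 : V) = 0.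
Proof. by elim: k => //= k ->; rewrite big1. Qed.

Lemma wsum_eq0 (V : nmodType) k (F : W -> V) :
  (forall w, size w = k -> F w = 0) -> wsum k F = 0.
Proof. by move=> /eq_wsum ->; apply: wsum0. Qed.

Lemma wsumD (V : nmodType) k (F F' : W -> V) :
  wsum k (fun w => F w + F' w) = wsum k F + wsum k F'.
Proof.
elim: k F F' => //= k IH F F'; under eq_bigr do rewrite IH.
by rewrite big_split.
Qed.

Lemma wsumB (V : zmodType) k (F F' : W -> V) :
  wsum k (fun w => F w - F' w) = wsum k F - wsum k F'.
Proof.
elim: k F F' => //= k IH F F'; under eq_bigr do rewrite IH.
by rewrite sumrB.
Qed.

Lemma wsum_sum (V : nmodType) (I : Type) (r : seq I) (P : pred I) k
    (F : I -> W -> V) :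
  wsum k (fun w => \sum_(i <- r | P i) F i w) =
  \sum_(i <- r | P i) wsum k (F i).
Proof.
elim: k F => //= k IH F; under eq_bigr do rewrite IH.
by rewrite exchange_big.
Qed.

Lemma wsum_wsum (V : nmodType) j k (F : W -> W -> V) :
  wsum j (fun u => wsum k (F u)) = wsum k (fun v => wsum j (F^~ v)).
Proof.
elim: j F => //= j IH F; under eq_bigr do rewrite IH.
by rewrite wsum_sum.
Qed.

Lemma wsum_additive (U V : nmodType) (f : U -> V) k (F : W -> U) :
  f 0 = 0 -> {morph f : x y / x + y} -> f (wsum k F) = wsum k (fun w => f (F w)).
Proof.
move=> f0 fD; elim: k F => //= k IH F.
by rewrite (big_morph f fD f0); apply: eq_bigr => i _.
Qed.

Lemma wsum_mull (K : pzRingType) k (F : W -> K) a :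
  wsum k (fun w => a * F w) = a * wsum k F.
Proof. by rewrite (wsum_additive _ _ (mulr0 a) (mulrDr a)). Qed.

Lemma wsum_mulr (K : pzRingType) k (F : W -> K) a :
  wsum k (fun w => F w * a) = wsum k F * a.
Proof.
by rewrite (wsum_additive (f := fun x => x * a)) ?mul0r// => x y; rewrite mulrDl.
Qed.

Lemma wsum_scale (K : pzRingType) (V : lmodType K) k (F : W -> V) a :
  wsum k (fun w => a *: F w) = a *: wsum k F.
Proof. by rewrite (wsum_additive _ _ (scaler0 _ a) (scalerDr a)). Qed.

Lemma wsum_cat (V : nmodType) j k (F : W -> V) :
  wsum (j + k) F = wsum j (fun u => wsum k (fun v => F (u ++ v))).
Proof.
by elim: j F => //= j IH F; apply: eq_bigr => i _; rewrite IH.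
Qed.

Lemma wsum_rcons (V : nmodType) k (F : W -> V) :
  wsum k.+1 F = wsum k (fun w => \sum_i F (rcons w i)).
Proof.
rewrite -addn1 wsum_cat; apply: eq_wsum => w _ /=.
by apply: eq_bigr => i _; rewrite cats1.
Qed.

Lemma ler_wsum (K : numDomainType) k (F F' : W -> K) :
  (forall w, size w = k -> F w <= F' w) -> wsum k F <= wsum k F'.
Proof.
elim: k F F' => [|k IH] F F' E /=; first exact: E.
by apply: ler_sum => i _; apply: IH => w sw; apply: E; rewrite /= sw.
Qed.

Lemma wsum_ge0 (K : numDomainType) k (F : W -> K) :
  (forall w, size w = k -> 0 <= F w) -> 0 <= wsum k F.
Proof. by move=> F0; rewrite -(wsum0 _ k); apply: ler_wsum. Qed.

Lemma wsum_ge (K : numDomainType) k (F : W -> K) u :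
  (forall w, 0 <= F w) -> size u = k -> F u <= wsum k F.
Proof.
elim: k F u => [|k IH] F [|i u] //= F0 [su].
rewrite (bigD1 i)//= (le_trans (IH (fun w => F (i :: w)) u _ su))//.
by rewrite lerDl sumr_ge0// => j _; apply: wsum_ge0.
Qed.

Lemma wsum_norm (K : numDomainType) (V : normedZmodType K) k (F : W -> V) :
  `|wsum k F| <= wsum k (fun w => `|F w|).
Proof.
elim: k F => //= k IH F; apply: (le_trans (ler_norm_sum _ _ _)).
exact: ler_sum.
Qed.

(** Isolates the letter in position [l], which [neumaier_Delta] differentiates along and omits. The
    default 0 is never reached, since words of length [k.+1] have a letter there. *)
Lemma wsum_take_drop (V : nmodType) k l (F : W -> W -> 'I_n -> V) :
  (l <= k)%N ->
  wsum k.+1 (fun w => if drop l w is i :: v then F (take l w) v i else 0) =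
  \sum_i wsum k (fun w => F (take l w) (drop l w) i).
Proof.
move=> lk; rewrite -(subnKC lk) -addnS wsum_cat.
rewrite -[RHS]wsum_sum wsum_cat; apply: eq_wsum => u su.
under eq_wsum do rewrite drop_size_cat// take_size_cat//.
rewrite /= -wsum_sum; apply: eq_wsum => v _.
by apply: eq_bigr => i _; rewrite drop_size_cat// take_size_cat.
Qed.

Lemma wsum_insert (V : nmodType) k l (F : W -> V) : (l <= k)%N ->
  \sum_i wsum k (fun w => F (take l w ++ i :: drop l w)) = wsum k.+1 F.
Proof.
move=> lk; rewrite -(wsum_take_drop (fun u v i => F (u ++ i :: v)) lk).
apply: eq_wsum => w sw; case E: (drop l w) => [|i v]; last by rewrite -E cat_take_drop.
by move/(congr1 size): E; rewrite size_drop sw subSn.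
Qed.

Lemma wsum_splits (V : nmodType) k (F : W -> W -> V) :
  wsum k (fun w => \sum_(j < (size w).+1) F (take j w) (drop j w)) =
  \sum_(j < k.+1) wsum j (fun u => wsum (k - j) (F u)).
Proof.
transitivity (wsum k (fun w => \sum_(j < k.+1) F (take j w) (drop j w))).
  by apply: eq_wsum => w ->.
rewrite wsum_sum; apply: eq_bigr => -[j /= jk] _.
rewrite -{1}(subnKC (ltnSE jk)) wsum_cat; apply: eq_wsum => u su.
by apply: eq_wsum => v _; rewrite take_size_cat// drop_size_cat.
Qed.

Lemma wsum_pred1 (V : nmodType) k (F : W -> V) u : size u = k ->
  (forall w, size w = k -> w != u -> F w = 0) -> wsum k F = F u.
Proof.
elim: k F u => [|k IH] F [|i u] //= [su] F0.
rewrite (bigD1 i)//= (IH _ u)// => [|w sw wu].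
  rewrite big1 ?addr0// => j ji; apply: wsum_eq0 => w sw.
  by apply: F0; rewrite /= ?sw// eqseq_cons negb_and ji.
by apply: F0; rewrite /= ?sw// eqseq_cons eqxx.
Qed.

(** A duplicate-free list, through which the finitely supported sums over all words in the
    definitions become sums over degrees. *)
Definition words D : seq W :=
  flatten [seq [seq tval w | w <- enum {: k.-tuple 'I_n}] | k <- iota 0 D].

Lemma mem_words D w : (w \in words D) = (size w < D)%N.
Proof.
apply/flattenP/idP => [[s /mapP[k]]|sw].
  by rewrite mem_iota add0n => kD -> /mapP[x _ ->]; rewrite size_tuple.
exists [seq tval w | w <- enum {: (size w).-tuple 'I_n}].
  by apply/mapP; exists (size w) => //; rewrite mem_iota.
by apply/mapP; exists (in_tuple w) => //; rewrite mem_enum.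
Qed.

Lemma uniq_words D : uniq (words D).
Proof.
rewrite /words; elim: (iota 0 D) (iota_uniq 0 D) => //= k s IH /andP[ks us].
rewrite cat_uniq IH// andbT map_inj_uniq ?enum_uniq//=; last exact: val_inj.
apply/hasPn => w /flattenP[t /mapP[l ls ->] /mapP[x _ ->]].
apply/mapP => -[y _ E]; move: ks.
by rewrite -(size_tuple y) -E size_tuple ls.
Qed.

Lemma big_words (V : nmodType) D (F : W -> V) :
  \sum_(w <- words D) F w = \sum_(k < D) wsum k F.
Proof.
rewrite big_flatten big_map /= -(subn0 D) -/(index_iota 0 D) big_mkord.
rewrite subn0; apply: eq_bigr => k _; rewrite -wsum_tuple big_map.
by rewrite big_enum.
Qed.

Lemma fsum_words (V : nmodType) D (F : W -> V) :
  (forall w, (D <= size w)%N -> F w = 0) ->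
  \sum_(w \in [set: W]) F w = \sum_(k < D) wsum k F.
Proof.
move=> F0; rewrite (fsbigE (words D)) ?uniq_words//=.
  rewrite (eq_bigl xpredT) => [|w]; last by rewrite classical_sets.in_setT.
  exact: big_words.
by move=> w _; rewrite mem_words -leqNgt => /F0.
Qed.

End WordSums.

(** The reindexing behind every Cauchy product below: summation by diagonals against summation by
    rows. *)
Lemma big_triangle (V : nmodType) (F : nat -> nat -> V) K :
  \sum_(k < K) \sum_(j < k.+1) F j (k - j)%N = \sum_(i < K) \sum_(j < K - i) F i j.
Proof.
elim: K => [|K IH]; first by rewrite !big_ord0.
rewrite big_ord_recr/= IH [RHS]big_ord_recr/= subSnn big_ord1.
rewrite [X in _ + X]big_ord_recr/= subnn addrA; congr (_ + _).
rewrite -big_split/=; apply: eq_bigr => i _.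
by rewrite subSn ?(ltnW (ltn_ord i))// big_ord_recr.
Qed.

(** * Real-analytic functions of several variables *)

Section RowNeighborhoods.
Context (R : realType) (m : nat).

Lemma near_rowP (x : 'rV[R]_m) (P : set 'rV[R]_m) :
  (\forall y \near x, P y) <->
  exists2 e : R, 0 < e & forall h : 'rV[R]_m, (forall i, `|h 0 i| < e) -> P (x + h).
Proof.
split.
  move=> /nbhs_ballP[e /= e0 Pe]; exists e => // h he; apply: Pe; split=> // i j.
  by rewrite !ord1 !mxE /ball/= opprD addNKr normrN; apply: he.
move=> [e e0 Pe]; apply/nbhs_ballP; exists e => //= y yx.
rewrite -[y](subrKC x); apply: Pe => i.
by have := yx.2 0 i; rewrite /ball/= !mxE distrC.
Qed.

End RowNeighborhoods.

(** * Power series with coefficients indexed by words *)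

Section PowerSeries.
Context (R : realType).

Lemma cvg_series_half (u : nat -> R) (M : R) :
  (forall k, `|u k| <= M * 2^-1 ^+ k) -> cvgn (series u).
Proof.
move=> uM; apply: normed_cvg; apply: (@series_le_cvg _ _ (geometric M 2^-1)) => //.
- by move=> k /=.
- by move=> k /=; apply: le_trans (uM k).
- by apply: is_cvg_geometric_series; rewrite ger0_norm ?invf_lt1 ?ltr1n.
Qed.

Lemma sum_half_le (K : nat) : \sum_(0 <= k < K) (2^-1 : R) ^+ k <= 2.
Proof.
have E : \sum_(0 <= k < K) (2^-1 : R) ^+ k = 2 - 2 * 2^-1 ^+ K.
  elim: K => [|K IH]; first by rewrite big_geq// expr0; lra.
  by rewrite big_nat_recr//= IH exprS; lra.
by rewrite E gerBl mulr_ge0 ?exprn_ge0.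
Qed.

Lemma cvg_sumr (T I : Type) (F : set_system T) (s : seq I) (f : I -> T -> R)
    (l : I -> R) : Filter F -> (forall i, f i @ F --> l i) ->
  (fun x => \sum_(i <- s) f i x) @ F --> \sum_(i <- s) l i.
Proof.
move=> FF fl; elim: s => [|i s IH].
  by under eq_fun do rewrite big_nil; rewrite big_nil; apply: cvg_cst.
by under eq_fun do rewrite big_cons; rewrite big_cons; apply: cvgD.
Qed.

Lemma succ_le_pow2 (k : nat) : (k.+1%:R <= 2 ^+ k :> R).
Proof. by rewrite -natrX ler_nat ltn_expl. Qed.

Context (m : nat).
Local Notation W := (seq 'I_m).
Implicit Types (a : W -> R) (h x : 'rV[R]_m) (w : W).

Definition mono h w : R := \prod_(i <- w) h 0 i.

Lemma mono_cons h i w : mono h (i :: w) = h 0 i * mono h w.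
Proof. by rewrite /mono big_cons. Qed.

Lemma mono_nil h : mono h [::] = 1.
Proof. by rewrite /mono big_nil. Qed.

Lemma mono_cat h u v : mono h (u ++ v) = mono h u * mono h v.
Proof. by rewrite /mono big_cat. Qed.

Lemma mono_le h s w : (forall i, `|h 0 i| <= s) -> `|mono h w| <= s ^+ size w.
Proof.
move=> hs; elim: w => [|i w IH]; first by rewrite mono_nil normr1.
by rewrite mono_cons normrM /= exprS ler_pM.
Qed.

Definition hom a h k : R := wsum k (fun w => a w * mono h w).
Definition absum a k : R := wsum k (fun w => `|a w|).

Lemma absum_ge0 a k : 0 <= absum a k.
Proof. exact: wsum_ge0. Qed.

Lemma hom_le a h s k : (forall i, `|h 0 i| <= s) -> `|hom a h k| <= absum a k * s ^+ k.
Proof.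
move=> hs; apply: (le_trans (wsum_norm _ _)); rewrite -wsum_mulr.
by apply: ler_wsum => w <-; rewrite normrM ler_wpM2l ?mono_le.
Qed.

(** Quantitative form of [analytic_at]. The sum is only claimed up to radius [1 / (8 * rho)], well
    inside the domain of convergence; the spare geometric factor pays for products, derivatives and
    remainders. *)
Definition expansion (f : 'rV[R]_m -> R) x a (M rho : R) : Prop :=
  [/\ 0 < rho, forall k, absum a k <= M * rho ^+ k &
    forall h, (forall i, `|h 0 i| <= (8 * rho)^-1) ->
      series (hom a h) @ \oo --> f (x + h)].

Lemma expansion_ge0 f x a M rho : expansion f x a M rho -> 0 <= M.
Proof.
by move=> [_ /(_ 0) + _]; rewrite expr0 mulr1; apply: le_trans (absum_ge0 _ _).
Qed.

Lemma expansion_widen f x a M rho rho' : rho <= rho' ->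
  expansion f x a M rho -> expansion f x a M rho'.
Proof.
move=> rr E; have M0 := expansion_ge0 E; have [r0 aM cv] := E.
have r'0 := lt_le_trans r0 rr; split=> // [k|h hr].
  by rewrite (le_trans (aM k))// ler_wpM2l// lerXn2r// nnegrE ltW.
apply: cv => i; apply: (le_trans (hr i)).
by rewrite lef_pV2 ?posrE ?mulr_gt0// ler_pM2l.
Qed.

Lemma hom_bound a M rho h s k : 0 < rho -> (forall k, absum a k <= M * rho ^+ k) ->
  (forall i, `|h 0 i| <= s) -> 0 <= s -> s * rho <= 2^-1 ->
  `|hom a h k| <= M * 2^-1 ^+ k.
Proof.
move=> r0 aM hs s0 sr; apply: (le_trans (hom_le _ _ hs)).
have M0 : 0 <= M by have := aM 0%N; rewrite expr0 mulr1; apply: le_trans (absum_ge0 _ _).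
apply: (@le_trans _ _ (M * (s * rho) ^+ k)); last first.
  by rewrite ler_wpM2l// lerXn2r// nnegrE ?mulr_ge0// ltW.
by rewrite exprMn mulrA mulrAC ler_wpM2r ?exprn_ge0.
Qed.

Lemma analytic_atP f x :
  analytic_at f x <-> exists a M rho, expansion f x a M rho.
Proof.
split.
  (* At the point with all coordinates [r / 2] every monomial of degree [k] equals [(r / 2) ^ k], so
     the boundedness of the terms of one convergent series bounds [absum a k] with [rho = 2 / r]. *)
  move=> [a [r [r0 E]]]; pose h0 : 'rV[R]_m := \row_i (r / 2).
  have [|c _] := E h0.
    by move=> i; rewrite mxE ger0_norm ?divr_ge0// ?ltW// gtr_pMr// invf_lt1 ?ltr1n.
  have {c} [M [_ MP]] := cvg_series_bounded c.
  exists a, (`|M| + 1), (2 / r); split; first by rewrite divr_gt0.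
    move=> k; have := MP (`|M| + 1) _ k I; have -> : M < `|M| + 1 by rewrite (le_lt_trans (ler_norm M))// ltrDl.
    move=> /(_ isT) /=.
    rewrite (wsum_tuple k (fun w => `|a w * \prod_(i <- w) h0 0 i|)).
    rewrite (eq_wsum (F' := fun w => `|a w| * (r / 2) ^+ k)); last first.
      move=> w sw; rewrite normrM -sw; congr (_ * _).
      rewrite (_ : \prod_(i <- w) h0 0 i = (r / 2) ^+ size w); last first.
        by elim: (w) => [|i u IH]; rewrite ?big_nil// big_cons IH mxE exprS.
      by rewrite ger0_norm// exprn_ge0// divr_ge0 ?ltW.
    rewrite wsum_mulr -/(absum a k) ger0_norm; last first.
      by rewrite mulr_ge0 ?absum_ge0// exprn_ge0// divr_ge0 ?ltW.
    by rewrite -ler_pdivlMr ?exprn_gt0 ?divr_gt0// -exprVn invf_div.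
  move=> h hr; have [i|_] := E h.
    apply: (le_lt_trans (hr i)); rewrite invfM invf_div mulrCA gtr_pMr//; lra.
  rewrite (_ : (fun k => _) = hom a h)//.
  by apply/funext => k; rewrite (wsum_tuple k (fun w => a w * mono h w)).
move=> [a [M [rho E]]]; have M0 := expansion_ge0 E; have [r0 aM cv] := E.
exists a, (8 * rho)^-1; split=> [|h hr]; first by rewrite invr_gt0 mulr_gt0.
have hr' i : `|h 0 i| <= (8 * rho)^-1 by exact: ltW.
split; last first.
  rewrite (_ : (fun k => _) = hom a h); first exact: cv.
  by apply/funext => k; rewrite (wsum_tuple k (fun w => a w * mono h w)).
rewrite (_ : (fun k => _) = (fun k => wsum k (fun w => `|a w * mono h w|))); last first.
  by apply/funext => k; rewrite (wsum_tuple k (fun w => `|a w * mono h w|)).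
apply: (@cvg_series_half _ M) => k.
rewrite ger0_norm; last exact: wsum_ge0.
apply: (@le_trans _ _ (absum a k * (8 * rho)^-1 ^+ k)).
  rewrite -wsum_mulr; apply: ler_wsum => w <-.
  by rewrite normrM ler_wpM2l ?mono_le.
apply: (@le_trans _ _ (M * rho ^+ k * (8 * rho)^-1 ^+ k)).
  by rewrite ler_wpM2r ?exprn_ge0// invr_ge0 mulr_ge0// ltW.
rewrite -mulrA -exprMn ler_wpM2l// lerXn2r// ?nnegrE ?mulr_ge0 ?invr_ge0 ?mulr_ge0 ?ltW//.
by rewrite invfM mulrCA divff ?gt_eqF//; lra.
Qed.


Lemma expansionP f x : analytic_at f x -> exists a M rho, expansion f x a M rho.
Proof. by move/analytic_atP. Qed.

Lemma expansion_analytic f x a M rho : expansion f x a M rho -> analytic_at f x.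
Proof. by move=> E; apply/analytic_atP; exists a, M, rho. Qed.

(** Enlarging [rho] by [e^-1] shrinks the polydisc below the radius [e] on which the functions
    agree; the coefficients stay the same. *)
Lemma near_analytic f g x : (\forall y \near x, f y = g y) ->
  analytic_at f x -> analytic_at g x.
Proof.
move=> /near_rowP[e e0 fg] /expansionP[a [M [rho E]]].
have r0 : 0 < rho by case: E.
have rr : rho <= rho + e^-1 by rewrite lerDl invr_ge0 ltW.
have [r'0 aM cv] := expansion_widen rr E.
apply: (@expansion_analytic _ _ a M (rho + e^-1)); split=> // h hr; rewrite -fg; first exact: cv.
move=> i; apply: (le_lt_trans (hr i)).
rewrite invf_plt ?posrE// ?mulr_gt0//.
have : 0 < e^-1 by rewrite invr_gt0.
lra.
Qed.

Lemma expansion_center f x a M rho : expansion f x a M rho -> f x = a [::].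
Proof.
move=> [r0 aM cv].
have hE k : hom a (0 : 'rV[R]_m) k.+1 = 0.
  by apply: wsum_eq0 => -[|i w]// _; rewrite mono_cons mxE mul0r mulr0.
have : series (hom a 0) @ \oo --> f (x + 0).
  by apply: cv => i; rewrite mxE normr0 invr_ge0 mulr_ge0 ?ltW.
rewrite addr0 => c; apply: (cvg_unique _ c) => //=.
rewrite -(cvg_shiftS (series (hom a 0))).
rewrite (_ : (fun k => _) = cst (a [::])); first exact: cvg_cst.
apply/funext => k; rewrite /= /series/= big_nat_recl// big1 ?addr0.
  by rewrite /hom/= mono_nil mulr1.
by move=> i _; rewrite hE.
Qed.

Lemma expansionD f g x a b M M' rho : expansion f x a M rho ->
  expansion g x b M' rho -> 
  expansion (fun y => f y + g y) x (fun w => a w + b w) (M + M') rho.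
Proof.
move=> [r0 aM cf] [_ bM cg]; split=> // [k|h hr].
  rewrite mulrDl; apply: (le_trans _ (lerD (aM k) (bM k))).
  by rewrite -wsumD; apply: ler_wsum => w _; apply: ler_normD.
rewrite (_ : series _ = series (hom a h) + series (hom b h)).
  by apply: cvgD; [exact: cf|exact: cg].
apply/funext => k; rewrite /series/= /series/=.
transitivity (\sum_(0 <= i < k) hom a h i + \sum_(0 <= i < k) hom b h i) => //.
rewrite -big_split/=; apply: eq_bigr => i _; rewrite -wsumD.
by apply: eq_wsum => w _; rewrite mulrDl.
Qed.

Lemma common_rho f g x : analytic_at f x -> analytic_at g x ->
  exists a b M M' rho, expansion f x a M rho /\ expansion g x b M' rho.
Proof.
move=> /expansionP[a [M [rho E]]] /expansionP[b [M' [rho' E']]].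
exists a, b, M, M', (Num.max rho rho').
by split; [apply: expansion_widen E|apply: expansion_widen E'];
   rewrite le_max lexx ?orbT.
Qed.

Lemma analyticD f g x : analytic_at f x -> analytic_at g x ->
  analytic_at (fun y => f y + g y) x.
Proof.
move=> Hf Hg; have [a [b [M [M' [rho [E E']]]]]] := common_rho Hf Hg.
exact: expansion_analytic (expansionD E E').
Qed.

Lemma cvg_series_finite (u : nat -> R) N : (forall k, (N <= k)%N -> u k = 0) ->
  series u @ \oo --> \sum_(0 <= k < N) u k.
Proof.
move=> u0; rewrite -(cvg_shiftn N).
rewrite (_ : (fun k => _) = cst (\sum_(0 <= k < N) u k)); first exact: cvg_cst.
apply/funext => k; rewrite /series/= (big_cat_nat (n := N)) ?leq_addl//=.
by rewrite [X in _ + X]big_nat_cond [X in _ + X]big1 ?addr0// => i /andP[/andP[/u0]].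
Qed.

Lemma analytic_affine f x v (l : 'I_m -> R) :
  (forall h, f (x + h) = v + \sum_i l i * h 0 i) -> analytic_at f x.
Proof.
move=> fE; pose a (w : W) : R := match w with [::] => v | [:: i] => l i | _ => 0 end.
pose M := `|v| + \sum_i `|l i|.
have M0 : 0 <= M by rewrite addr_ge0 ?sumr_ge0.
have a2 k : wsum k.+2 (fun w => `|a w|) = 0.
  by apply: wsum_eq0 => -[|i [|j w]]//= _; rewrite normr0.
apply: (@expansion_analytic _ _ a M 1); split=> // [[|[|k]]|h hr].
- by rewrite expr1n mulr1 /absum/= lerDl sumr_ge0.
- by rewrite expr1n mulr1 /absum/= lerDr.
- by rewrite expr1n mulr1 /absum a2.
rewrite fE; have := @cvg_series_finite (hom a h) 2.
rewrite big_nat_recl// big_nat1 /hom/= mono_nil mulr1.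
under eq_bigr do rewrite mono_cons mono_nil mulr1.
apply=> -[|[|k]]// _; apply: wsum_eq0 => -[|i [|j w]]//= _.
by rewrite mul0r.
Qed.

Lemma analytic_cst v x : analytic_at (fun=> v) x.
Proof.
apply: (@analytic_affine _ x v (fun=> 0)) => h; rewrite big1 ?addr0// => i _.
by rewrite mul0r.
Qed.

(** The product of two partial sums and the partial sum of the Cauchy product differ by the terms
    with [i + j >= K]: at most [K ^ 2 <= 4 ^ K] of them, each at most [M * M' * 8^-1 ^+ K]. *)
Lemma cauchy_product (u v : nat -> R) (M M' s t : R) :
  (forall k, `|u k| <= M * 8^-1 ^+ k) -> (forall k, `|v k| <= M' * 8^-1 ^+ k) ->
  series u @ \oo --> s -> series v @ \oo --> t ->
  series (fun k => \sum_(j < k.+1) u j * v (k - j)%N) @ \oo --> s * t.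
Proof.
move=> uM vM us vt.
have M0 : 0 <= M by have := uM 0%N; rewrite expr0 mulr1; apply: le_trans.
have M'0 : 0 <= M' by have := vM 0%N; rewrite expr0 mulr1; apply: le_trans.
pose w k := \sum_(j < k.+1) u j * v (k - j)%N.
have wE K : \sum_(0 <= k < K) w k =
    \sum_(0 <= i < K) \sum_(0 <= j < K - i) u i * v j.
  elim: K => [|K IH]; first by rewrite !big_geq.
  rewrite big_nat_recr//= IH [in RHS]big_nat_recr//= subSnn big_nat1.
  rewrite /w big_ord_recr/= subnn addrA; congr (_ + _).
  rewrite -(big_mkord xpredT (fun j => u j * v (K - j)%N)) -big_split/=.
  apply: eq_big_nat => i /andP[_ iK].
  by rewrite subSn ?(ltnW iK)// big_nat_recr.
have dE K : series u K * series v K - series w K =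
    \sum_(0 <= i < K) \sum_(K - i <= j < K) u i * v j.
  rewrite /series/= wE mulr_suml -sumrB; apply: eq_big_nat => i /andP[_ iK].
  rewrite mulr_sumr (big_cat_nat (n := (K - i)%N)) ?leq_subr//=.
  by rewrite addrC addrK.
have dB K : `|series u K * series v K - series w K| <= M * M' * 2^-1 ^+ K.
  rewrite dE; apply: (le_trans (ler_norm_sum _ _ _)).
  apply: (@le_trans _ _ (\sum_(0 <= i < K) (K%:R * (M * M' * 8^-1 ^+ K)))).
    apply: ler_sum_nat => i /andP[_ iK]; apply: (le_trans (ler_norm_sum _ _ _)).
    apply: (@le_trans _ _ (\sum_(K - i <= j < K) (M * M' * 8^-1 ^+ K))).
      apply: ler_sum_nat => j /andP[jK _]; rewrite normrM.
      apply: (le_trans (ler_pM _ _ (uM i) (vM j))) => //.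
      rewrite mulrACA -exprD ler_wpM2l ?mulr_ge0//.
      by rewrite ler_wiXn2l ?invr_ge0 ?invf_le1//; lia || lra || lia.
    rewrite sumr_const_nat -[X in X <= _]mulr_natl ler_wpM2r ?mulr_ge0 ?exprn_ge0//.
    by rewrite ler_nat; lia.
  rewrite sumr_const_nat subn0 -[X in X <= _]mulr_natl mulrA mulrCA ler_wpM2l ?mulr_ge0//.
  rewrite (_ : 8^-1 = 2^-1 * 4^-1 :> R); last by lra.
  rewrite exprMn mulrCA ler_piMr ?exprn_ge0// exprVn ler_pdivrMr ?exprn_gt0// mul1r.
  rewrite (_ : 4 = 2 * 2 :> R); last by lra.
  have K2 : K%:R <= 2 ^+ K :> R.
    by rewrite -natrX ler_nat ltnW// ltn_expl.
  by rewrite exprMn ler_pM.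
have d0 : (fun K => series u K * series v K - series w K) @ \oo --> (0 : R).
  have g0 : (geometric (M * M') (2^-1)) @ \oo --> (0 : R).
    by apply: cvg_geometric; rewrite ger0_norm ?invf_lt1 ?ltr1n.
  apply: (@squeeze_cvgr _ _ _ _ (fun K => - (geometric (M * M') (2^-1)) K)
     (geometric (M * M') (2^-1))) => //; last first.
    by rewrite -oppr0; exact: cvgN.
  by apply: nearW => K; rewrite -ler_norml; apply: dB.
rewrite (_ : series w =
  (fun K => series u K * series v K - (series u K * series v K - series w K))).
  by rewrite -[s * t]subr0; apply: cvgB => //; apply: cvgM.
by apply/funext => K; rewrite opprB addrC subrK.
Qed.

(** The product of the free algebra; on commuting coordinates it evaluates to the Cauchy product. *)
Definition conv (K : pzRingType) (a b : W -> K) : W -> K :=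
  fun w => \sum_(k < (size w).+1) a (take k w) * b (drop k w).

Lemma hom_conv a b h k :
  hom (conv a b) h k = \sum_(j < k.+1) hom a h j * hom b h (k - j).
Proof.
transitivity (wsum k (fun w => \sum_(j < (size w).+1)
    ((a (take j w) * mono h (take j w)) * (b (drop j w) * mono h (drop j w))))).
  apply: eq_wsum => w _; rewrite mulr_suml; apply: eq_bigr => j _.
  by rewrite mulrACA -mono_cat cat_take_drop.
rewrite (wsum_splits k
   (fun u v => a u * mono h u * (b v * mono h v))).
by apply: eq_bigr => j _; rewrite -wsum_mulr; apply: eq_wsum => u _; rewrite wsum_mull.
Qed.

Lemma absum_conv a b k :
  absum (conv a b) k <= \sum_(j < k.+1) absum a j * absum b (k - j).
Proof.
apply: (@le_trans _ _ (wsum k (fun w => \sum_(j < (size w).+1)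
    `|a (take j w)| * `|b (drop j w)|))).
  apply: ler_wsum => w _; apply: (le_trans (ler_norm_sum _ _ _)).
  by apply: ler_sum => j _; rewrite normrM.
rewrite (wsum_splits k (fun u v => `|a u| * `|b v|)).
by apply: ler_sum => j _; rewrite -wsum_mulr; apply: ler_wsum => u _; rewrite wsum_mull.
Qed.

(** The [k.+1 <= 2 ^ k] ways to cut a word of length [k] double [rho]. *)
Lemma expansionM f g x a b M M' rho : expansion f x a M rho ->
  expansion g x b M' rho -> 
  expansion (fun y => f y * g y) x (conv a b) (M * M') (2 * rho).
Proof.
move=> Ef Eg; have M0 := expansion_ge0 Ef; have M'0 := expansion_ge0 Eg.
have [r0 aM cf] := Ef; have [_ bM cg] := Eg.
split=> [|k|h hr]; first by rewrite mulr_gt0.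
  apply: (le_trans (absum_conv _ _ _)).
  apply: (@le_trans _ _ (\sum_(j < k.+1) (M * M' * rho ^+ k))).
    apply: ler_sum => -[j /= jk] _.
    apply: (le_trans (ler_pM (absum_ge0 _ _) (absum_ge0 _ _) (aM j) (bM _))).
    by rewrite mulrACA -exprD subnKC.
  rewrite sumr_const card_ord -[X in X <= _]mulr_natl mulrCA ler_wpM2l ?mulr_ge0//.
  by rewrite exprMn ler_wpM2r ?exprn_ge0 ?(ltW r0)// succ_le_pow2.
have hr' i : `|h 0 i| <= (8 * rho)^-1.
  apply: (le_trans (hr i)); rewrite lef_pV2 ?posrE ?mulr_gt0//; lra.
rewrite (_ : hom _ h = fun k => \sum_(j < k.+1) hom a h j * hom b h (k - j)); last first.
  by apply/funext => k; rewrite hom_conv.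
have B c L : 0 <= L -> (forall k, absum c k <= L * rho ^+ k) ->
    forall k, `|hom c h k| <= L * 8^-1 ^+ k.
  move=> L0 cL k; apply: (le_trans (hom_le _ _ hr')).
  apply: (le_trans (ler_wpM2r _ (cL k))).
    by rewrite exprn_ge0// invr_ge0 mulr_ge0// ltW.
  rewrite -mulrA -exprMn (_ : rho * _ = 8^-1)//.
  by rewrite invfM mulrCA divff ?mulr1// gt_eqF.
by apply: (cauchy_product (B _ _ M0 aM) (B _ _ M'0 bM)); [apply: cf|apply: cg].
Qed.

Lemma analyticM f g x : analytic_at f x -> analytic_at g x ->
  analytic_at (fun y => f y * g y) x.
Proof.
move=> Hf Hg; have [a [b [M [M' [rho [E E']]]]]] := common_rho Hf Hg.
exact: expansion_analytic (expansionM E E').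
Qed.

Lemma analytic_sum (I : Type) (r : seq I) (P : pred I) (f : I -> 'rV[R]_m -> R) x :
  (forall i, analytic_at (f i) x) ->
  analytic_at (fun y => \sum_(i <- r | P i) f i y) x.
Proof.
move=> fx; elim: r => [|i r IH].
  by under eq_fun do rewrite big_nil; apply: analytic_cst.
under eq_fun do rewrite big_cons; case: (P i) => //.
exact: analyticD.
Qed.

End PowerSeries.

(** * Linear substitution in power series *)

Section Pullback.
Context (R : realType) (m p : nat) (L : 'M[R]_(p, m)).

(** Coefficients of the series of [a] evaluated at [h *m L], expanded letter by letter. *)
Fixpoint pull (a : seq 'I_m -> R) (v : seq 'I_p) : R :=
  if v is j :: v' then \sum_i L j i * pull (fun w => a (i :: w)) v' else a [::].

Lemma hom_pull a h k : hom (pull a) h k = hom a (h *m L) k.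
Proof.
elim: k a => [|k IH] a; first by rewrite /hom/= !mono_nil.
rewrite /hom/=.
transitivity (\sum_j \sum_i h 0 j * L j i * hom (pull (fun w => a (i :: w))) h k).
  apply: eq_bigr => j _.
  transitivity (wsum k (fun v => \sum_i h 0 j * L j i *
    (pull (fun w => a (i :: w)) v * mono h v))).
    apply: eq_wsum => v _; rewrite mono_cons mulr_suml; apply: eq_bigr => i _; ring.
  by rewrite wsum_sum; apply: eq_bigr => i _; rewrite wsum_mull.
rewrite exchange_big; apply: eq_bigr => i _; rewrite -mulr_suml IH.
rewrite /hom -wsum_mull; apply: eq_wsum => v _; rewrite mono_cons mxE; ring.
Qed.

Let c := \sum_j \sum_i `|L j i|.

Lemma absum_pull a k : absum (pull a) k <= c ^+ k * absum a k.
Proof.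
have c0 : 0 <= c by apply: sumr_ge0 => j _; apply: sumr_ge0.
elim: k a => [|k IH] a; first by rewrite /absum/= expr0 mul1r.
rewrite {1}/absum/= exprS -mulrA mulr_suml; apply: ler_sum => j _.
apply: (@le_trans _ _ (wsum k (fun v => \sum_i `|L j i| *
    `|pull (fun w => a (i :: w)) v|))).
  apply: ler_wsum => v _; apply: (le_trans (ler_norm_sum _ _ _)).
  by apply: ler_sum => i _; rewrite normrM.
rewrite wsum_sum mulr_suml; apply: ler_sum => i _; rewrite wsum_mull ler_wpM2l//.
apply: (le_trans (IH _)); rewrite ler_wpM2l ?exprn_ge0//.
rewrite /absum/= (bigD1 i)//= lerDl; apply: sumr_ge0 => ? _.
exact: wsum_ge0.
Qed.

(** Applied with [L] a block inclusion: it restricts the group multiplication, jointly analytic in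
    both factors, to one factor. *)
Lemma analytic_pull (f : 'rV[R]_m -> R) (g : 'rV[R]_p -> R) x y :
  (forall h, g (y + h) = f (x + h *m L)) -> analytic_at f x -> analytic_at g y.
Proof.
move=> gf /expansionP[a [M [rho E]]]; have M0 := expansion_ge0 E.
have [r0 aM cv] := E.
have c0 : 0 <= c by apply: sumr_ge0 => j _; apply: sumr_ge0.
have c1 : 0 < c + 1 by rewrite ltr_wpDl.
apply: (@expansion_analytic _ _ _ _ (pull a) M ((c + 1) * rho)); split=> [|k|h hr].
- by rewrite mulr_gt0.
- apply: (le_trans (absum_pull _ _)); rewrite exprMn mulrCA.
  apply: ler_pM; rewrite ?exprn_ge0 ?absum_ge0//.
  by rewrite lerXn2r ?nnegrE ?(ltW c1)// lerDl.
rewrite gf (_ : hom _ h = hom a (h *m L)); last by apply/funext => k; rewrite hom_pull.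
apply: cv => i; rewrite mxE; apply: (le_trans (ler_norm_sum _ _ _)).
apply: (@le_trans _ _ (\sum_j (8 * ((c + 1) * rho))^-1 * `|L j i|)).
  by apply: ler_sum => j _; rewrite normrM ler_wpM2r.
have -> : (8 * ((c + 1) * rho))^-1 = (8 * rho)^-1 * (c + 1)^-1 by rewrite !invfM; ring.
rewrite -mulr_sumr -mulrA ler_piMr ?invr_ge0 ?mulr_ge0 ?(ltW r0)//.
rewrite mulrC ler_pdivrMr// mul1r; apply: (@le_trans _ _ c); last by rewrite lerDl.
by apply: ler_sum => j _; rewrite (bigD1 i)//= lerDl sumr_ge0.
Qed.

End Pullback.

(** * Gradients and second derivatives of analytic functions *)

Section Gradient.
Context (R : realType) (m : nat).
Local Notation W := (seq 'I_m).
Implicit Types (a : W -> R) (h k x : 'rV[R]_m) (w : W).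

(** Coefficients of the [i]-th partial derivative: as letters are ordered, every word obtained by
    inserting [i] somewhere in [w] contributes. *)
Definition dsub i a (w : W) : R :=
  \sum_(p < (size w).+1) a (take p w ++ i :: drop p w).

Lemma dsub_cons i a j w : dsub i a (j :: w) = a [:: i, j & w] + dsub i (fun v => a (j :: v)) w.
Proof. by rewrite /dsub big_ord_recl. Qed.

(** Derivative of the monomial of [w] at [h] in the direction [k], by the product rule. *)
Fixpoint dmono h k w : R :=
  if w is i :: w' then k 0 i * mono h w' + h 0 i * dmono h k w' else 0.

Lemma hom_dsub a h k l :
  wsum l.+1 (fun w => a w * dmono h k w) = \sum_i k 0 i * hom (dsub i a) h l.
Proof.
elim: l a => [|l IH] a.
  apply: eq_bigr => i _; rewrite /hom/= /dsub big_ord1/= !mono_nil mulr0 addr0 !mulr1.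
  by rewrite mulrC.
rewrite wsumS.
transitivity (\sum_j (k 0 j * hom (fun w => a (j :: w)) h l.+1 +
    h 0 j * wsum l.+1 (fun w => a (j :: w) * dmono h k w))).
  apply: eq_bigr => j _; rewrite /hom -!wsum_mull -wsumD; apply: eq_wsum => w _ /=; ring.
under eq_bigr do rewrite IH.
transitivity (\sum_i k 0 i * (\sum_j h 0 j * (hom (fun w => a [:: i, j & w]) h l +
   hom (dsub i (fun v => a (j :: v))) h l))).
  under [RHS]eq_bigr do rewrite mulr_sumr.
  under [in RHS]eq_bigr do under eq_bigr do rewrite mulrDr mulrDr.
  under [in RHS]eq_bigr do rewrite big_split.
  rewrite [RHS]big_split big_split/=; congr (_ + _).
    apply: eq_bigr => i _; rewrite /hom/= mulr_sumr; apply: eq_bigr => j _.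
    rewrite -!wsum_mull; apply: eq_wsum => w _; rewrite mono_cons; ring.
  rewrite [RHS]exchange_big; apply: eq_bigr => j _; rewrite mulr_sumr.
  by apply: eq_bigr => i _; rewrite mulrCA.
apply: eq_bigr => i _; congr (_ * _); rewrite /hom/=; apply: eq_bigr => j _.
rewrite -wsumD -wsum_mull; apply: eq_wsum => w _; rewrite mono_cons dsub_cons; ring.
Qed.

Lemma absum_dsub i a l : absum (dsub i a) l <= l.+1%:R * absum a l.+1.
Proof.
apply: (@le_trans _ _ (wsum l (fun w => \sum_(p < l.+1) `|a (take p w ++ i :: drop p w)|))).
  by apply: ler_wsum => w <-; apply: ler_norm_sum.
rewrite wsum_sum; apply: (@le_trans _ _ (\sum_(p < l.+1) absum a l.+1)); last first.
  by rewrite sumr_const card_ord -[X in X <= _]mulr_natl.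
apply: ler_sum => -[p /= pl] _.
rewrite /absum -(wsum_insert (fun w => `|a w|) (ltnSE pl)).
by rewrite (bigD1 i)//= lerDl sumr_ge0// => j _; apply: wsum_ge0.
Qed.

Definition psum a h : R := limn (series (hom a h)).

Lemma expansion_dsub i a (M rho : R) x : 0 < rho -> 0 <= M ->
  (forall k : nat, absum a k <= M * rho ^+ k) ->
  expansion (fun y => psum (dsub i a) (y - x)) x (dsub i a) (M * rho) (2 * rho).
Proof.
move=> r0 M0 aM.
have dM l : absum (dsub i a) l <= M * rho * (2 * rho) ^+ l.
  apply: (le_trans (absum_dsub _ _ _)).
  apply: (le_trans (ler_pM _ (absum_ge0 _ _) (succ_le_pow2 _ l) (aM _))) => //.
  by rewrite exprMn exprS; rewrite le_eqVlt; apply/orP; left; apply/eqP; ring.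
split=> // [|h hr]; first by rewrite mulr_gt0.
rewrite addrC addKr; apply: (cvg_series_half (M := M * rho)) => l.
apply: (@hom_bound _ _ _ (M * rho) (2 * rho) h (8 * (2 * rho))^-1) => //;
  rewrite ?mulr_gt0 ?invr_ge0 ?mulr_ge0 ?(ltW r0)//.
rewrite invfM -mulrA mulVf ?mulr1 ?gt_eqF ?mulr_gt0//; lra.
Qed.

(** An estimate of Cauchy type: an increment of size [t <= d] is controlled by the growth of the
    monomial on the larger polydisc of radius [s + d]. No power of [size w] appears, so the bound
    sums over all degrees. *)
Lemma mono_diff1 h k (s t d : R) w : (forall i, `|h 0 i| <= s) -> (forall i, `|k 0 i| <= t) ->
  0 <= s -> 0 <= t -> t <= d -> 0 < d ->
  `|mono (h + k) w - mono h w| <= t / d * (s + d) ^+ size w.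
Proof.
move=> hs kt s0 t0 td d0; have td0 : 0 <= t / d by rewrite divr_ge0 // ltW.
have hk i : `|(h + k) 0 i| <= s + d.
  by rewrite mxE; apply: (le_trans (ler_normD _ _)); rewrite lerD// (le_trans (kt i)).
elim: w => [|i w IH]; first by rewrite !mono_nil subrr normr0 mulr1.
rewrite !mono_cons mxE /= exprS.
rewrite (_ : _ - _ = h 0 i * (mono (h + k) w - mono h w) + k 0 i * mono (h + k) w); last by ring.
apply: (le_trans (ler_normD _ _)); rewrite !normrM.
apply: (le_trans (lerD (ler_pM _ _ (hs i) IH) (ler_pM _ _ (kt i) (mono_le w hk)))) => //.
rewrite le_eqVlt; apply/orP; left; apply/eqP; field; exact: lt0r_neq0.
Qed.

Lemma mono_diff2 h k (s t d : R) w : (forall i, `|h 0 i| <= s) -> (forall i, `|k 0 i| <= t) ->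
  0 <= s -> 0 <= t -> t <= d -> 0 < d ->
  `|mono (h + k) w - mono h w - dmono h k w| <= (t / d) ^+ 2 * (s + d) ^+ size w.
Proof.
move=> hs kt s0 t0 td d0; have td0 : 0 <= t / d by rewrite divr_ge0 // ltW.
elim: w => [|i w IH]; first by rewrite !mono_nil subrr subr0 normr0 mulr1 exprn_ge0.
rewrite !mono_cons mxE /= [(s + d) ^+ _.+1]exprS.
rewrite (_ : _ - _ - _ = h 0 i * (mono (h + k) w - mono h w - dmono h k w) +
  k 0 i * (mono (h + k) w - mono h w)); last by ring.
apply: (le_trans (ler_normD _ _)); rewrite !normrM.
have D1 := mono_diff1 w hs kt s0 t0 td d0.
apply: (le_trans (lerD (ler_pM _ _ (hs i) IH) (ler_pM _ _ (kt i) D1))) => //.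
rewrite le_eqVlt; apply/orP; left; apply/eqP; field; exact: lt0r_neq0.
Qed.

(** Differentiability with quadratic remainder, uniform in the direction. Power series provide it
    directly, and it makes the gradient unique and the chain rule elementary. *)
Definition qdiff (f : 'rV[R]_m -> R) y (p : 'I_m -> R) : Prop :=
  exists C d : R, 0 < d /\ forall k (t : R), 0 <= t -> t <= d -> (forall i, `|k 0 i| <= t) ->
    `|f (y + k) - f y - \sum_i k 0 i * p i| <= C * t ^+ 2.

Lemma lim_norm_le (u : nat -> R) l C : u @ \oo --> l -> (forall K, `|u K| <= C) -> `|l| <= C.
Proof.
move=> ul uC; have /cvg_lim <- // : (fun K => `|u K|) @ \oo --> `|l| by exact: cvg_norm.
by apply: limr_le; [apply/cvg_ex; exists `|l|; apply: cvg_norm|apply: nearW].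
Qed.

Lemma expansion_qdiff f x a M rho h : expansion f x a M rho ->
  (forall i, `|h 0 i| <= (32 * rho)^-1) ->
  qdiff f (x + h) (fun i => psum (dsub i a) h).
Proof.
move=> E hd; have M0 := expansion_ge0 E; have [r0 aM cv] := E.
(* With this [d], [h] and [h + k] lie within radius [1 / (8 * rho)], [h] lies within the radius
   [1 / (16 * rho)] of the derivative series, and [(d + d) * rho = 1 / 16] makes the remainders
   summable. *)
set d := (32 * rho)^-1 in hd.
have d0 : 0 < d by rewrite invr_gt0 mulr_gt0.
have dr : d * rho = 32^-1 by rewrite /d invfM -mulrA mulVf ?mulr1 ?gt_eqF.
have rE : (8 * rho)^-1 = 4 * d.
  by rewrite /d !invfM; rewrite mulrA; congr (_ * _); lra.
exists (2 * M / d ^+ 2), d; split=> // k t t0 td kt.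
(* The derivative series is cut one degree earlier, because differentiation lowers the degree; thus
   [S K] is exactly the sum of the second-order remainders of the monomials. *)
pose S K := series (hom a (h + k)) K.+1 - series (hom a h) K.+1 -
  \sum_i k 0 i * series (hom (dsub i a) h) K.
apply: (@lim_norm_le S).
  apply: cvgB; last first.
    apply: cvg_sumr => i; apply: cvgMr.
    have [_ _] := expansion_dsub i x r0 M0 aM => /(_ h).
    rewrite addrC addKr; apply => j; apply: (le_trans (hd j)).
    rewrite /d lef_pV2 ?posrE ?mulr_gt0//; lra.
  apply: cvgB.
    have -> : x + h + k = x + (h + k) by rewrite addrA.
    rewrite (cvg_shiftS (series (hom a (h + k)))); apply: cv => i.
    rewrite mxE rE; apply: (le_trans (ler_normD _ _)).
    have := hd i; have := kt i; lra.
  rewrite (cvg_shiftS (series (hom a h))); apply: cv => i.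
  rewrite rE; have := hd i; lra.
move=> K.
have -> : S K = \sum_(0 <= l < K.+1)
    wsum l (fun w => a w * (mono (h + k) w - mono h w - dmono h k w)).
  have hE l : wsum l (fun w => a w * (mono (h + k) w - mono h w - dmono h k w)) =
      hom a (h + k) l - hom a h l - wsum l (fun w => a w * dmono h k w).
    rewrite /hom -[- wsum _ _]mulN1r -[- wsum l (fun w => a w * dmono h k w)]mulN1r.
    rewrite -!wsum_mull -!wsumD; apply: eq_wsum => w _; ring.
  under eq_bigr do rewrite hE.
  rewrite !sumrB /S /series/=; congr (_ - _).
  rewrite [RHS]big_nat_recl// [X in _ = X + _]/= mulr0 add0r.
  under [RHS]eq_bigr do rewrite hom_dsub.
  by rewrite exchange_big; apply: eq_bigr => i _; rewrite mulr_sumr.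
apply: (le_trans (ler_norm_sum _ _ _)).
apply: (@le_trans _ _ (\sum_(0 <= l < K.+1) M * (t / d) ^+ 2 * 2^-1 ^+ l)).
  apply: ler_sum => l _; apply: (le_trans (wsum_norm _ _)).
  apply: (@le_trans _ _ (absum a l * ((t / d) ^+ 2 * (d + d) ^+ l))).
    rewrite -wsum_mulr; apply: ler_wsum => w <-; rewrite normrM ler_wpM2l//.
    by apply: mono_diff2 => //; exact: ltW.
  apply: (@le_trans _ _ (M * rho ^+ l * ((t / d) ^+ 2 * (d + d) ^+ l))).
    by rewrite ler_wpM2r// mulr_ge0 ?exprn_ge0 ?addr_ge0 ?divr_ge0 ?(ltW d0).
  rewrite mulrACA -exprMn ler_wpM2l//.
    by rewrite mulr_ge0 ?exprn_ge0 ?divr_ge0 ?(ltW d0).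
  rewrite lerXn2r ?nnegrE ?mulr_ge0 ?addr_ge0 ?(ltW d0) ?(ltW r0)//.
  by rewrite mulrC mulrDl dr; lra.
rewrite -mulr_sumr; apply: (le_trans (ler_wpM2l _ (sum_half_le _ _))).
  by rewrite mulr_ge0 ?exprn_ge0 ?divr_ge0 ?(ltW d0).
rewrite le_eqVlt; apply/orP; left; apply/eqP; field; exact: lt0r_neq0.
Qed.

Lemma qdiff_unique f y p q : qdiff f y p -> qdiff f y q -> p =1 q.
Proof.
move=> [C [d [d0 H]]] [C' [d' [d'0 H']]] i; apply/eqP; rewrite -subr_eq0 -normr_le0.
apply/ler_addgt0Pr => e e0; rewrite add0r.
pose t := Num.min (Num.min d d') (e / (`|C| + `|C'| + 1)).
have D0 : 0 < `|C| + `|C'| + 1 by rewrite ltr_wpDl.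
have t0 : 0 < t by rewrite !lt_min d0 d'0 divr_gt0.
have td : t <= d by rewrite !ge_min lexx.
have td' : t <= d' by rewrite !ge_min lexx orbT.
pose k : 'rV[R]_m := \row_j (t * (j == i)%:R).
have kt j : `|k 0 j| <= t.
  by rewrite mxE normrM (ger0_norm (ltW t0)) ger_pMr// normr_nat lern1 leq_b1.
have kE (r : 'I_m -> R) : \sum_j k 0 j * r j = t * r i.
  rewrite (bigD1 i)//= mxE eqxx mulr1 big1 ?addr0// => j /negPf ji.
  by rewrite mxE ji mulr0 mul0r.
have := H k t (ltW t0) td kt; have := H' k t (ltW t0) td' kt; rewrite !kE => B' B.
have : `|t * (p i - q i)| <= (`|C| + `|C'|) * t ^+ 2.
  rewrite (_ : t * _ = (f (y + k) - f y - t * q i) - (f (y + k) - f y - t * p i)); last by ring.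
  apply: (le_trans (ler_normB _ _)); rewrite mulrDl addrC lerD//.
    by apply: (le_trans B); rewrite ler_wpM2r ?exprn_ge0 ?ler_norm ?ltW.
  by apply: (le_trans B'); rewrite ler_wpM2r ?exprn_ge0 ?ler_norm ?ltW.
rewrite normrM (ger0_norm (ltW t0)) expr2 mulrCA ler_pM2l// => /le_trans; apply.
apply: (@le_trans _ _ ((`|C| + `|C'| + 1) * t)); first by rewrite ler_wpM2r ?(ltW t0)// lerDl.
by rewrite mulrC -ler_pdivlMr// /t ge_min lexx orbT.
Qed.

(** The second derivatives at the centre are [a [:: i; j] + a [:: j; i]], hence symmetric by
    inspection. *)
Lemma analytic_gradient f x : analytic_at f x ->
  exists g : 'I_m -> 'rV[R]_m -> R,
    [/\ forall i, analytic_at (g i) x,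
        \forall y \near x, qdiff f y (g ^~ y) &
        forall i j, exists2 s : 'I_m -> 'I_m -> R,
          qdiff (g i) x (s i) /\ qdiff (g j) x (s j) & s i j = s j i].
Proof.
move=> /expansionP[a [M [rho E]]]; have M0 := expansion_ge0 E.
have [r0 aM cv] := E.
have Eg i := expansion_dsub i x r0 M0 aM.
exists (fun i y => psum (dsub i a) (y - x)); split.
- by move=> i; exact: (expansion_analytic (Eg i)).
- apply/near_rowP; exists (32 * rho)^-1; first by rewrite invr_gt0 mulr_gt0.
  move=> h hr; have /(expansion_qdiff E) : forall i, `|h 0 i| <= (32 * rho)^-1.
    by move=> i; exact: ltW.
  by under [X in _ -> qdiff _ _ X]eq_fun do rewrite addrC addKr.
have M20 : 0 <= M * rho by rewrite mulr_ge0 // ltW.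
have r20 : 0 < 2 * rho by rewrite mulr_gt0.
have Q i : qdiff (fun y => psum (dsub i a) (y - x)) x (fun j => dsub j (dsub i a) [::]).
  have := @expansion_qdiff _ _ _ _ _ 0 (Eg i).
  have [_ aM' _] := Eg i.
  rewrite addr0 (_ : (fun j => psum _ 0) = (fun j => dsub j (dsub i a) [::])); last first.
    apply/funext => j; have := expansion_dsub j x r20 M20 aM'.
    by move/expansion_center; rewrite subrr.
  by apply => j; rewrite mxE normr0 invr_ge0 mulr_ge0 // mulr_ge0 // ltW.
move=> i j; exists (fun i j => dsub j (dsub i a) [::]); first by split; exact: Q.
by rewrite /dsub !big_ord1/= !big_ord_recl !big_ord0/= !addr0 addrC.
Qed.

End Gradient.

(** * Left-invariant vector fields *)

Section Derivative0.
Context (R : realType).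
Implicit Types (F H : R -> R).

(** Unlike [derive1], which is a mere [lim], this carries the existence of the derivative, as the
    rules for sums, products and composites require. *)
Definition der0 F (l : R) : Prop := (fun t => t^-1 * (F t - F 0)) @ 0^' --> l.

Lemma der0_derive1 F l : der0 F l -> derive1 (F : R -> R^o) 0 = l.
Proof.
move=> Fl; apply: cvg_lim => //.
rewrite (_ : (fun h : R => _) = (fun t => t^-1 * (F t - F 0))); first exact: Fl.
by apply/funext => t; rewrite addr0.
Qed.

Lemma eq_near_cvg_filter (T : Type) (U : nbhsType) (F : set_system T) (f g : T -> U) :
  Filter F -> (\forall x \near F, f x = g x) -> f @ F = g @ F.
Proof.
by move=> FF E; apply/seteqP; split=> A FA; apply: filterS2 E FA => x /= ->.
Qed.

Lemma der0_near F H l : (\forall t \near (0 : R), F t = H t) -> der0 F l -> der0 H l.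
Proof.
move=> FH; apply: cvg_trans; apply: near_eq_cvg.
have <- : F 0 = H 0 by exact: (nbhs_singleton FH).
by apply: cvg_within; move: FH; apply: filterS => t ->.
Qed.

Lemma der0_cst (v : R) : der0 (fun=> v) 0.
Proof.
rewrite /der0 (_ : (fun t : R => _) = cst 0); first exact: cvg_cst.
by apply/funext => t; rewrite subrr mulr0.
Qed.

Lemma der0D F H l m : der0 F l -> der0 H m -> der0 (fun t => F t + H t) (l + m).
Proof.
move=> Fl Hm; rewrite /der0 (_ : (fun t => _) =
  (fun t => t^-1 * (F t - F 0) + t^-1 * (H t - H 0))); first exact: cvgD.
by apply/funext => t; ring.
Qed.

Lemma der0_cvg F l : der0 F l -> F @ 0^' --> F 0.
Proof.
move=> Fl; have : (fun t => t * (t^-1 * (F t - F 0)) + F 0) @ 0^' --> 0 * l + F 0.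
  apply: cvgD; last exact: cvg_cst.
  by apply: cvgM => //; apply: cvg_within; exact: cvg_id.
rewrite mul0r add0r; apply: cvg_trans; apply: near_eq_cvg.
near=> t; rewrite mulrA divff ?mul1r ?subrK//.
by near: t; exact: nbhs_dnbhs_neq.
Unshelve. all: by end_near. Qed.

Lemma der0M F H l m : der0 F l -> der0 H m ->
  der0 (fun t => F t * H t) (l * H 0 + F 0 * m).
Proof.
move=> Fl Hm; have : (fun t => t^-1 * (F t - F 0) * H t + F 0 * (t^-1 * (H t - H 0))) @ 0^'
    --> l * H 0 + F 0 * m.
  apply: cvgD; first by apply: cvgM => //; exact: der0_cvg Hm.
  by apply: cvgM => //; exact: cvg_cst.
apply: cvg_trans; apply: near_eq_cvg.
by apply: nearW => t /=; ring.
Qed.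

Lemma der0_chain (m : nat) (f : 'rV[R]_m -> R) (u : R -> 'rV[R]_m) p (y : 'I_m -> R) :
  qdiff f (u 0) p -> (forall k, der0 (fun t => u t 0 k) (y k)) ->
  der0 (fun t => f (u t)) (\sum_k p k * y k).
Proof.
move=> [C [d [d0 fC]]] uy.
(* [T t] bounds every coordinate increment and so serves as the size in [qdiff]. It tends to 0 while
   [T t / t] stays bounded, so the remainder of order [T t ^ 2] vanishes after division by [t]. *)
pose T t := \sum_k `|u t 0 k - u 0 0 k|.
have T0 : T @ 0^' --> (0 : R).
  rewrite [X in _ --> X](_ : 0 = \sum_(k < m) `|u 0 0 k - u 0 0 k|); last first.
    by rewrite big1// => k _; rewrite subrr normr0.
  apply: cvg_sumr => k; apply: cvg_norm; apply: cvgB; last exact: cvg_cst.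
  exact: der0_cvg (uy k).
have Q : (fun t => \sum_k `|t^-1 * (u t 0 k - u 0 0 k)|) @ 0^' --> \sum_k `|y k|.
  by apply: cvg_sumr => k; apply: cvg_norm; exact: uy.
pose r t := t^-1 * (f (u t) - f (u 0) - \sum_k (u t 0 k - u 0 0 k) * p k).
have r0 : r @ 0^' --> (0 : R).
  apply: norm_cvg0.
  apply: (@squeeze_cvgr _ _ _ _ (fun=> 0)
    (fun t => `|C| * (\sum_k `|t^-1 * (u t 0 k - u 0 0 k)|) * T t)); last first.
  - rewrite -[X in _ --> X](mulr0 (`|C| * \sum_k `|y k|)); apply: cvgM => //.
    by apply: cvgM => //; exact: cvg_cst.
  - exact: cvg_cst.
  near=> t; rewrite normr_ge0/= /r normrM.
  have Tk k : `|u t 0 k - u 0 0 k| <= T t.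
    by rewrite /T (bigD1 k)//= lerDl sumr_ge0.
  have Tt0 : 0 <= T t by apply: sumr_ge0.
  have := fC (u t - u 0) (T t) Tt0 _ _; rewrite subrKC => H.
  have {}H : `|f (u t) - f (u 0) - \sum_k (u t 0 k - u 0 0 k) * p k| <= C * T t ^+ 2.
    rewrite (eq_bigr (fun k => (u t - u 0) 0 k * p k)); last by move=> k _; rewrite !mxE.
    apply: H => [|k]; last by rewrite !mxE; exact: Tk.
    by near: t; move: d0; exact: cvgr_le T0 d.
  have {}H := le_trans H (ler_wpM2r (exprn_ge0 2 Tt0) (ler_norm C)).
  apply: (le_trans (ler_wpM2l (normr_ge0 _) H)).
  rewrite (eq_bigr (fun k => `|t^-1| * `|u t 0 k - u 0 0 k|)); last first.
    by move=> k _; rewrite normrM.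
  by rewrite -mulr_sumr -/(T t) le_eqVlt; apply/orP; left; apply/eqP; ring.
rewrite /der0.
have : (fun t => \sum_k p k * (t^-1 * (u t 0 k - u 0 0 k)) + r t) @ 0^' --> \sum_k p k * y k + 0.
  apply: cvgD => //; apply: cvg_sumr => k; apply: cvgM; [exact: cvg_cst|exact: uy].
rewrite addr0; apply: cvg_trans; apply: near_eq_cvg.
apply: nearW => t; rewrite /r mulrBr addrC -addrA [X in _ + X](_ : _ = 0) ?addr0//.
apply/eqP; rewrite addrC subr_eq0 mulr_sumr; apply/eqP; apply: eq_bigr => k _; ring.
Unshelve. all: by end_near. Qed.

End Derivative0.

(** * Left-invariant derivatives in charts and their commutators *)

Section LieDerivative.
Context (R : realType) (n : nat) (G : lieGroupType R n).
Context (c : chart R n G) (c_atlas : lie_atlas c) (c_unit : cdom c 1%g).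
Implicit Types (d : chart R n G) (g h : G) (f : G -> R) (xi : 'rV[R]_n).

Local Notation gam xi t := (cinv c (cfun c 1%g + t *: xi)).
Local Notation X := (lie_der c).
Definition chart_coord d k : G -> R := fun h => cfun d h 0 k.

Lemma cfunK d g : lie_atlas d -> cdom d g -> cinv d (cfun d g) = g.
Proof. by move=> /lie_charts[_ _ K _ _]; exact: K. Qed.

Lemma cinvK d x : lie_atlas d -> (cfun d @` cdom d) x ->
  cdom d (cinv d x) /\ cfun d (cinv d x) = x.
Proof. by move=> dA [g dg <-]; rewrite cfunK. Qed.

Lemma near_chart d g : lie_atlas d -> cdom d g ->
  \forall x \near cfun d g, (cfun d @` cdom d) x.
Proof.
move=> /lie_charts[_ oi _ _ _] dg; apply: open_nbhs_nbhs; split=> //; exists g.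
Qed.

Lemma cfun_continuous d g : lie_atlas d -> cdom d g -> {for g, continuous (cfun d)}.
Proof.
move=> /lie_charts[od _ _ cf _] dg; move: cf; rewrite continuous_open_subspace//.
by apply; rewrite inE.
Qed.

Lemma cinv_continuous d x : lie_atlas d -> (cfun d @` cdom d) x ->
  {for x, continuous (cinv d)}.
Proof.
move=> /lie_charts[_ oi _ _ ci] dx; move: ci; rewrite continuous_open_subspace//.
by apply; rewrite inE.
Qed.

Lemma mul_gam0 g xi : (g * gam xi (0 : R))%g = g.
Proof. by rewrite scale0r addr0 cfunK// mulg1. Qed.

Lemma mul_gam_cvg g xi : (fun t : R => (g * gam xi t)%g) @ (0 : R) --> g.
Proof.
rewrite -[X in _ --> X](mul_gam0 g xi).
have C1 : {for (0 : R), continuous (fun t : R => cfun c 1%g + t *: xi)}.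
  apply: (@continuousD _ _ R^o); first exact: cst_continuous.
  by move=> t; apply: cvgZr_tmp => //; exact: cvg_id.
have C2 : {for (0 : R), continuous (fun t : R => gam xi t)}.
  apply: (@continuous_comp _ _ _ (fun t : R => cfun c 1%g + t *: xi) (cinv c)) => //.
  by apply: cinv_continuous => //; rewrite scale0r addr0; exists 1%g.
apply: (@continuous_comp _ _ _ (fun t : R => (g, gam xi t))
          (fun x : G * G => (x.1 * x.2)%g) 0); last exact: lie_mul_continuous.
by apply: cvg_pair; [exact: cvg_cst|exact: C2].
Qed.

Lemma near_mul_gam g xi (P : set G) : (\forall h \near g, P h) ->
  \forall t \near (0 : R), P (g * gam xi t)%g.
Proof. exact: (@mul_gam_cvg g xi). Qed.

Lemma near_cdom d g : lie_atlas d -> cdom d g -> \forall h \near g, cdom d h.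
Proof. by move=> /lie_charts[od _ _ _ _] dg; apply: open_nbhs_nbhs. Qed.

Lemma lie_der_near xi f f' g : (\forall h \near g, f h = f' h) -> X xi f g = X xi f' g.
Proof.
move=> /near_mul_gam-/(_ xi) E; rewrite /lie_der /derive1.
have E0 := nbhs_singleton E.
congr (lim _); apply: (@eq_near_cvg_filter _ _ (0 : R)^'); apply: cvg_within; move: E.
by apply: filterS => t E; rewrite !addr0 E E0.
Qed.

(** The components of the field in the chart [d] are partial derivatives of the multiplication map
    at [(x, c(e))] in the direction [(0, xi)], and therefore analytic in [x]. *)
Lemma der0_coord d g xi k : lie_atlas d -> cdom d g ->
  exists2 A : 'rV[R]_n -> R, analytic_at A (cfun d g) &
    \forall x \near cfun d g, der0 (fun t => chart_coord d k (cinv d x * gam xi t)%g) (A x).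
Proof.
move=> dA dg; have gd : cdom d (g * 1)%g by rewrite mulg1.
have [q [qA qn _]] := analytic_gradient (lie_mul_analytic _ _ _ dA c_atlas dA _ _ dg c_unit gd k).
set m := (fun u : 'rV_(n + n) => _) in qn.
exists (fun x => \sum_i q i (row_mx x (cfun c 1%g)) * (row_mx 0 xi : 'rV[R]_(n + n)) 0 i).
  apply: analytic_sum => i; apply: analyticM; last exact: analytic_cst.
  apply: (analytic_pull (L := row_mx 1%:M 0)) (qA i) => h.
  by rewrite mul_mx_row mulmx1 mulmx0 add_row_mx addr0.
move/near_rowP: qn => [e e0 qn]; apply/near_rowP; exists e => // h he.
have := qn (row_mx h 0); rewrite add_row_mx addr0 => Q.
have {}Q : qdiff m (row_mx (cfun d g + h) (cfun c 1%g)) (q^~ (row_mx (cfun d g + h) (cfun c 1%g))).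
  apply: Q => i; rewrite mxE; case: splitP => j _; first exact: he.
  by rewrite mxE normr0.
pose u (t : R) : 'rV[R]_(n + n) := row_mx (cfun d g + h) (cfun c 1%g) + t *: row_mx 0 xi.
have u0 : u 0 = row_mx (cfun d g + h) (cfun c 1%g) by rewrite /u scale0r addr0.
have := @der0_chain R _ m u _ (fun i => (row_mx 0 xi : 'rV[R]_(n + n)) 0 i).
rewrite u0 => /(_ _ Q) H.
apply: der0_near (H _).
  apply: (@filterE _ (nbhs (0 : R))) => t; rewrite /m /u scale_row_mx scaler0 add_row_mx addr0.
  by rewrite row_mxKl row_mxKr.
move=> i; rewrite /der0; apply: (@cvg_trans _ (cst ((row_mx 0 xi : 'rV[R]_(n + n)) 0 i) @ 0^')).
  apply: near_eq_cvg; near=> t.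
  rewrite /u !mxE mul0r addr0 addrAC subrr add0r mulrA mulVf ?mul1r//.
  by near: t; exact: nbhs_dnbhs_neq.
exact: cvg_cst.
Unshelve. all: by end_near. Qed.

(** Chain rule along the curve [g * gam xi t], which stays in the domain of [d] for small [t]. *)
Lemma der0_lie d g xi f p : lie_atlas d -> cdom d g ->
  qdiff (f \o cinv d) (cfun d g) p ->
  der0 (fun t => f (g * gam xi t)%g) (\sum_k p k * X xi (chart_coord d k) g).
Proof.
move=> dA dg fp.
pose u (t : R) := cfun d (g * gam xi t)%g.
have u0 : u 0 = cfun d g by rewrite /u mul_gam0.
have H k : der0 (fun t => u t 0 k) (X xi (chart_coord d k) g).
  have [A _ /nbhs_singleton] := der0_coord xi k dA dg; rewrite cfunK// => D.
  by have := D; rewrite -(der0_derive1 D).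
rewrite -u0 in fp; have := der0_chain fp H.
apply: der0_near; have := near_mul_gam xi (near_cdom dA dg).
by apply: filterS => t dt; rewrite /u /= cfunK.
Qed.

Lemma lie_der_formula d g xi f p : lie_atlas d -> cdom d g ->
  qdiff (f \o cinv d) (cfun d g) p -> X xi f g = \sum_k p k * X xi (chart_coord d k) g.
Proof. by move=> dA dg fp; apply: der0_derive1; exact: der0_lie fp. Qed.

Lemma analytic_qdiff d g f : analytic_at (f \o cinv d) (cfun d g) ->
  exists p, qdiff (f \o cinv d) (cfun d g) p.
Proof.
by move=> /analytic_gradient[q [_ /nbhs_singleton qd _]]; exists (q^~ (cfun d g)).
Qed.

Lemma analytic_der0 d g xi f : lie_atlas d -> cdom d g ->
  analytic_at (f \o cinv d) (cfun d g) ->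
  der0 (fun t => f (g * gam xi t)%g) (X xi f g).
Proof.
move=> dA dg /analytic_qdiff[p fp]; have D := der0_lie (xi := xi) dA dg fp.
by have := D; rewrite -(der0_derive1 D).
Qed.

(** Near [g] the derivative is a sum of products of partial derivatives of [f] with the components
    from [der0_coord], all of them analytic. *)
Lemma analytic_lie_der d g xi f : lie_atlas d -> cdom d g ->
  analytic_at (f \o cinv d) (cfun d g) ->
  analytic_at (X xi f \o cinv d) (cfun d g).
Proof.
move=> dA dg /analytic_gradient[q [qA qn _]].
have /choice[A AP] : forall k, exists A : 'rV[R]_n -> R, analytic_at A (cfun d g) /\
    \forall x \near cfun d g, der0 (fun t => chart_coord d k (cinv d x * gam xi t)%g) (A x).
  by move=> k; have [A A1 A2] := der0_coord xi k dA dg; exists A.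
apply: (@near_analytic _ _ (fun x => \sum_k q k x * A k x)); last first.
  by apply: analytic_sum => k; apply: analyticM => //; case: (AP k).
have An := @filter_forall _ _ _ _ (nbhs_filter (cfun d g)) (fun k => (AP k).2).
have := near_chart dA dg.
apply: filterS3 An qn => x Ax qx dx; have [dcx cdx] := cinvK dA dx.
rewrite /= (lie_der_formula xi dA dcx (p := q^~ x)); last by rewrite cdx.
by apply: eq_bigr => k _; congr (_ * _); apply/esym/der0_derive1/Ax.
Qed.

Lemma lie_derD d g xi f f' : lie_atlas d -> cdom d g ->
  analytic_at (f \o cinv d) (cfun d g) -> analytic_at (f' \o cinv d) (cfun d g) ->
  X xi (fun h => f h + f' h) g = X xi f g + X xi f' g.
Proof.
by move=> dA dg fA f'A; apply: der0_derive1; apply: der0D; exact: analytic_der0 dA dg _.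
Qed.

Lemma lie_derM d g xi f f' : lie_atlas d -> cdom d g ->
  analytic_at (f \o cinv d) (cfun d g) -> analytic_at (f' \o cinv d) (cfun d g) ->
  X xi (fun h => f h * f' h) g = X xi f g * f' g + f g * X xi f' g.
Proof.
move=> dA dg fA f'A; apply: der0_derive1.
have := der0M (analytic_der0 (xi := xi) dA dg fA) (analytic_der0 (xi := xi) dA dg f'A).
by rewrite !mul_gam0.
Qed.

Lemma lie_der_cst xi v g : X xi (fun=> v) g = 0.
Proof. by apply: der0_derive1; exact: der0_cst. Qed.

Lemma lie_derZ d g xi a f : lie_atlas d -> cdom d g ->
  analytic_at (f \o cinv d) (cfun d g) ->
  X xi (fun h => a * f h) g = a * X xi f g.
Proof.
move=> dA dg fA; rewrite (lie_derM (f := fun=> a) xi dA dg)//; last exact: analytic_cst.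
by rewrite lie_der_cst mul0r add0r.
Qed.

Lemma lie_der_sum d g xi (I : Type) (s : seq I) (f : I -> G -> R) : lie_atlas d -> cdom d g ->
  (forall i, analytic_at (f i \o cinv d) (cfun d g)) ->
  X xi (fun h => \sum_(i <- s) f i h) g = \sum_(i <- s) X xi (f i) g.
Proof.
move=> dA dg fA; elim: s => [|i s IH].
  by under [fun h => _]eq_fun do rewrite big_nil; rewrite big_nil lie_der_cst.
under [fun h => _]eq_fun do rewrite big_cons; rewrite big_cons -IH.
by apply: (lie_derD xi dA dg) => //; exact: analytic_sum.
Qed.

Lemma lie_der_translate xi f g : X xi f g = X xi (fun h => f (g * h)%g) 1%g.
Proof. by rewrite /lie_der; under [in RHS]eq_fun do rewrite mul1g. Qed.

Lemma lie_der_translate_fun xi f g : (fun h => X xi f (g * h)%g) = X xi (fun h => f (g * h)%g).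
Proof.
by apply/funext => h; rewrite /lie_der; under eq_fun do rewrite -mulgA.
Qed.

Lemma coord_analytic d d' g k : lie_atlas d -> lie_atlas d' -> cdom d g -> cdom d' g ->
  analytic_at (chart_coord d' k \o cinv d) (cfun d g).
Proof. by move=> dA dA' dg dg'; exact: lie_transition. Qed.

Lemma coord_translate_analytic d g k : lie_atlas d -> cdom d g ->
  analytic_at ((fun h => chart_coord d k (g * h)%g) \o cinv c) (cfun c 1%g).
Proof.
move=> dA dg; have gd : cdom d (g * 1)%g by rewrite mulg1.
apply: (analytic_pull (L := row_mx 0 1%:M)) (lie_mul_analytic _ _ _ dA c_atlas dA _ _ dg c_unit gd k).
move=> h; rewrite mul_mx_row mulmx1 mulmx0 add_row_mx addr0 /=.
by rewrite row_mxKl row_mxKr cfunK.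
Qed.

Lemma lie_der_coord1 xi k : X xi (chart_coord c k) 1%g = xi 0 k.
Proof.
have := @lie_der_formula c 1%g xi (chart_coord c k) (fun i => (i == k)%:R) c_atlas c_unit.
have near1 : \forall t \near (0 : R), (cfun c @` cdom c) (cfun c 1%g + t *: xi).
  have C1 : {for (0 : R), continuous (fun t : R => cfun c 1%g + t *: xi)}.
    apply: (@continuousD _ _ R^o); first exact: cst_continuous.
    by move=> t; apply: cvgZr_tmp => //; exact: cvg_id.
  by apply: C1; rewrite scale0r addr0; exact: near_chart.
move=> _; apply: der0_derive1.
apply: (@der0_near _ (fun t => cfun c 1%g 0 k + t * xi 0 k)).
  move: near1; apply: filterS => t /(cinvK c_atlas)[_].
  by rewrite /chart_coord mul1g => ->; rewrite !mxE.
apply: (@cvg_trans _ (cst (xi 0 k) @ 0^')); last exact: cvg_cst.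
apply: near_eq_cvg; near=> t.
rewrite mul0r addr0 addrAC subrr add0r mulrA mulVf ?mul1r//.
by near: t; exact: nbhs_dnbhs_neq.
Unshelve. all: by end_near. Qed.

Local Opaque lie_der.

Section Commutator.
Context (xi eta : 'rV[R]_n).

(* In a chart the second-order parts of [X_xi X_eta] and [X_eta X_xi] agree, by
   the symmetry of second derivatives. *)
Lemma lie_commutator_formula d g f p : lie_atlas d -> cdom d g ->
  analytic_at (f \o cinv d) (cfun d g) ->
  qdiff (f \o cinv d) (cfun d g) p ->
  X xi (X eta f) g - X eta (X xi f) g =
  \sum_k p k * (X xi (X eta (chart_coord d k)) g - X eta (X xi (chart_coord d k)) g).
Proof.
move=> dA dg fA fp; have [q [qA qn qs]] := analytic_gradient fA.
have pq k : p k = q k (cfun d g).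
  exact: (qdiff_unique fp (nbhs_singleton qn)).
pose P k h := q k (cfun d h).
have PA k : analytic_at (P k \o cinv d) (cfun d g).
  apply: near_analytic (qA k); have := near_chart dA dg; apply: filterS => x dx.
  by rewrite /P/= (cinvK dA dx).2.
have CA k : analytic_at (chart_coord d k \o cinv d) (cfun d g) by exact: coord_analytic.
have near_lie a : \forall h \near g, X a f h = \sum_k P k h * X a (chart_coord d k) h.
  have := cfun_continuous dA dg qn => /=.
  apply: filterS2 (near_cdom dA dg) => h dh qh.
  by rewrite (lie_der_formula a dA dh (p := q^~ (cfun d h))).
have XP a k s : qdiff (q k) (cfun d g) s ->
    X a (P k) g = \sum_l s l * X a (chart_coord d l) g.
  move=> qk; apply: (lie_der_formula a dA dg).
  have [C [e [e0 H]]] := qk.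
  (* [P k] read in the chart agrees with [q k] only on the image of the chart, so the increments are
     also kept below [e' / 2]. *)
  have [e' e'0 H'] := (near_rowP _ _).1 (near_chart dA dg).
  exists C, (Num.min e (e' / 2)); split; first by rewrite lt_min e0 divr_gt0.
  move=> k0 t t0; rewrite le_min => /andP[te te'] kt; rewrite /P/= cfunK//.
  rewrite (cinvK dA _).2; first exact: H.
  apply: H' => i; apply: (le_lt_trans (kt i)); apply: (le_lt_trans te'); lra.
have XX a b : X a (X b f) g = \sum_k (X a (P k) g * X b (chart_coord d k) g +
    p k * X a (X b (chart_coord d k)) g).
  rewrite (lie_der_near a (near_lie b)) (lie_der_sum a _ dA dg); last first.
    by move=> k; exact: (analyticM (PA k) (analytic_lie_der b dA dg (CA k))).
  apply: eq_bigr => k _; rewrite (lie_derM a dA dg (PA k)); last first.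
    exact: (analytic_lie_der b dA dg (CA k)).
  by rewrite pq.
have /choice[s sP] : forall k, exists s, qdiff (q k) (cfun d g) s.
  by move=> k; have [s [sk _] _] := qs k k; exists (s k).
have ssym k l : s k l = s l k.
  have [s' [sk sl] E] := qs k l.
  by rewrite (qdiff_unique (sP k) sk) (qdiff_unique (sP l) sl).
rewrite (XX xi eta) (XX eta xi) -sumrB.
transitivity (\sum_k (X xi (P k) g * X eta (chart_coord d k) g -
    X eta (P k) g * X xi (chart_coord d k) g) +
  \sum_k p k * (X xi (X eta (chart_coord d k)) g - X eta (X xi (chart_coord d k)) g)).
  by rewrite -big_split/=; apply: eq_bigr => k _; rewrite opprD addrACA -mulrBr.
rewrite [X in X + _](_ : _ = 0) ?add0r// sumrB; apply/eqP; rewrite subr_eq0; apply/eqP.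
transitivity (\sum_k \sum_l s k l * X xi (chart_coord d l) g * X eta (chart_coord d k) g).
  by apply: eq_bigr => k _; rewrite (XP _ _ _ (sP k)) mulr_suml.
transitivity (\sum_k \sum_l s k l * X eta (chart_coord d l) g * X xi (chart_coord d k) g); last first.
  by apply: eq_bigr => k _; rewrite (XP _ _ _ (sP k)) mulr_suml.
rewrite exchange_big; apply: eq_bigr => k _; apply: eq_bigr => l _.
by rewrite (ssym l k) mulrAC.
Qed.

End Commutator.

Context (B : 'M[R]_n) (B_basis : B \in unitmx).
Local Notation br := (structure_const c B).

(** By [lie_commutator_formula] the defect [D] of the identity is a first-order operator, determined
    by its values on coordinate functions. On those of [c] it vanishes at the unit, by the
    definition of the bracket; left invariance moves every other point to the unit. *)
Lemma lie_commutator d g f i j : lie_atlas d -> cdom d g ->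
  analytic_at (f \o cinv d) (cfun d g) ->
  X (row i B) (X (row j B) f) g - X (row j B) (X (row i B) f) g =
  \sum_k br i j 0 k * X (row k B) f g.
Proof.
pose D f g := X (row i B) (X (row j B) f) g - X (row j B) (X (row i B) f) g -
  \sum_k br i j 0 k * X (row k B) f g.
suff D0 f' d' g' : lie_atlas d' -> cdom d' g' ->
    analytic_at (f' \o cinv d') (cfun d' g') -> D f' g' = 0.
  by move=> dA dg fA; apply/eqP; rewrite -subr_eq0; apply/eqP; exact: D0 fA.
have DE f0 d0 g0 p : lie_atlas d0 -> cdom d0 g0 ->
    analytic_at (f0 \o cinv d0) (cfun d0 g0) -> qdiff (f0 \o cinv d0) (cfun d0 g0) p ->
    D f0 g0 = \sum_m p m * D (chart_coord d0 m) g0.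
  move=> dA dg fA fp; have E := lie_commutator_formula (row i B) (row j B) dA dg fA fp.
  rewrite /D [X in X - _ = _]E {E}.
  under [in RHS]eq_bigr do rewrite mulrBr; rewrite [RHS]sumrB; congr (_ - _).
  under eq_bigr do rewrite (lie_der_formula _ dA dg fp) mulr_sumr.
  rewrite exchange_big; apply: eq_bigr => m _; rewrite mulr_sumr.
  by apply: eq_bigr => k _; rewrite mulrCA.
have D1 m : D (chart_coord c m) 1%g = 0.
  apply/eqP; rewrite subr_eq0; apply/eqP.
  under eq_bigr do rewrite lie_der_coord1.
  transitivity ((br i j *m B) 0 m).
    by rewrite /structure_const mulmxKV// /lie_bracket mxE.
  by rewrite [LHS]mxE; apply: eq_bigr => l _; congr (_ * _); rewrite mxE.
move=> dA dg fA; have [p fp] := analytic_qdiff fA.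
rewrite (DE _ _ _ _ dA dg fA fp) big1// => k _.
have -> : D (chart_coord d' k) g' = D (fun h => chart_coord d' k (g' * h)%g) 1%g.
  rewrite /D !(lie_der_translate _ _ g') !lie_der_translate_fun; congr (_ - _).
  by apply: eq_bigr => l _; rewrite lie_der_translate.
have cA := coord_translate_analytic k dA dg; have [q cq] := analytic_qdiff cA.
by rewrite (DE _ _ _ _ c_atlas c_unit cA cq) big1 ?mulr0// => m _; rewrite D1 mulr0.
Qed.

End LieDerivative.

(** * Combinatorics of the Leibniz rule *)

Section PicksSplits.
Context (n : nat).
Local Notation W := (seq 'I_n).

(** Unshuffles of [w], with multiplicity: the ways in which the derivatives of a word distribute
    over two factors. *)
Fixpoint splits (w : W) : seq (W * W) :=
  if w is i :: w' then [seq (i :: p.1, p.2) | p <- splits w'] ++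
                       [seq (p.1, i :: p.2) | p <- splits w']
  else [:: ([::], [::])].

Fixpoint picks (w : W) : seq ('I_n * W) :=
  if w is i :: w' then (i, w') :: [seq (p.1, i :: p.2) | p <- picks w'] else [::].

Lemma size_splits w p : p \in splits w -> (size p.1 + size p.2 = size w)%N.
Proof.
elim: w p => [|i w IH] p /=; first by rewrite inE => /eqP ->.
rewrite mem_cat => /orP[]/mapP[q /IH <- ->] //=.
by rewrite addnS.
Qed.

Lemma perm_picks w p : p \in picks w -> perm_eq w (p.1 :: p.2).
Proof.
elim: w p => [|i w IH] p //=; rewrite inE => /orP[/eqP -> //|/mapP[q /IH H ->]] /=.
apply: (@perm_trans _ (i :: q.1 :: q.2)); first by rewrite perm_cons.
by rewrite (perm_catCA [:: i] [:: q.1] q.2).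
Qed.

Lemma size_picks w p : p \in picks w -> size w = (size p.2).+1.
Proof. by move=> /perm_picks/perm_size. Qed.

Lemma big_splits0 (V : nmodType) (F : W * W -> V) w :
  \sum_(p <- splits w | size p.1 == 0%N) F p = F ([::], w).
Proof.
elim: w F => [|i w IH] F; first by rewrite /= big_cons big_nil addr0.
by rewrite big_cat !big_map /= big_pred0 ?add0r// (IH (fun p => F (p.1, i :: p.2))).
Qed.

Lemma big_splits1 (V : nmodType) (F : W * W -> V) w :
  \sum_(p <- splits w | size p.1 == 1%N) F p = \sum_(p <- picks w) F ([:: p.1], p.2).
Proof.
elim: w F => [|i w IH] F; first by rewrite /= big_cons !big_nil.
rewrite big_cat !big_map big_cons big_map /=; congr (_ + _).
  rewrite (eq_bigl (fun p : W * W => size p.1 == 0%N))//.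
  exact: (big_splits0 (fun p => F (i :: p.1, p.2))).
exact: (IH (fun p => F (p.1, i :: p.2))).
Qed.

(** A letter and a remaining word of length [m] arise from [m.+1] positions of that letter. *)
Lemma wsum_picks (V : nmodType) m (K : 'I_n -> W -> V) :
  wsum m.+1 (fun w => \sum_(p <- picks w) K p.1 p.2) = (\sum_i wsum m (K i)) *+ m.+1.
Proof.
elim: m K => [|m IH] K.
  by rewrite mulr1n; apply: eq_bigr => i _; rewrite /= big_seq1.
rewrite wsumS.
transitivity (\sum_j (wsum m.+1 (K j) +
    wsum m.+1 (fun w => \sum_(p <- picks w) K p.1 (j :: p.2)))).
  apply: eq_bigr => j _; rewrite -wsumD; apply: eq_wsum => w _.
  by rewrite /= big_cons big_map.
rewrite big_split mulrS; congr (_ + _).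
under eq_bigr do rewrite (IH (fun i u => K i (_ :: u))).
by rewrite sumrMnl exchange_big.
Qed.

(** The number of letter-preserving bijections between the positions of [u] and those of [w]. It is
    the value at the origin of the derivative along [w] of the product of the coordinates listed in
    [u]. *)
Fixpoint matchings (w u : W) : nat :=
  if u is j :: u' then \sum_(p <- picks w | p.1 == j) matchings p.2 u' else w == [::].

(** Only permutations of [u] contribute, and each of the [(size u)!] bijections is counted once.
    This recovers a single coefficient of a symmetric tensor from its pairing. *)
Lemma wsum_matchings (V : nmodType) (v : W -> V) u :
  (forall w w', perm_eq w w' -> v w = v w') ->
  wsum (size u) (fun w => v w *+ matchings w u) = v u *+ (size u)`!.
Proof.
elim: u v => [|j u IH] v vs; first by rewrite /= mulr1n.
rewrite [size _]/=.
transitivity (wsum (size u).+1 (fun w => \sum_(p <- picks w)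
   (if p.1 == j then v (j :: p.2) *+ matchings p.2 u else 0))).
  apply: eq_wsum => w _; rewrite /= -[LHS]sumrMnr big_mkcond/=.
  apply: eq_big_seq => p /perm_picks /vs ->.
  by case: eqP => // ->.
rewrite (wsum_picks _ (fun i w => if i == j then v (j :: w) *+ matchings w u else 0)).
rewrite (bigD1 j)//= eqxx big1 ?addr0; last first.
  by move=> i /negPf ->; exact: wsum0.
rewrite (IH (fun w => v (j :: w))); last by move=> w w' ww; apply: vs; rewrite perm_cons.
by rewrite -mulrnA factS mulnC.
Qed.

End PicksSplits.

(** * Words as left-invariant operators, and coordinates that separate them *)

Section LieWords.
Context (R : realType) (n : nat) (G : lieGroupType R n).
Context (c : chart R n G) (c_atlas : lie_atlas c) (c_unit : cdom c 1%g).
Context (B : 'M[R]_n) (B_basis : B \in unitmx).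
Implicit Types (d : chart R n G) (g h : G) (f : G -> R) (U : set G).
Local Notation LX i := (lie_der c (row i B)).
Local Opaque lie_der.
Local Notation W := (seq 'I_n).

(** A local notion is needed because the coordinates [zeta] are analytic only on the domain of
    [c]. *)
Definition analytic_on U f : Prop := forall d, lie_atlas d -> forall g, U g ->
  cdom d g -> analytic_at (f \o cinv d) (cfun d g).

Lemma analytic_onT f : analytic_on setT f <-> analytic f.
Proof.
split=> H d dA g; first by move=> dg; exact: H.
by move=> _; exact: H.
Qed.

Lemma analytic_onD U f f' : analytic_on U f -> analytic_on U f' ->
  analytic_on U (fun h => f h + f' h).
Proof. by move=> fA f'A d dA g Ug dg; apply: analyticD; [exact: fA|exact: f'A]. Qed.

Lemma analytic_onM U f f' : analytic_on U f -> analytic_on U f' ->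
  analytic_on U (fun h => f h * f' h).
Proof. by move=> fA f'A d dA g Ug dg; apply: analyticM; [exact: fA|exact: f'A]. Qed.

Lemma analytic_on_cst U v : analytic_on U (fun=> v).
Proof. by move=> d dA g Ug dg; exact: analytic_cst. Qed.

Lemma analytic_on_sum U (I : Type) (s : seq I) (f : I -> G -> R) :
  (forall i, analytic_on U (f i)) -> analytic_on U (fun h => \sum_(i <- s) f i h).
Proof. by move=> fA d dA g Ug dg; apply: analytic_sum => i; exact: fA. Qed.

Lemma analytic_on_lie_der U f xi : analytic_on U f -> analytic_on U (lie_der c xi f).
Proof. by move=> fA d dA g Ug dg; apply: analytic_lie_der => //; exact: fA. Qed.

Definition rword (w : W) f : G -> R := foldr (fun i => LX i) f w.

Lemma rword_cat u v f : rword (u ++ v) f = rword u (rword v f).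
Proof. by rewrite /rword foldr_cat. Qed.

Lemma analytic_on_rword U f w : analytic_on U f -> analytic_on U (rword w f).
Proof. by move=> fA; elim: w => //= i w; exact: analytic_on_lie_der. Qed.

Section OpenSet.
Variables (U : set G) (oU : open U).

Lemma near_open g : U g -> \forall h \near g, U h.
Proof. by move=> Ug; apply: open_nbhs_nbhs. Qed.

Lemma eq_lie_der f f' xi : (forall h, U h -> f h = f' h) ->
  forall g, U g -> lie_der c xi f g = lie_der c xi f' g.
Proof.
move=> ff g Ug; apply: lie_der_near => //.
by move: (near_open Ug); apply: filterS => h; exact: ff.
Qed.

Lemma eq_rword f f' w : (forall h, U h -> f h = f' h) ->
  forall g, U g -> rword w f g = rword w f' g.
Proof. by move=> ff; elim: w => //= i w IH; exact: eq_lie_der. Qed.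

Lemma rword_sum (I : Type) (s : seq I) (f : I -> G -> R) w g :
  (forall i, analytic_on U (f i)) -> U g ->
  rword w (fun h => \sum_(i <- s) f i h) g = \sum_(i <- s) rword w (f i) g.
Proof.
move=> fA; elim: w g => [|i w IH] g Ug //=.
rewrite (eq_lie_der _ (f' := fun h => \sum_(i <- s) rword w (f i) h))//.
have [d dA dg] := lie_cover g; apply: (lie_der_sum c_atlas c_unit _ _ dA dg) => // j.
exact: (analytic_on_rword w (fA j) dA Ug dg).
Qed.

Lemma rwordZ a f w g : analytic_on U f -> U g ->
  rword w (fun h => a * f h) g = a * rword w f g.
Proof.
move=> fA; elim: w g => [|i w IH] g Ug //=.
rewrite (eq_lie_der _ (f' := fun h => a * rword w f h))//.
have [d dA dg] := lie_cover g; apply: (lie_derZ c_atlas c_unit _ _ dA dg) => //.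
exact: (analytic_on_rword w fA dA Ug dg).
Qed.

Lemma rwordD f f' w g : analytic_on U f -> analytic_on U f' -> U g ->
  rword w (fun h => f h + f' h) g = rword w f g + rword w f' g.
Proof.
move=> fA f'A; elim: w g => [|i w IH] g Ug //=.
rewrite (eq_lie_der _ (f' := fun h => rword w f h + rword w f' h))//.
have [d dA dg] := lie_cover g.
exact: (lie_derD c_atlas c_unit _ dA dg (analytic_on_rword w fA dA Ug dg)
  (analytic_on_rword w f'A dA Ug dg)).
Qed.

Lemma rwordM f f' w g : analytic_on U f -> analytic_on U f' -> U g ->
  rword w (fun h => f h * f' h) g =
  \sum_(p <- splits w) rword p.1 f g * rword p.2 f' g.
Proof.
move=> fA f'A; elim: w g => [|i w IH] g Ug /=; first by rewrite big_seq1.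
rewrite (eq_lie_der _ (f' := fun h => \sum_(p <- splits w) rword p.1 f h * rword p.2 f' h))//.
have [d dA dg] := lie_cover g.
have AA v F : analytic_on U F -> analytic_at (rword v F \o cinv d) (cfun d g).
  by move=> FA; exact: (analytic_on_rword v FA dA Ug dg).
rewrite (lie_der_sum c_atlas c_unit _ _ dA dg)//; last first.
  by move=> p; exact: (analyticM (AA p.1 _ fA) (AA p.2 _ f'A)).
rewrite big_cat/= !big_map/= -[RHS]big_split/=; apply: eq_bigr => p _.
exact: (lie_derM c_atlas c_unit _ dA dg (AA p.1 _ fA) (AA p.2 _ f'A)).
Qed.

Local Notation br := (structure_const c B).

(** Words act on functions through the enveloping algebra: [lie_commutator] applies to [rword b f],
    and [rword a] is linear. *)
Lemma rword_relator f a b i j g : analytic_on U f -> U g ->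
  rword (a ++ [:: i, j & b]) f g - rword (a ++ [:: j, i & b]) f g -
  \sum_k br i j 0 k * rword (a ++ k :: b) f g = 0.
Proof.
move=> fA Ug; have hA := analytic_on_rword b fA; set h := rword b f in hA.
have XA k : analytic_on U (LX k h) by exact: analytic_on_lie_der.
have E k : U k -> LX i (LX j h) k = LX j (LX i h) k + \sum_l br i j 0 l * LX l h k.
  move=> Uk; have [d dA dk] := lie_cover k.
  have H := lie_commutator c_atlas c_unit B_basis i j dA dk (hA d dA k Uk dk).
  by rewrite -H addrC subrK.
rewrite !rword_cat /= -/h.
transitivity (rword a (fun k => LX j (LX i h) k + \sum_l br i j 0 l * LX l h k) g -
    rword a (LX j (LX i h)) g - \sum_k br i j 0 k * rword (a ++ k :: b) f g).
  by congr (_ - _ - _); exact: (eq_rword a E Ug).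
rewrite rwordD//; first last.
- by apply: analytic_on_sum => l; apply: analytic_onM => //; exact: analytic_on_cst.
- exact: analytic_on_lie_der.
rewrite rword_sum//; last first.
  by move=> l; apply: analytic_onM => //; exact: analytic_on_cst.
rewrite [X in X - _ = 0]addrC addrA [X in X + _ - _]addrC subrr add0r.
apply/eqP; rewrite subr_eq0; apply/eqP.
by apply: eq_bigr => l _; rewrite rwordZ// rword_cat.
Qed.

(** In the Leibniz rule a nonzero term has at least one letter on [f] and at least [m] letters on
    [f']; since [w] has at most [m.+1] letters, exactly one falls on [f]. *)
Lemma rword_vanish f f' m w g : analytic_on U f -> analytic_on U f' -> U g ->
  f g = 0 -> (forall v, (size v < m)%N -> rword v f' g = 0) -> (size w <= m.+1)%N ->
  rword w (fun h => f h * f' h) g =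
  \sum_(p <- picks w | size p.2 == m) LX p.1 f g * rword p.2 f' g.
Proof.
move=> fA f'A Ug f0 f'0 wm; rewrite rwordM//.
rewrite (bigID (fun p : W * W => size p.1 == 1%N))/= [X in _ + X]big1_seq ?addr0; last first.
  move=> [[|i [|j a]] b] /andP[//= _ ps]; first by rewrite f0 mul0r.
  rewrite f'0 ?mulr0//; move/size_splits: ps => /= ps.
  by move: wm; rewrite -ps; lia.
rewrite (big_splits1 (fun p => rword p.1 f g * rword p.2 f' g)) /=.
rewrite [RHS]big_mkcond; apply: eq_big_seq => p pw; case: eqP => // pm.
rewrite f'0 ?mulr0// ltn_neqAle -ltnS -(size_picks pw) wm andbT; exact/eqP.
Qed.

End OpenSet.

(** Chart coordinates centred at the unit and made dual to the basis there, as [lie_zeta] shows. *)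
Definition zeta i h : R := \sum_k (chart_coord c k h - chart_coord c k 1%g) * invmx B k i.

Lemma chart_open : open (cdom c).
Proof. by have /lie_charts[] := c_atlas. Qed.

Lemma zeta_analytic i : analytic_on (cdom c) (zeta i).
Proof.
apply: analytic_on_sum => k; apply: analytic_onM; last exact: analytic_on_cst.
apply: analytic_onD; last exact: analytic_on_cst.
by move=> d dA g cg dg; exact: coord_analytic.
Qed.

Lemma zeta1 i : zeta i 1%g = 0.
Proof. by rewrite /zeta big1// => k _; rewrite subrr mul0r. Qed.

Lemma lie_zeta i j : LX j (zeta i) 1%g = (j == i)%:R.
Proof.
have cA k : analytic_at (chart_coord c k \o cinv c) (cfun c 1%g) by exact: coord_analytic.
have cA' k : analytic_at ((fun h => chart_coord c k h - chart_coord c k 1%g) \o cinv c) (cfun c 1%g).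
  by apply: analyticD; [exact: cA|exact: analytic_cst].
rewrite /zeta (lie_der_sum c_atlas c_unit _ _ c_atlas c_unit)//; last first.
  by move=> k; exact: (analyticM (cA' k) (analytic_cst _ _)).
transitivity ((B *m invmx B) j i); last by rewrite mulmxV// mxE.
rewrite mxE; apply: eq_bigr => k _.
rewrite (lie_derM c_atlas c_unit _ c_atlas c_unit (cA' k)); last exact: analytic_cst.
rewrite lie_der_cst mulr0 addr0.
rewrite (lie_derD c_atlas c_unit _ c_atlas c_unit (cA k)); last exact: analytic_cst.
by rewrite lie_der_cst addr0 lie_der_coord1// mxE.
Qed.

Definition zetas u : G -> R := foldr (fun i f h => zeta i h * f h) (fun=> 1) u.

Lemma zetas_analytic u : analytic_on (cdom c) (zetas u).
Proof.
elim: u => [|i u IH]; first exact: analytic_on_cst.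
by apply: analytic_onM IH; exact: zeta_analytic.
Qed.

(** A product of [size u] functions vanishing at the unit has zero derivatives of lower order there;
    one of order [size u] must give exactly one letter to each factor. *)
Lemma rword_zetas u w : (size w <= size u)%N ->
  rword w (zetas u) 1%g = if size w == size u then (matchings w u)%:R else 0.
Proof.
elim: u w => [|i u IH] w wu; first by move: wu; rewrite leqn0 size_eq0 => /eqP ->.
rewrite (rword_vanish chart_open (m := size u) (zeta_analytic i) (zetas_analytic u))//.
- rewrite /= natr_sum; case: eqP => wE.
    rewrite big_seq_cond [RHS]big_mkcond [RHS]big_seq/= big_mkcondr/=.
    apply: eq_bigr => p pw; have := size_picks pw; rewrite wE => -[pu].
    by rewrite -pu eqxx lie_zeta IH ?pu// eqxx; case: eqP; rewrite ?mul1r// mul0r.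
  apply: big1_seq => p /andP[/eqP pu pw]; case: wE.
  by rewrite (size_picks pw) pu.
- exact: zeta1.
- by move=> v vu; rewrite IH ?(ltnW vu)// ltn_eqF.
Qed.

(* Uniqueness in the Poincare-Birkhoff-Witt theorem comes from the fact that
   left-invariant differential operators separate symmetric tensors. *)
Lemma pbw_pairing (u : W) : exists e : W -> R,
  [/\ forall w, (size w < size u)%N -> e w = 0,
      forall w, size w = size u -> e w = (matchings w u)%:R &
      forall a b i j, e (a ++ [:: i, j & b]) - e (a ++ [:: j, i & b]) -
        \sum_k structure_const c B i j 0 k * e (a ++ k :: b) = 0].
Proof.
exists (fun w => rword w (zetas u) 1%g); split.
- by move=> w wu; rewrite rword_zetas ?(ltnW wu)// ltn_eqF.
- by move=> w wu; rewrite rword_zetas ?wu// eqxx.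
- by move=> a b i j; apply: (rword_relator chart_open) => //; exact: zetas_analytic.
Qed.

End LieWords.

(** * Complex-valued functions *)

Section ComplexLie.
Context (R : realType) (n : nat) (G : lieGroupType R n).
Context (c : chart R n G) (c_atlas : lie_atlas c) (c_unit : cdom c 1%g).
Context (B : 'M[R]_n).
Local Notation C := (R[i]^o).
Implicit Types (phi psi : G -> C) (g : G).
Local Notation D xi := (lie_derC c xi).
Local Notation Re := (@complex.Re R).
Local Notation Im := (@complex.Im R).

Lemma CanalyticD phi psi : Canalytic phi -> Canalytic psi ->
  Canalytic (fun g => phi g + psi g).
Proof.
rewrite /Canalytic -!analytic_onT => -[r1 i1] [r2 i2].
have := analytic_onD r1 r2; have := analytic_onD i1 i2.
by split; [under [fun g => Re _]eq_fun do rewrite raddfD/=|under [fun g => Im _]eq_fun do rewrite raddfD/=].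
Qed.

Lemma CanalyticM phi psi : Canalytic phi -> Canalytic psi ->
  Canalytic (fun g => phi g * psi g).
Proof.
rewrite /Canalytic -!analytic_onT => -[r1 i1] [r2 i2]; split.
  have := analytic_onD (analytic_onM r1 r2)
    (analytic_onM (@analytic_on_cst _ _ G setT (-1)) (analytic_onM i1 i2)).
  congr analytic_on; apply/funext => g; rewrite mulN1r.
  by case: (phi g) => ? ?; case: (psi g).
have := analytic_onD (analytic_onM r1 i2) (analytic_onM i1 r2).
congr analytic_on; apply/funext => g.
by case: (phi g) => ? ?; case: (psi g).
Qed.

Lemma Canalytic_cst (a : C) : Canalytic (fun _ : G => a).
Proof. by rewrite /Canalytic -!analytic_onT; split; exact: analytic_on_cst. Qed.

Lemma Canalytic_lie_derC phi xi : Canalytic phi -> Canalytic (D xi phi).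
Proof.
rewrite /Canalytic -!analytic_onT => -[r1 i1].
by split; exact: (analytic_on_lie_der c_atlas c_unit).
Qed.

Lemma Canalytic_lie_word phi w : Canalytic phi -> Canalytic (lie_word c B w phi).
Proof. by move=> fA; elim: w => //= i w; exact: Canalytic_lie_derC. Qed.

Lemma lie_derC_D phi psi xi : Canalytic phi -> Canalytic psi ->
  D xi (fun g => phi g + psi g) = (fun g => D xi phi g + D xi psi g).
Proof.
move=> [r1 i1] [r2 i2]; apply/funext => g; have [d dA dg] := lie_cover g.
have Er : (fun h => Re (phi h + psi h)) = (fun h => Re (phi h) + Re (psi h)).
  by apply/funext => h; rewrite raddfD.
have Ei : (fun h => Im (phi h + psi h)) = (fun h => Im (phi h) + Im (psi h)).
  by apply/funext => h; rewrite raddfD.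
rewrite /lie_derC Er Ei.
by rewrite !(lie_derD c_atlas c_unit _ dA dg) //; [exact: i1|exact: i2|exact: r1|exact: r2].
Qed.

Lemma lie_derC_M phi psi xi : Canalytic phi -> Canalytic psi ->
  D xi (fun g => phi g * psi g) = (fun g => D xi phi g * psi g + phi g * D xi psi g).
Proof.
move=> [r1 i1] [r2 i2]; apply/funext => g; have [d dA dg] := lie_cover g.
have Er : (fun h => Re (phi h * psi h)) =
    (fun h => Re (phi h) * Re (psi h) + -1 * (Im (phi h) * Im (psi h))).
  by apply/funext => h; rewrite mulN1r; case: (phi h) => ? ?; case: (psi h).
have Ei : (fun h => Im (phi h * psi h)) =
    (fun h => Re (phi h) * Im (psi h) + Im (phi h) * Re (psi h)).
  by apply/funext => h; case: (phi h) => ? ?; case: (psi h).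
have r1' := r1 d dA g dg; have i1' := i1 d dA g dg.
have r2' := r2 d dA g dg; have i2' := i2 d dA g dg.
rewrite /lie_derC Er Ei.
rewrite (lie_derD c_atlas c_unit _ dA dg (analyticM r1' r2')
  (analyticM (analytic_cst (-1) _) (analyticM i1' i2'))).
rewrite (lie_derZ c_atlas c_unit _ _ dA dg (analyticM i1' i2')).
rewrite (lie_derD c_atlas c_unit _ dA dg (analyticM r1' i2') (analyticM i1' r2')).
rewrite (lie_derM c_atlas c_unit _ dA dg r1' r2') (lie_derM c_atlas c_unit _ dA dg i1' i2').
rewrite (lie_derM c_atlas c_unit _ dA dg r1' i2') (lie_derM c_atlas c_unit _ dA dg i1' r2').
case: (phi g) => a b; case: (psi g) => a' b' /=.
by apply/eqP; rewrite eq_complex/=; apply/andP; split; apply/eqP; ring.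
Qed.

Lemma lie_derC_cst (a : C) xi : D xi (fun=> a) = (fun=> 0).
Proof. by apply/funext => g; rewrite /lie_derC !lie_der_cst. Qed.

Lemma lie_derC_Z (a : C) phi xi : Canalytic phi ->
  D xi (fun g => a * phi g) = (fun g => a * D xi phi g).
Proof.
move=> fA; rewrite lie_derC_M ?lie_derC_cst//; last exact: Canalytic_cst.
by apply/funext => g; rewrite mul0r add0r.
Qed.

Lemma lie_word_cat u v phi : lie_word c B (u ++ v) phi = lie_word c B u (lie_word c B v phi).
Proof. by rewrite /lie_word foldr_cat. Qed.

Lemma lie_word_cst0 w : lie_word c B w (fun=> 0) = (fun=> 0).
Proof. by elim: w => //= i w ->; rewrite lie_derC_cst. Qed.

Lemma lie_word_D phi psi w : Canalytic phi -> Canalytic psi ->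
  lie_word c B w (fun g => phi g + psi g) =
  (fun g => lie_word c B w phi g + lie_word c B w psi g).
Proof.
move=> fA gA; elim: w => //= i w ->.
by rewrite lie_derC_D//; exact: Canalytic_lie_word.
Qed.

Lemma lie_word_Z a phi w : Canalytic phi ->
  lie_word c B w (fun g => a * phi g) = (fun g => a * lie_word c B w phi g).
Proof.
move=> fA; elim: w => //= i w ->.
by rewrite lie_derC_Z//; exact: Canalytic_lie_word.
Qed.

End ComplexLie.

(** * The Gutt star product *)

Section ComplexNorm.
Context (R : realType).
Local Notation cn := (@Normc.normc R).
Implicit Types x y : R[i].

Lemma cnD x y : cn (x + y) <= cn x + cn y.
Proof. exact: (@le_normcD R x y). Qed.

Lemma cnM x y : cn (x * y) = cn x * cn y.
Proof. exact: Normc.normcM. Qed.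

Lemma cn0 : cn 0 = 0.
Proof. exact: Normc.normc0. Qed.

Lemma cn_ge0 x : 0 <= cn x.
Proof. by case: x => a b; exact: sqrtr_ge0. Qed.

Lemma cnN x : cn (- x) = cn x.
Proof. exact: (@normcN R x). Qed.

Lemma cn_real (a : R) : cn a%:C%C = `|a|.
Proof. by rewrite /Normc.normc/= expr0n addr0 sqrtr_sqr. Qed.

Lemma cn_nat k : cn k%:R = k%:R.
Proof. by rewrite -(rmorph_nat (real_complex R)) cn_real normr_nat. Qed.

Lemma cnV x : cn x^-1 = (cn x)^-1.
Proof. exact: Normc.normcV. Qed.

Lemma cnX x k : cn (x ^+ k) = cn x ^+ k.
Proof.
elim: k => [|k IH]; first by rewrite !expr0 Normc.normc1.
by rewrite !exprS cnM IH.
Qed.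

Lemma cn_sum (I : Type) (s : seq I) (P : pred I) (f : I -> R[i]) :
  cn (\sum_(i <- s | P i) f i) <= \sum_(i <- s | P i) cn (f i).
Proof.
elim/big_ind2: _ => [|x a y b xa yb|//]; first by rewrite cn0.
by apply: (le_trans (cnD _ _)); rewrite lerD.
Qed.

End ComplexNorm.

(** * Symmetric tensors and the ideal of the enveloping algebra *)

Section Tensors.
Context (R : realType) (n : nat).
Local Notation C := (R[i]^o).
Local Notation W := (seq 'I_n).
Local Notation cn := (@Normc.normc R).
Local Notation word := (@word R n).
Implicit Types (t a b : W -> C) (u v w : W).

Lemma wsum_fun k (F : W -> W -> C) w : wsum k F w = wsum k (fun u => F u w).
Proof. exact: (wsum_additive _ F (f := fun t => t w)). Qed.

Definition symk k t : Prop := (forall w, size w <> k -> t w = 0) /\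
  (forall w w', perm_eq w w' -> t w = t w').

Definition l1 k t : R := wsum k (fun w => cn (t w)).

Lemma l1_ge0 k t : 0 <= l1 k t.
Proof. by apply: wsum_ge0 => w _; exact: cn_ge0. Qed.

Lemma l1D k a b : l1 k (a + b) <= l1 k a + l1 k b.
Proof. by rewrite /l1 -wsumD; apply: ler_wsum => w _; exact: cnD. Qed.

Lemma l1Z k (c : C) t : l1 k (c *: t) = cn c * l1 k t.
Proof. by rewrite /l1 -wsum_mull; apply: eq_wsum => w _; exact: cnM. Qed.

Lemma l1N k t : l1 k (- t) = l1 k t.
Proof. by apply: eq_wsum => w _; exact: cnN. Qed.

Lemma l10 k : l1 k 0 = 0.
Proof. by apply: wsum_eq0 => w _; exact: cn0. Qed.

Lemma l1_sum k (I : Type) (s : seq I) (P : pred I) (f : I -> W -> C) :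
  l1 k (\sum_(i <- s | P i) f i) <= \sum_(i <- s | P i) l1 k (f i).
Proof.
elim/big_ind2: _ => [|x a y b xa yb|//]; first by rewrite l10.
by apply: (le_trans (l1D _ _ _)); rewrite lerD.
Qed.

Lemma l1_wsum k j (F : W -> W -> C) : l1 k (wsum j F) <= wsum j (fun v => l1 k (F v)).
Proof.
elim: j F => //= j IH F; apply: (le_trans (l1_sum _ _ _ _)).
by apply: ler_sum.
Qed.

Lemma symkD k a b : symk k a -> symk k b -> symk k (a + b).
Proof.
move=> [a0 aS] [b0 bS]; split=> [w wk|w w' ww].
  by rewrite -[LHS]/(a w + b w) a0// b0// addr0.
by rewrite -[LHS]/(a w + b w) (aS _ _ ww) (bS _ _ ww).
Qed.

Lemma symkZ k (c : C) a : symk k a -> symk k (c *: a).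
Proof.
move=> [a0 aS]; split=> [w wk|w w' ww]; rewrite -[LHS]/(c * a w).
  by rewrite a0// mulr0.
by rewrite (aS _ _ ww).
Qed.

Lemma symk0 k : symk k 0.
Proof. by []. Qed.

Lemma symk_sum k (I : Type) (s : seq I) (P : pred I) (f : I -> W -> C) :
  (forall i, P i -> symk k (f i)) -> symk k (\sum_(i <- s | P i) f i).
Proof. by move=> fs; apply: big_ind => //; exact: symkD. Qed.

Lemma symk_wsum k j (F : W -> W -> C) : (forall v, size v = j -> symk k (F v)) ->
  symk k (wsum j F).
Proof.
elim: j F => [|j IH] F Fs /=; first exact: Fs.
by apply: symk_sum => i _; apply: IH => v sv; apply: Fs; rewrite /= sv.
Qed.

Lemma word_expand k t : (forall w, size w <> k -> t w = 0) ->
  t = wsum k (fun u => t u *: word u).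
Proof.
move=> t0; apply/funext => w; rewrite wsum_fun.
have [wk|wk] := eqVneq (size w) k.
  rewrite (wsum_pred1 (u := w))//=.
    by rewrite -[RHS]/(t w * word w w) /Defs.word eqxx mulr1.
  move=> u _ uw; rewrite -[LHS]/(t u * word u w) /Defs.word eq_sym.
  by rewrite (negPf uw) mulr0.
rewrite t0; last exact/eqP.
apply/esym/wsum_eq0 => u uk; rewrite -[LHS]/(t u * word u w) /Defs.word.
by case: eqP => [E|]; rewrite ?mulr0//; move: wk; rewrite E uk eqxx.
Qed.

Lemma tensor_prodDl a a' b : tensor_prod (a + a') b = tensor_prod a b + tensor_prod a' b.
Proof.
apply/funext => w; rewrite -[RHS]/(tensor_prod a b w + tensor_prod a' b w).
by rewrite -big_split/=; apply: eq_bigr => k _; rewrite -mulrDl.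
Qed.

Lemma tensor_prodDr a b b' : tensor_prod a (b + b') = tensor_prod a b + tensor_prod a b'.
Proof.
apply/funext => w; rewrite -[RHS]/(tensor_prod a b w + tensor_prod a b' w).
by rewrite -big_split/=; apply: eq_bigr => k _; rewrite -mulrDr.
Qed.

Lemma tensor_prodZl (c : C) a b : tensor_prod (c *: a) b = c *: tensor_prod a b.
Proof.
apply/funext => w; rewrite -[RHS]/(c * tensor_prod a b w) mulr_sumr.
by apply: eq_bigr => k _; rewrite mulrA.
Qed.

Lemma tensor_prodZr (c : C) a b : tensor_prod a (c *: b) = c *: tensor_prod a b.
Proof.
apply/funext => w; rewrite -[RHS]/(c * tensor_prod a b w) mulr_sumr.
by apply: eq_bigr => k _; rewrite mulrCA.
Qed.

Lemma tensor_prod0l b : tensor_prod 0 b = 0.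
Proof. by apply/funext => w; apply: big1 => k _; rewrite mul0r. Qed.

Lemma tensor_prod0r a : tensor_prod a 0 = 0.
Proof. by apply/funext => w; apply: big1 => k _; rewrite mulr0. Qed.

Lemma tensor_prod_suml (I : Type) (s : seq I) (f : I -> W -> C) b :
  tensor_prod (\sum_(i <- s) f i) b = \sum_(i <- s) tensor_prod (f i) b.
Proof.
by apply: (big_morph (fun x => tensor_prod x b));
  [move=> x y; exact: tensor_prodDl|exact: tensor_prod0l].
Qed.

Lemma tensor_prod_sumr (I : Type) (s : seq I) (f : I -> W -> C) a :
  tensor_prod a (\sum_(i <- s) f i) = \sum_(i <- s) tensor_prod a (f i).
Proof.
by apply: (big_morph (tensor_prod a)); [move=> x y; exact: tensor_prodDr|exact: tensor_prod0r].
Qed.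

Lemma tensor_prod_word u v : tensor_prod (word u) (word v) = word (u ++ v).
Proof.
apply/funext => w; rewrite /tensor_prod /Defs.word.
have [->|wuv] := eqVneq w (u ++ v); last first.
  rewrite big1// => k _; case: eqP => [E|]; rewrite ?mul0r//.
  by case: eqP => [E'|]; rewrite ?mulr0//; move: wuv; rewrite -E -E' cat_take_drop eqxx.
have uk : (size u < (size (u ++ v)).+1)%N by rewrite size_cat ltnS leq_addr.
rewrite (bigD1 (Ordinal uk))//= take_size_cat// drop_size_cat// !eqxx mul1r big1 ?addr0//.
move=> k kE; case: eqP => [E|]; rewrite ?mul0r//; move: kE.
rewrite -val_eqE /=; move/(congr1 size): E; rewrite size_takel; last exact: ltnSE.
by move=> ->; rewrite eqxx.
Qed.

(** ** Symmetrized words *)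

Definition tpermute k (w : k.-tuple 'I_n) (s : 'S_k) : k.-tuple 'I_n :=
  [tuple tnth w (s i) | i < k].

Lemma sum_permute (V : nmodType) (F : W -> V) k (w : k.-tuple 'I_n) :
  \sum_(s : 'S_(size w)) F (permute s) = \sum_(s : 'S_k) F (tpermute w s).
Proof.
have sw := size_tuple w; case: w sw => w /= wk sw.
move: wk; rewrite -{}sw => wk; apply: eq_bigr => s _; congr F.
rewrite /permute /tpermute /=; apply: eq_map => i.
by have -> : Tuple wk = in_tuple w by apply: val_inj.
Qed.

Lemma veeE k (w : k.-tuple 'I_n) :
  vee R w = (k`!%:R)^-1 *: \sum_(s : 'S_k) word (tpermute w s).
Proof. by rewrite /vee (sum_permute word) size_tuple. Qed.

Lemma perm_permute w s : perm_eq (@permute n w s) w.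
Proof.
by apply/(@tuple_permP _ _ _ (in_tuple w)); exists s.
Qed.

Lemma size_permute w s : size (@permute n w s) = size w.
Proof. exact: perm_size (perm_permute s). Qed.

Lemma fact_neq0 (k : nat) : (k`!%:R : R[i]) != 0.
Proof. by rewrite pnatr_eq0 -lt0n fact_gt0. Qed.

Lemma sum_sym_permute (V : lmodType R[i]) (F : W -> V) w :
  (forall u u', perm_eq u u' -> F u = F u') ->
  ((size w)`!%:R : R[i])^-1 *: \sum_(s : 'S_(size w)) F (permute s) = F w.
Proof.
move=> FS; rewrite (eq_bigr (fun=> F w)); last by move=> s _; exact: FS (perm_permute s).
rewrite sumr_const card_Sn -[F w *+ _]scaler_nat scalerA mulVf ?scale1r//.
Qed.

Lemma vee_symk w : symk (size w) (vee R w).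
Proof.
have sw : size w = size w by []; move: (sw); pose w' := in_tuple w.
rewrite -[w]/(tval w') (veeE w'); split=> [u uk|u u' uu].
  rewrite -[LHS]/(_ * _) fct_sumE big1 ?mulr0// => s _; rewrite /Defs.word.
  by case: eqP => // E; case: uk; rewrite E size_tuple.
have [uk|uk] := eqVneq (size u) (size w); last first.
  have E x : size x != size w -> (\sum_(s : 'S_(size w)) word (tpermute w' s)) x = 0.
    move=> xk; rewrite fct_sumE big1// => s _; rewrite /Defs.word.
    by case: eqP => // E; move: xk; rewrite E size_tuple eqxx.
  by rewrite -[LHS]/(_ * _) -[RHS]/(_ * _) !E// -(perm_size uu).
rewrite -[LHS]/(_ * _) -[RHS]/(_ * _); congr (_ * _); rewrite !fct_sumE.
have u'k : size u' == size w by rewrite -(perm_size uu) uk.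
have /tuple_permP[p uE] : perm_eq u (Tuple u'k) by [].
rewrite (reindex_inj (mulgI p)); apply: eq_bigr => s _; rewrite /Defs.word uE; congr (nat_of_bool _)%:R.
set U := [tuple _ | i < _].
transitivity (U == tpermute w' (p * s)%g); first by [].
transitivity (Tuple u'k == tpermute w' s); last by [].
apply/eqP/eqP => [E|].
  apply/eq_from_tnth => i; move/(congr1 (fun q => tnth q ((p^-1)%g i))): E.
  by rewrite !tnth_mktuple permM permKV.
move=> E; apply/eq_from_tnth => i; rewrite /U E.
by rewrite !tnth_mktuple permM.
Qed.

(** [vee R w] is an average of permutations of [w], on which a symmetric [F] is constant. *)
Lemma vee_pairing (V : lmodType R[i]) (F : W -> V) w :
  (forall u u', perm_eq u u' -> F u = F u') ->
  wsum (size w) (fun u => vee R w u *: F u) = F w.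
Proof.
move=> FS; rewrite -[RHS](sum_sym_permute w FS) /vee.
transitivity (((size w)`!%:R : R[i])^-1 *: \sum_(s : 'S_(size w))
   wsum (size w) (fun u => word (permute s) u *: F u)).
  rewrite -wsum_sum -wsum_scale; apply: eq_wsum => u _.
  rewrite -[X in X *: _]/(_ * _) fct_sumE -scalerA; congr (_ *: _).
  by rewrite scaler_suml.
congr (_ *: _); apply: eq_bigr => s _; rewrite (wsum_pred1 (u := permute s)).
- by rewrite /Defs.word eqxx scale1r.
- exact: size_permute.
by move=> u _ us; rewrite /Defs.word (negPf us) scale0r.
Qed.

Lemma l1_word k w : size w = k -> l1 k (word w) = 1.
Proof.
move=> wk; rewrite /l1 (wsum_pred1 (u := w))//; first by rewrite /Defs.word eqxx Normc.normc1.
by move=> u _ uw; rewrite /Defs.word (negPf uw) cn0.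
Qed.

Lemma l1_vee w : l1 (size w) (vee R w) <= 1.
Proof.
rewrite /vee l1Z cnV cn_nat mulrC ler_pdivrMr ?ltr0n ?fact_gt0// mul1r.
apply: (le_trans (l1_sum _ _ _ _)).
rewrite (eq_bigr (fun=> 1)); last by move=> s _; rewrite l1_word ?size_permute.
by rewrite sumr_const card_Sn.
Qed.

(** Here the sum runs over the other word of the kernel [vee R w u]; replacing each permutation by
    its inverse exchanges the two words. *)
Lemma vee_sum_sym (V : lmodType R[i]) (F : W -> V) k u :
  (forall w w', perm_eq w w' -> F w = F w') -> size u = k ->
  wsum k (fun w => vee R w u *: F w) = F u.
Proof.
move=> FS uk; pose u' := in_tuple u; move: u' => u'; subst k.
rewrite -[RHS](sum_sym_permute u FS) -wsum_tuple.
transitivity (\sum_(w : (size u).-tuple 'I_n) ((size u)`!%:R : R[i])^-1 *: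
   \sum_(s : 'S_(size u)) (u == tpermute w s)%:R *: F w).
  apply: eq_bigr => w _; rewrite (veeE w) -[X in X *: _]/(_ * _) fct_sumE.
  by rewrite -scalerA scaler_suml.
rewrite -scaler_sumr; congr (_ *: _); rewrite exchange_big.
have invI : injective (fun s : 'S_(size u) => s^-1%g) by exact: invg_inj.
rewrite (reindex_inj invI); apply: eq_bigr => s _ /=.
pose v : (size u).-tuple 'I_n := tpermute (in_tuple u) s.
have vE : permute s = v :> W by [].
rewrite vE (bigD1 v)//= big1 ?addr0.
  have uE : in_tuple u = tpermute v s^-1.
    by apply/eq_from_tnth => i; rewrite !tnth_mktuple permKV.
  by have := congr1 val uE; rewrite /= => <-; rewrite eqxx scale1r.
move=> w wv; rewrite (_ : (u == _) = false) ?scale0r//; apply/eqP => uE.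
move/eqP: wv; apply; apply/eq_from_tnth => i; rewrite tnth_mktuple.
have -> : in_tuple u = tpermute w s^-1 by apply: val_inj.
by rewrite tnth_mktuple permK.
Qed.

Lemma is_sym_vee w : is_sym (vee R w).
Proof.
have [v0 vS] := vee_symk w; split=> //; exists (size w) => u uw.
by apply: v0 => E; move: uw; rewrite E ltnn.
Qed.

(** Symmetrization is the identity on symmetric tensors, so only the scaling of each degree is
    left. *)
Lemma quantE (z : C) t : is_sym t -> quant z t = fun u => z ^+ size u * t u.
Proof.
move=> [[d td] tS]; rewrite /quant.
have E w : (t w * (z ^+ size w / (size w)`!%:R)) *: \sum_(s : 'S_(size w)) word (permute s) =
   (z ^+ size w * t w) *: vee R w.
  by rewrite /vee scalerA; congr (_ *: _); rewrite mulrA [t w * _]mulrC.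
under eq_fsbigr do rewrite E.
rewrite (@fsum_words _ _ d.+1); last by move=> w dw; rewrite td// mulr0 scale0r.
apply/funext => u; rewrite fct_sumE.
have H k : wsum k (fun w => (z ^+ size w * t w) *: vee R w) u =
    if size u == k then z ^+ size u * t u else 0.
  rewrite wsum_fun; case: eqP => uk.
    rewrite -[RHS](vee_sum_sym (F := fun w => z ^+ size w * t w : C) _ uk).
      by apply: eq_wsum => w _; rewrite -[LHS]/(_ * _) mulrC.
    by move=> w w' ww; rewrite (tS _ _ ww) (perm_size ww).
  apply: wsum_eq0 => w wk; rewrite -[LHS]/(_ * _) (vee_symk w).1 ?mulr0//.
  by move=> E'; apply: uk; rewrite E' wk.
under eq_bigr do rewrite H.
have [ud|du] := ltnP (size u) d.+1.
  rewrite (bigD1 (Ordinal ud))//= eqxx big1 ?addr0// => k.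
  by rewrite -val_eqE/= eq_sym => /negPf ->.
rewrite big1 ?td ?mulr0// => k _.
by rewrite gtn_eqF// (leq_trans (ltn_ord k)).
Qed.

(** ** The ideal of the enveloping algebra *)

Context (br : 'I_n -> 'I_n -> 'rV[R]_n).

Definition lie_rel u (i j : 'I_n) v : W -> C :=
  word (u ++ [:: i, j & v]) - word (u ++ [:: j, i & v]) -
  \sum_k ((br i j 0 k)%:C%C : C) *: word (u ++ k :: v).

Lemma relE u i j v :
  tensor_prod (tensor_prod (word u) (env_relator br i j)) (word v) = lie_rel u i j v.
Proof.
have BN (x y : W -> C) : x - y = x + (-1) *: y by rewrite scaleN1r.
rewrite /env_relator !BN !tensor_prodDr !tensor_prodDl !tensor_prodZr !tensor_prodZl.
rewrite !tensor_prod_word tensor_prod_sumr tensor_prod_suml /lie_rel !BN -!catA; congr (_ + _ + _ *: _).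
by apply: eq_bigr => k _; rewrite tensor_prodZr tensor_prodZl !tensor_prod_word -catA.
Qed.

Local Notation ideal := (env_ideal br).

Lemma idealP t : ideal t <-> exists s : seq (C * (W * W) * ('I_n * 'I_n)),
  t = \sum_(x <- s) x.1.1 *: lie_rel x.1.2.1 x.2.1 x.2.2 x.1.2.2.
Proof.
by split=> -[s ->]; exists s; apply: eq_bigr => x _; rewrite relE.
Qed.

Lemma ideal0 : ideal 0.
Proof. by exists [::]; rewrite big_nil. Qed.

Lemma idealD a b : ideal a -> ideal b -> ideal (a + b).
Proof. by move=> [s ->] [s' ->]; exists (s ++ s'); rewrite big_cat. Qed.

Lemma idealZ (c : C) a : ideal a -> ideal (c *: a).
Proof.
move=> [s ->]; exists [seq ((c * x.1.1, x.1.2), x.2) | x <- s].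
by rewrite big_map scaler_sumr; apply: eq_bigr => x _; rewrite scalerA.
Qed.

Lemma idealN a : ideal a -> ideal (- a).
Proof. by rewrite -scaleN1r; exact: idealZ. Qed.

Lemma ideal_sum (I : Type) (s : seq I) (P : pred I) (f : I -> W -> C) :
  (forall i, P i -> ideal (f i)) -> ideal (\sum_(i <- s | P i) f i).
Proof. by move=> fi; apply: big_ind => //; [exact: ideal0|exact: idealD]. Qed.

Lemma ideal_wsum j (F : W -> W -> C) : (forall v, size v = j -> ideal (F v)) ->
  ideal (wsum j F).
Proof.
elim: j F => [|j IH] F Fs /=; first exact: Fs.
by apply: ideal_sum => i _; apply: IH => v sv; apply: Fs; rewrite /= sv.
Qed.

Lemma ideal_rel u i j v : ideal (lie_rel u i j v).
Proof.
by apply/idealP; exists [:: ((1, (u, v)), (i, j))]; rewrite big_seq1 scale1r.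
Qed.

(** Equality in the enveloping algebra, kept on representatives in the tensor algebra, where the
    norms live. *)
Definition eqv a b := ideal (a - b).

Lemma eqv_refl a : eqv a a.
Proof. by rewrite /eqv subrr; exact: ideal0. Qed.

Lemma eqv_trans b a a' : eqv a b -> eqv b a' -> eqv a a'.
Proof. by move=> H H'; have := idealD H H'; rewrite addrA subrK. Qed.

Lemma eqv_sym a b : eqv a b -> eqv b a.
Proof. by move=> /idealN; rewrite opprB. Qed.

Lemma eqvD a a' b b' : eqv a a' -> eqv b b' -> eqv (a + b) (a' + b').
Proof. by move=> H H'; have := idealD H H'; rewrite addrACA -opprD. Qed.

Lemma eqvZ c a b : eqv a b -> eqv (c *: a) (c *: b).
Proof. by move=> /(idealZ c); rewrite scalerBr. Qed.

Lemma eqv_sum (I : Type) (s : seq I) (P : pred I) (f f' : I -> W -> C) :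
  (forall i, P i -> eqv (f i) (f' i)) ->
  eqv (\sum_(i <- s | P i) f i) (\sum_(i <- s | P i) f' i).
Proof. by move=> ff; rewrite /eqv -sumrB; exact: ideal_sum. Qed.

Lemma eqv_wsum j (F F' : W -> W -> C) : (forall v, size v = j -> eqv (F v) (F' v)) ->
  eqv (wsum j F) (wsum j F').
Proof.
elim: j F F' => [|j IH] F F' Fs /=; first exact: Fs.
by apply: eqv_sum => i _; apply: IH => v sv; apply: Fs; rewrite /= sv.
Qed.

Definition lmul (i : 'I_n) t := tensor_prod (word [:: i]) t.

Lemma lmul_word i w : lmul i (word w) = word (i :: w).
Proof. exact: tensor_prod_word. Qed.

Lemma lmul_sum i (I : Type) (s : seq I) (f : I -> W -> C) :
  lmul i (\sum_(j <- s) f j) = \sum_(j <- s) lmul i (f j).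
Proof. exact: tensor_prod_sumr. Qed.

Lemma lmulZ i c t : lmul i (c *: t) = c *: lmul i t.
Proof. exact: tensor_prodZr. Qed.

Lemma lmul_ideal i t : ideal t -> ideal (lmul i t).
Proof.
move=> /idealP[s ->]; rewrite lmul_sum; apply: ideal_sum => x _; rewrite lmulZ.
apply: idealZ; rewrite (_ : lmul _ _ = lie_rel (i :: x.1.2.1) x.2.1 x.2.2 x.1.2.2).
  exact: ideal_rel.
have BN (y z : W -> C) : y - z = y + (-1) *: z by rewrite scaleN1r.
rewrite /lie_rel /lmul !BN !tensor_prodDr !tensor_prodZr tensor_prod_sumr !tensor_prod_word.
congr (_ + _ *: _); apply: eq_bigr => k _.
by rewrite tensor_prodZr tensor_prod_word.
Qed.

Lemma lmul_eqv i a b : eqv a b -> eqv (lmul i a) (lmul i b).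
Proof.
move=> /(lmul_ideal i); rewrite /eqv /lmul; congr env_ideal.
by rewrite -scaleN1r tensor_prodDr tensor_prodZr scaleN1r.
Qed.

End Tensors.

(** * Multiplying a symmetric tensor by a vector in the enveloping algebra *)

Section Enveloping.
Context (R : realType) (n : nat).
Local Notation C := (R[i]^o).
Local Notation W := (seq 'I_n).
Local Notation cn := (@Normc.normc R).
Local Notation word := (@word R n).
Implicit Types (t a b : W -> C) (u v w : W) (x : 'I_n -> C).
Context (br : 'I_n -> 'I_n -> 'rV[R]_n).
Local Notation eqv := (eqv br).

Definition vnorm x : R := \sum_i cn (x i).

Lemma vnorm_ge0 x : 0 <= vnorm x.
Proof. by apply: sumr_ge0 => i _; exact: cn_ge0. Qed.

Definition ad (y : 'I_n) x : 'I_n -> C := fun l => \sum_j x j * (br y j 0 l)%:C%C.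

Definition bnorm : R := \sum_y \sum_j \sum_l `|br y j 0 l|.

Lemma bnorm_ge0 : 0 <= bnorm.
Proof. by apply: sumr_ge0 => y _; apply: sumr_ge0 => j _; apply: sumr_ge0. Qed.

Lemma ad_norm y x : vnorm (ad y x) <= bnorm * vnorm x.
Proof.
rewrite /vnorm mulr_sumr; apply: (@le_trans _ _ (\sum_l \sum_j cn (x j) * `|br y j 0 l|)).
  apply: ler_sum => l _; apply: (le_trans (cn_sum _ _ _)).
  by apply: ler_sum => j _; rewrite cnM cn_real.
rewrite exchange_big; apply: ler_sum => j _; rewrite -mulr_sumr mulrC.
rewrite ler_wpM2r ?cn_ge0//; apply: (@le_trans _ _ (\sum_j \sum_l `|br y j 0 l|)).
  by rewrite [leRHS](bigD1 j)//= lerDl; apply: sumr_ge0 => i _; apply: sumr_ge0.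
rewrite /bnorm [leRHS](bigD1 y)//= lerDl; apply: sumr_ge0 => i _.
by apply: sumr_ge0 => k _; apply: sumr_ge0.
Qed.

Definition contract (v : W) t : W -> C := fun u => t (v ++ u).

(* [x] inserted after the first [p] letters of a tensor of degree [p + q]. *)
Definition ins p q x t : W -> C :=
  wsum p (fun u => wsum q (fun v => \sum_j (t (u ++ v) * x j) *: word (u ++ j :: v))).

Definition sym2 t : Prop := forall w w', perm_eq w w' -> t w = t w'.

(** The relation [y x = x y + [y, x]] moves [x] past the letter [y] on its left. By the symmetry of
    [t], the letter consumed by the bracket can be contracted in first position. *)
Lemma ins_step p q x t : sym2 t ->
  eqv (ins p.+1 q x t) (ins p q.+1 x t + \sum_y ins p q (ad y x) (contract [:: y] t)).
Proof.
move=> tS; rewrite /eqv opprD addrA.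
rewrite (_ : _ - _ = wsum p (fun u => wsum q (fun v => \sum_y \sum_j
  (t (u ++ y :: v) * x j) *: lie_rel br u y j v))).
  apply: ideal_wsum => u _; apply: ideal_wsum => v _; apply: ideal_sum => y _.
  by apply: ideal_sum => j _; apply: idealZ; exact: ideal_rel.
have I1 : ins p.+1 q x t = wsum p (fun u => wsum q (fun v => \sum_y \sum_j
    (t (u ++ y :: v) * x j) *: word (u ++ [:: y, j & v]))).
  rewrite /ins wsum_rcons; apply: eq_wsum => u _; rewrite -wsum_sum.
  apply: eq_wsum => v _; apply: eq_bigr => y _; apply: eq_bigr => j _.
  by rewrite !cat_rcons.
have I2 : ins p q.+1 x t = wsum p (fun u => wsum q (fun v => \sum_y \sum_j
    (t (u ++ y :: v) * x j) *: word (u ++ [:: j, y & v]))).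
  by rewrite /ins; apply: eq_wsum => u _; rewrite wsumS -wsum_sum.
have I3 : \sum_y ins p q (ad y x) (contract [:: y] t) =
  wsum p (fun u => wsum q (fun v => \sum_y \sum_j (t (u ++ y :: v) * x j) *:
    \sum_l ((br y j 0 l)%:C%C : C) *: word (u ++ l :: v))).
  rewrite /ins -wsum_sum; apply: eq_wsum => u _; rewrite -wsum_sum.
  apply: eq_wsum => v _; apply: eq_bigr => y _.
  have tE : contract [:: y] t (u ++ v) = t (u ++ y :: v).
    by apply: tS; rewrite /= -cat1s (perm_catCA [:: y] u v).
  under eq_bigr do rewrite tE /ad mulr_sumr scaler_suml.
  rewrite exchange_big; apply: eq_bigr => j _; rewrite scaler_sumr.
  by apply: eq_bigr => l _; rewrite scalerA mulrA.
have wsumBB (F1 F2 F3 : W -> W -> W -> C) :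
    wsum p (fun u => wsum q (F1 u)) - wsum p (fun u => wsum q (F2 u)) -
    wsum p (fun u => wsum q (F3 u)) =
    wsum p (fun u => wsum q (fun v => F1 u v - F2 u v - F3 u v)).
  by rewrite -!wsumB; apply: eq_wsum => u _; rewrite -!wsumB.
rewrite I1 I2 I3 wsumBB; apply: eq_wsum => u _; apply: eq_wsum => v _.
rewrite -!sumrB; apply: eq_bigr => y _; rewrite -!sumrB; apply: eq_bigr => j _.
by rewrite -!scalerBr.
Qed.

(* [adl l k x t] is the image of [t], of degree [l + k], under the operator
   sending [y ^ (l + k)] to [ad_y ^ l (x) (x) y ^ k]. *)
Fixpoint adl l k x t : W -> C :=
  if l is l'.+1 then \sum_y adl l' k (ad y x) (contract [:: y] t) else ins 0 k x t.

Lemma sym2_contract v t : sym2 t -> sym2 (contract v t).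
Proof. by move=> tS w w' ww; apply: tS; rewrite perm_cat2l. Qed.

(** Polarized form of [y ^ p x = \sum_l C(p, l) (ad_y ^ l x) y ^ (p - l)], from [ins_step] by
    Pascal's rule. *)
Lemma ins_expand p q x t : sym2 t ->
  eqv (ins p q x t) (\sum_(l < p.+1) 'C(p, l)%:R *: adl l (p - l + q) x t).
Proof.
elim: p q x t => [|p IH] q x t tS.
  by rewrite big_ord1 bin0 scale1r /= add0n; exact: eqv_refl.
apply: (eqv_trans (ins_step _ _ _ tS)).
have E1 := IH q.+1 x t tS.
have E2 : eqv (\sum_y ins p q (ad y x) (contract [:: y] t))
    (\sum_y \sum_(l < p.+1) 'C(p, l)%:R *: adl l (p - l + q) (ad y x) (contract [:: y] t)).
  by apply: eqv_sum => y _; apply: IH; exact: sym2_contract.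
apply: (eqv_trans (eqvD E1 E2)); rewrite exchange_big.
rewrite (_ : _ + _ = \sum_(l < p.+2) 'C(p.+1, l)%:R *: adl l (p.+1 - l + q) x t).
  exact: eqv_refl.
rewrite [RHS]big_ord_recl [RHS]/= big_ord_recl /= !bin0 !subn0 addnS -addrA; congr (_ + _).
transitivity (\sum_(i < p.+1) ('C(p, i.+1)%:R *: adl i.+1 (p.+1 - i.+1 + q) x t +
    'C(p, i)%:R *: adl i.+1 (p.+1 - i.+1 + q) x t)).
  rewrite big_split/=; congr (_ + _).
    rewrite [RHS]big_ord_recr/= bin_small// scale0r addr0.
    apply: eq_bigr => i _; rewrite /bump /= add1n subSS addnS -addSn.
    by rewrite -subSn// subSS.
  by apply: eq_bigr => i _; rewrite -scaler_sumr subSS.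
apply: eq_bigr => i _; rewrite -scalerDl -natrD /bump /= add1n.
by rewrite binS.
Qed.

Lemma sum_binomial_column k l : (\sum_(p < k.+1) 'C(p, l) = 'C(k.+1, l.+1))%N.
Proof.
elim: k => [|k IH]; first by rewrite big_ord1; case: l => //= l; rewrite bin0n bin1S.
by rewrite big_ord_recr/= IH -binS.
Qed.

(** For [t] symmetric of degree [k] this is [k.+1] times the symmetric product of [x] and [t]. *)
Definition vsym x t : W -> C := fun w => \sum_(p <- picks w) x p.1 * t p.2.

Lemma map_picks w : [seq p.1 | p <- picks w] = w.
Proof.
elim: w => //= i w IH; congr (_ :: _); rewrite -map_comp -[RHS]IH.
exact: eq_map.
Qed.

Lemma vsym_symk k x t : symk k t -> symk k.+1 (vsym x t).
Proof.
move=> [t0 tS]; split=> [w wk|w w' ww].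
  apply: big1_seq => p /andP[_ pw]; rewrite t0 ?mulr0// => E.
  by apply: wk; rewrite (size_picks pw) E.
have E u : vsym x t u = \sum_(j <- u) x j * t (rem j u).
  rewrite -[in RHS](map_picks u) big_map; apply: eq_big_seq => p pu; congr (_ * _).
  apply: tS; rewrite map_picks; rewrite -(perm_cons p.1).
  rewrite perm_sym; apply: (perm_trans _ (perm_picks pu)); rewrite perm_sym perm_to_rem//.
  by rewrite -(map_picks u); apply: map_f.
rewrite !E (perm_big _ ww); apply: eq_big_seq => j jw; congr (_ * _); apply: tS.
rewrite -(perm_cons j) -(permPl (perm_to_rem _)) ?(perm_mem ww)//.
by rewrite -(permPr (perm_to_rem jw)).
Qed.

Lemma l1_vsym k x t : l1 k.+1 (vsym x t) <= k.+1%:R * vnorm x * l1 k t.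
Proof.
apply: (@le_trans _ _ (wsum k.+1 (fun w => \sum_(p <- picks w) cn (x p.1) * cn (t p.2)))).
  apply: ler_wsum => w _; apply: (le_trans (cn_sum _ _ _)).
  by apply: ler_sum => p _; rewrite cnM.
rewrite (wsum_picks _ (fun i u => cn (x i) * cn (t u))) -[leLHS]mulr_natl -mulrA ler_wpM2l//.
by rewrite /vnorm mulr_suml; apply: ler_sum => i _; rewrite wsum_mull.
Qed.

Lemma sum_ins_picks (V : nmodType) k (F : 'I_n -> W -> W -> V) :
  \sum_(p < k.+1) wsum p (fun u => wsum (k - p) (fun v => \sum_j F j (u ++ v) (u ++ j :: v))) =
  wsum k.+1 (fun w => \sum_(p <- picks w) F p.1 p.2 w).
Proof.
elim: k F => [|k IH] F.
  rewrite big_ord1 subnn /=; apply: eq_bigr => j _; by rewrite big_seq1.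
rewrite big_ord_recl [RHS]wsumS.
transitivity (\sum_i (wsum k.+1 (fun w => F i w (i :: w)) +
   wsum k.+1 (fun w => \sum_(p <- picks w) F p.1 (i :: p.2) (i :: w)))); last first.
  by apply: eq_bigr => i _; rewrite -wsumD; apply: eq_wsum => w _; rewrite [picks _]/= big_cons big_map.
rewrite big_split; congr (_ + _).
  by rewrite -[LHS]/(wsum k.+1 (fun v => \sum_j F j v (j :: v))) wsum_sum.
transitivity (\sum_i \sum_(p < k.+1) wsum p (fun u => wsum (k - p) (fun v =>
    \sum_j F j (i :: (u ++ v)) (i :: (u ++ j :: v))))); last first.
  by apply: eq_bigr => i _; rewrite (IH (fun j v w => F j (i :: v) (i :: w))).
rewrite [RHS]exchange_big; apply: eq_bigr => p _; rewrite lift0 wsumS.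
by apply: eq_bigr => i _; apply: eq_wsum => u _; rewrite subSS.
Qed.

Lemma sum_ins k x t : symk k t -> \sum_(p < k.+1) ins p (k - p) x t = vsym x t.
Proof.
move=> tS; have [v0 _] := vsym_symk x tS.
rewrite [RHS](word_expand v0) /ins.
rewrite (sum_ins_picks k (fun j v w => (t v * x j) *: word w)).
apply: eq_wsum => w _; rewrite /vsym scaler_suml; apply: eq_bigr => p _.
by rewrite mulrC.
Qed.

(** [ins_expand] summed over all positions of [x]; the columns of Pascal's triangle add up to
    ['C(k.+1, l.+1)]. The term [l = 0] is [k.+1] times the product of [x] and [t], so the relation
    can be solved for that product. *)
Lemma vsym_expand k x t : symk k t ->
  eqv (vsym x t) (\sum_(l < k.+1) 'C(k.+1, l.+1)%:R *: adl l (k - l) x t).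
Proof.
move=> tS; rewrite -(sum_ins x tS).
have H : eqv (\sum_(p < k.+1) ins p (k - p) x t)
    (\sum_(p < k.+1) \sum_(l < k.+1) 'C(p, l)%:R *: adl l (k - l) x t).
  apply: eqv_sum => p _; apply: (eqv_trans (ins_expand _ _ _ tS.2)).
  rewrite (big_ord_widen k.+1 (fun l => 'C(p, l)%:R *: adl l (p - l + (k - p)) x t))//.
  rewrite big_mkcond /=; rewrite (eq_bigr (fun l : 'I_k.+1 => 'C(p, l)%:R *: adl l (k - l) x t)).
    exact: eqv_refl.
  move=> l _; case: ifPn => [lp|]; last by rewrite -leqNgt => pl; rewrite bin_small// scale0r.
  by congr (_ *: adl _ _ _ _); have := ltn_ord p; lia.
apply: (eqv_trans H).
rewrite exchange_big (eq_bigr (fun l : 'I_k.+1 => 'C(k.+1, l.+1)%:R *: adl l (k - l) x t)).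
  exact: eqv_refl.
move=> l _; rewrite -scaler_suml -natr_sum; congr (_%:R *: _).
exact: sum_binomial_column.
Qed.

Fixpoint adw v x : 'I_n -> C := if v is y :: v' then adw v' (ad y x) else x.

Lemma adlE l k x t : adl l k x t = wsum l (fun v => ins 0 k (adw v x) (contract v t)).
Proof.
elim: l x t => [|l IH] x t //=.
by apply: eq_bigr => y _; rewrite IH.
Qed.

Lemma adw_bound v x : vnorm (adw v x) <= bnorm ^+ size v * vnorm x.
Proof.
elim: v x => [|y v IH] x /=; first by rewrite expr0 mul1r.
apply: (le_trans (IH _)); rewrite exprS [bnorm * _]mulrC -mulrA.
by rewrite ler_wpM2l ?exprn_ge0 ?bnorm_ge0// ad_norm.
Qed.

Lemma l1_contract l k x t :
  wsum l (fun v => vnorm (adw v x) * l1 k (contract v t)) <=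
  bnorm ^+ l * vnorm x * l1 (l + k) t.
Proof.
rewrite [l1 (l + k) t]wsum_cat -wsum_mull; apply: ler_wsum => v <-.
by rewrite ler_wpM2r ?l1_ge0 ?adw_bound.
Qed.

Lemma contract_symk l k v t : size v = l -> symk (l + k) t -> symk k (contract v t).
Proof.
move=> vl [t0 tS]; split; last exact: sym2_contract.
move=> w wk; apply: t0; rewrite size_cat vl => /eqP; rewrite eqn_add2l => /eqP.
exact: wk.
Qed.

Lemma sum_pow_half l : \sum_(i < l) (2^-1 : R) ^+ i.+1 <= 1.
Proof.
have -> : \sum_(i < l) (2^-1 : R) ^+ i.+1 = 1 - 2^-1 ^+ l.
  elim: l => [|l IH]; first by rewrite big_ord0 expr0 subrr.
  by rewrite big_ord_recr/= IH exprS; lra.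
by rewrite gerBl exprn_ge0.
Qed.

Lemma pow2_fact l : (2 ^ l <= l.+1`!)%N.
Proof. by elim: l => // l IH; rewrite expnS factS leq_mul. Qed.

Lemma bin_ffact_split k l j : (l <= j)%N ->
  ('C(k, l) * (k - l) ^_ (j - l) * l`! = k ^_ j)%N.
Proof.
move=> lj; rewrite mulnAC bin_ffact.
rewrite -{2}(subnKC lj); elim: (j - l)%N => [|d IH]; first by rewrite addn0 muln1.
by rewrite addnS !ffactnSr mulnA IH subnDA.
Qed.

(* The Bernoulli-type recursion
   [x (x) t == x \/ t - sum_(l >= 1) C(k, l) / (l + 1) ad_t ^ l (x) (x) t]
   has coefficients small enough for the bound to be [k ^_ j]. *)
Lemma left_mul_expand k x t : symk k t -> exists A : nat -> W -> C,
  [/\ forall j, (j <= k)%N -> symk (k.+1 - j) (A j),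
      A 0%N = (k.+1%:R : R[i])^-1 *: vsym x t,
      forall j, (j <= k)%N ->
        l1 (k.+1 - j) (A j) <= bnorm ^+ j * (k ^_ j)%:R * vnorm x * l1 k t &
      eqv (ins 0 k x t) (\sum_(j < k.+1) A j)].
Proof.
elim/ltn_ind: k x t => k IH x t tS.
(* Expansions of the contracted products; [v] is nonempty, so the induction hypothesis provides
   them. *)
pose P (v : W) (A : nat -> W -> C) := (0 < size v <= k)%N -> let m := (k - size v)%N in
  [/\ forall j, (j <= m)%N -> symk (m.+1 - j) (A j),
      forall j, (j <= m)%N -> l1 (m.+1 - j) (A j) <=
         bnorm ^+ j * (m ^_ j)%:R * vnorm (adw v x) * l1 m (contract v t) &
      eqv (ins 0 m (adw v x) (contract v t)) (\sum_(j < m.+1) A j)].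
have /choice[A AP] : forall v, exists A, P v A.
  move=> v; have [/andP[v0 vk]|] := boolP (0 < size v <= k)%N; last first.
    by move=> H; exists (fun=> 0) => H'; rewrite H' in H.
  have mk : (k - size v < k)%N by rewrite ltn_subrL v0 (leq_trans v0).
  have tS' : symk (k - size v) (contract v t).
    by apply: (contract_symk erefl); rewrite subnKC.
  have [A [A1 _ A3 A4]] := IH _ mk (adw v x) _ tS'.
  by exists A => _.
(* Equal to ['C(k.+1, l.+1) / k.+1], the coefficient in [vsym_expand] after division by [k.+1]. *)
pose coef l : R[i] := 'C(k, l)%:R / l.+1%:R.
(* The part lowered by [i] further degrees of the term with [l] contractions. The term [l = 0] is
   the unknown itself, hence the value 0. *)
pose T l i : W -> C := if l is 0 then 0 else coef l *: wsum l (fun v => A v i).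
pose A' j : W -> C := if j is 0 then (k.+1%:R : R[i])^-1 *: vsym x t
  else - \sum_(l < j.+1) T l (j - l)%N.
have k1 : (k.+1%:R : R[i]) != 0 by rewrite pnatr_eq0.
have TS l i : (l <= k)%N -> (i <= k - l)%N -> symk (k.+1 - (l + i)) (T l i).
  case: l => [|l] lk ik; first exact: symk0.
  apply: symkZ; apply: symk_wsum => v vl.
  have [|+ _ _] := AP v; rewrite vl ?lk// => /(_ _ ik).
  by have -> : ((k - l.+1).+1 - i = k.+1 - (l.+1 + i))%N by lia.
exists A'; split=> //.
- move=> [|j] jk; first by rewrite subn0; apply: symkZ; exact: vsym_symk.
  rewrite [A' _]/A' -[X in symk _ X]scaleN1r; apply: symkZ; apply: symk_sum => -[l /= lj] _.
  by have := TS l (j.+1 - l)%N; rewrite subnKC; [apply; lia|lia].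
- move=> [|j] jk.
    rewrite subn0 expr0 ffactn0 !mul1r /A' l1Z cnV cn_nat mulrC ler_pdivrMr ?ltr0n//.
    by apply: (le_trans (l1_vsym _ _ _)); rewrite -mulrA mulrC.
  rewrite /A' l1N; apply: (le_trans (l1_sum _ _ _ _)).
  rewrite big_ord_recl (_ : l1 _ (T _ _) = 0) ?add0r; last exact: l10.
  set Q := bnorm ^+ j.+1 * (k ^_ j.+1)%:R * vnorm x * l1 k t.
  have Q0 : 0 <= Q by rewrite /Q !mulr_ge0 ?exprn_ge0 ?bnorm_ge0 ?vnorm_ge0 ?l1_ge0.
  (* The term with [l.+1] contractions receives the share [2^-1 ^+ l.+1], because
     [2 ^ l.+1 <= l.+2!]. The shares sum to at most 1, so the constant in the bound does not grow
     along the recursion. *)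
  apply: (@le_trans _ _ (\sum_(l < j.+1) (2^-1 ^+ l.+1) * Q)); last first.
    by rewrite -mulr_suml -[X in _ <= X]mul1r ler_wpM2r// sum_pow_half.
  apply: ler_sum => l' _; rewrite lift0; move: (nat_of_ord l') (ltn_ord l') => l lj {l'}.
  have lk : (l.+1 <= k)%N by lia.
  rewrite -[T _ _]/(coef l.+1 *: wsum l.+1 (fun v => A v (j.+1 - l.+1)%N)) l1Z; apply: (le_trans (ler_wpM2l (cn_ge0 _) (l1_wsum _ _ _))).
  apply: (@le_trans _ _ (cn (coef l.+1) * wsum l.+1 (fun v =>
      bnorm ^+ (j - l) * ((k - l.+1) ^_ (j - l))%:R *
      (vnorm (adw v x) * l1 (k - l.+1) (contract v t))))).
    rewrite ler_wpM2l ?cn_ge0//; apply: ler_wsum => v vl.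
    have [|_ + _] := AP v; rewrite vl ?lk// => /(_ (j - l)%N).
    rewrite subSS (_ : (k - l.+1).+1 - (j - l) = k - j)%N; last by lia.
    by rewrite !mulrA; apply; lia.
  rewrite wsum_mull; apply: (@le_trans _ _ (cn (coef l.+1) *
     (bnorm ^+ (j - l) * ((k - l.+1) ^_ (j - l))%:R * (bnorm ^+ l.+1 * vnorm x * l1 k t)))).
    rewrite ler_wpM2l ?cn_ge0// ler_wpM2l ?mulr_ge0 ?exprn_ge0 ?bnorm_ge0//.
    by apply: (le_trans (l1_contract _ _ _ _)); rewrite subnKC.
  rewrite /coef cnM cnV !cn_nat /Q.
  have -> : bnorm ^+ j.+1 = bnorm ^+ (j - l) * bnorm ^+ l.+1.
    by rewrite -exprD; congr (_ ^+ _); lia.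
  have E : 'C(k, l.+1)%:R / l.+2%:R * ((k - l.+1) ^_ (j - l))%:R <=
      2^-1 ^+ l.+1 * (k ^_ j.+1)%:R :> R.
    have H := @bin_ffact_split k l.+1 j.+1 lj.
    rewrite exprVn mulrAC ler_pdivrMr ?ltr0n// mulrAC mulrC -mulrA ler_pdivlMl ?exprn_gt0//.
    rewrite -natrX -!natrM ler_nat.
    have <- := H; rewrite subSS.
    have := pow2_fact l.+1; rewrite factS.
    set c := 'C(k, l.+1); set f := (_ ^_ _)%N; set g := (l.+1)`!.
    move=> p2; rewrite [X in (_ <= X)%N](_ : _ = c * f * (l.+2 * g))%N; last by ring.
    by rewrite [(f * c)%N]mulnC [X in (X <= _)%N]mulnC leq_mul2l p2 orbT.
  set q := vnorm x * l1 k t.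
  have q0 : 0 <= q by rewrite mulr_ge0 ?vnorm_ge0 ?l1_ge0.
  set b1 := bnorm ^+ (j - l); set b2 := bnorm ^+ l.+1.
  have b0 : 0 <= b1 * b2 by rewrite mulr_ge0 ?exprn_ge0 ?bnorm_ge0.
  rewrite [X in X <= _](_ : _ = b1 * b2 * q * ('C(k, l.+1)%:R / l.+2%:R * ((k - l.+1) ^_ (j - l))%:R)); last first.
    by rewrite /q; ring.
  rewrite [X in _ <= X](_ : _ = b1 * b2 * q * (2^-1 ^+ l.+1 * (k ^_ j.+1)%:R)); last by rewrite /q; ring.
  by apply: ler_wpM2l E; exact: mulr_ge0 b0 q0.
have vE := eqvZ (k.+1%:R : R[i])^-1 (vsym_expand x tS).
move: vE; rewrite scaler_sumr big_ord_recl [X in eqv _ (X + _)](_ : _ = ins 0 k x t); last first.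
  by rewrite bin1 scalerA mulVf// scale1r subn0.
set rest := (X in eqv _ (_ + X)) => vE.
have rE : eqv rest (\sum_(l < k) \sum_(i < k - l) T l.+1 i).
  apply: eqv_sum => l' _; rewrite lift0; move: (nat_of_ord l') (ltn_ord l') => l lk {l'}.
  rewrite scalerA.
  rewrite (_ : _ * _ = coef l.+1); last first.
    rewrite /coef mulrC; apply/eqP; rewrite eqr_div ?pnatr_eq0// -!natrM eqr_nat.
    by rewrite mulnC -mul_bin_diag mulnC.
  rewrite -scaler_sumr -wsum_sum; apply: eqvZ; rewrite adlE.
  apply: eqv_wsum => v vl; have [|_ _] := AP v; first by rewrite vl.
  by rewrite vl (_ : (k - l.+1).+1 = k - l)%N//; lia.
have AE : \sum_(j < k.+1) A' j = (k.+1%:R : R[i])^-1 *: vsym x t -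
    \sum_(l < k) \sum_(i < k - l) T l.+1 i.
  rewrite big_ord_recl; congr (_ + _).
  transitivity (- \sum_(l < k) \sum_(j < l.+2) T j (l.+1 - j)%N).
    by rewrite -sumrN; apply: eq_bigr => l _; rewrite lift0.
  congr (- _); have := big_triangle T k.+1.
  rewrite big_ord_recl [X in X + _ = _]big1 ?add0r => [|i _]; last by rewrite ord1.
  rewrite [in RHS]big_ord_recl [X in _ = X + _]big1 ?add0r => [|i _]; last by [].
  exact.
rewrite AE.
by have := eqvD (eqv_sym vE) (eqvZ (-1) rE); rewrite !scaleN1r addrK.
Qed.

End Enveloping.

(** * The Gutt product as a polynomial in the deformation parameter *)

Section GuttExpansion.
Context (R : realType) (n : nat).
Local Notation C := (R[i]^o).
Local Notation W := (seq 'I_n).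
Local Notation cn := (@Normc.normc R).
Local Notation word := (@word R n).
Implicit Types (t a b : W -> C) (u v w : W).

Lemma symk_pairing_inj k a b : symk k a -> symk k b ->
  (forall F : W -> C, sym2 F -> wsum k (fun w => a w * F w) = wsum k (fun w => b w * F w)) ->
  a = b.
Proof.
move=> [a0 aS] [b0 bS] H; apply/funext => u.
have [uk|/eqP uk] := eqVneq (size u) k; last by rewrite a0// b0.
pose F w : C := (perm_eq u w)%:R.
have FS : sym2 F by move=> w w' ww; rewrite /F (permPr ww).
have E (c : W -> C) : sym2 c -> wsum k (fun w => c w * F w) = c u * wsum k F.
  move=> cS; rewrite -wsum_mull; apply: eq_wsum => w _; rewrite /F.
  by case: (boolP (perm_eq u w)) => [/cS ->//|_]; rewrite !mulr0.
have := H F FS; rewrite (E a aS) (E b bS).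
apply: mulIf; rewrite gt_eqF//; apply: (@lt_le_trans _ _ (F u)).
  by rewrite /F perm_refl ltr01.
by apply: wsum_ge => // w; exact: ler0n.
Qed.

Lemma vee_perm w w' : perm_eq w w' -> vee R w = vee R w'.
Proof.
move=> ww; have sw := perm_size ww.
apply: (symk_pairing_inj (vee_symk R w)); first by rewrite sw; exact: vee_symk.
move=> F FS; rewrite [LHS](@vee_pairing R n _ F w FS) sw.
by rewrite [RHS](@vee_pairing R n _ F w' FS); exact: FS.
Qed.

Definition delta (i : 'I_n) : 'I_n -> C := fun j => (j == i)%:R.

Lemma vnorm_delta i : vnorm (delta i) = 1.
Proof.
rewrite /vnorm (bigD1 i)//= /delta eqxx Normc.normc1 big1 ?addr0// => j /negPf ->.
exact: cn0.
Qed.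

Lemma vee_cons i w : ((size w).+1%:R : R[i])^-1 *: vsym (delta i) (vee R w) = vee R (i :: w).
Proof.
have k1 : ((size w).+1%:R : R[i]) != 0 by rewrite pnatr_eq0.
apply: (@symk_pairing_inj (size w).+1); first by apply: symkZ; apply: vsym_symk; exact: vee_symk.
  exact: (vee_symk R (i :: w)).
move=> F FS; rewrite [RHS](@vee_pairing R n _ F (i :: w) FS).
transitivity (((size w).+1%:R : R[i])^-1 * wsum (size w).+1 (fun u => \sum_(p <- picks u)
    (delta i p.1 * vee R w p.2 * F (p.1 :: p.2)))).
  rewrite -wsum_mull; apply: eq_wsum => u _; rewrite -[X in X * _ = _]/(_ * _) -mulrA.
  congr (_ * _); rewrite /vsym mulr_suml; apply: eq_big_seq => p /perm_picks pu.
  by rewrite (FS _ _ pu).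
rewrite (wsum_picks _ (fun j v => delta i j * vee R w v * F (j :: v))).
rewrite -[X in _ * X]mulr_natl mulrA mulVf// mul1r (bigD1 i)//= big1 ?addr0; last first.
  by move=> j ji; apply: wsum_eq0 => u _; rewrite /delta (negPf ji) !mul0r.
rewrite -[RHS](@vee_pairing R n _ (fun v => F (i :: v)) w); last first.
  by move=> u u' uu; apply: FS; rewrite perm_cons.
by apply: eq_wsum => u _; rewrite /delta eqxx mul1r.
Qed.

Lemma vee_nil : vee R [::] = word [::].
Proof.
rewrite /vee /= invr1 scale1r (eq_bigr (fun=> word [::])).
  by rewrite sumr_const card_Sn.
by move=> s _; congr Defs.word; apply/eqP; rewrite -size_eq0 size_permute.
Qed.

Lemma ins0_delta k i t : (forall w, size w <> k -> t w = 0) ->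
  ins 0 k (delta i) t = lmul i t.
Proof.
move=> t0; rewrite [in RHS](word_expand t0) /ins /=.
rewrite (wsum_additive (f := lmul i)); [|exact: tensor_prod0r|by move=> x y; exact: tensor_prodDr].
apply: eq_wsum => v _; rewrite lmulZ lmul_word (bigD1 i)//= /delta eqxx mulr1 big1 ?addr0//.
by move=> j /negPf ->; rewrite mulr0 scale0r.
Qed.

Lemma leq_ffact k k' j : (k <= k')%N -> (k ^_ j <= k' ^_ j)%N.
Proof.
by move=> kk; elim: j => // j IH; rewrite !ffactnSr leq_mul// leq_sub2r.
Qed.

Lemma ffact_split k i j : (k ^_ i * (k - i) ^_ j = k ^_ (i + j))%N.
Proof.
elim: j => [|d IH]; first by rewrite addn0 muln1.
by rewrite addnS !ffactnSr mulnA IH subnDA.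
Qed.

Lemma sum_pow2 k : \sum_(i < k) (2 : R) ^+ i <= 2 ^+ k.
Proof.
elim: k => [|k IH]; first by rewrite big_ord0 expr0.
by rewrite big_ord_recr/= exprS; move: IH; lra.
Qed.

Context (br : 'I_n -> 'I_n -> 'rV[R]_n).
Local Notation eqv := (eqv br).
Local Notation beta := (bnorm br).

Lemma word_sym_expand w : exists S : nat -> W -> C,
  [/\ forall m, (m <= size w)%N -> symk (size w - m) (S m), S 0%N = vee R w,
      forall m, (m <= size w)%N -> l1 (size w - m) (S m) <=
        2 ^+ (size w + m) * beta ^+ m * (size w ^_ m)%:R &
      eqv (word w) (\sum_(m < (size w).+1) S m)].
Proof.
elim: w => [|i w [S [S1 S2 S3 S4]]].
  exists (fun=> vee R [::]); split=> //.
  - by move=> [|m]// _; exact: (vee_symk R [::]).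
  - move=> [|m]// _; rewrite !expr0 !mul1r ffactn0.
    by apply: (le_trans (l1_vee R [::])).
  - by rewrite big_ord1 vee_nil; exact: eqv_refl.
set k := size w in S1 S2 S3 S4.
pose P m (A : nat -> W -> C) := (m <= k)%N ->
  [/\ forall j, (j <= k - m)%N -> symk ((k - m).+1 - j) (A j),
      A 0%N = ((k - m).+1%:R : R[i])^-1 *: vsym (delta i) (S m),
      forall j, (j <= k - m)%N -> l1 ((k - m).+1 - j) (A j) <=
         beta ^+ j * ((k - m) ^_ j)%:R * vnorm (delta i) * l1 (k - m) (S m) &
      eqv (ins 0 (k - m) (delta i) (S m)) (\sum_(j < (k - m).+1) A j)].
have /choice[A AP] : forall m, exists A, P m A.
  move=> m; have [mk|km] := leqP m k; last by exists (fun=> 0); rewrite /P leqNgt km.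
  by have [A HA] := left_mul_expand br (delta i) (S1 m mk); exists A.
(* The drop [m = k.+1] does not occur, since the terms of [A j] have degree at least 1. *)
pose S' m : W -> C := if (m <= k)%N then \sum_(j < m.+1) A j (m - j)%N else 0.
have szE : size (i :: w) = k.+1 by [].
exists S'; rewrite szE; split.
- move=> m _; rewrite /S'; case: ifP => mk; last exact: symk0.
  apply: symk_sum => -[j /= jm] _; have jk : (j <= k)%N by lia.
  have [H _ _ _] := AP j jk; have := H (m - j)%N.
  by rewrite (_ : (k - j).+1 - (m - j) = k.+1 - m)%N; [apply; lia|lia].
- rewrite /S' leq0n big_ord1; have [_ -> _ _] := AP 0%N (leq0n k).
  by rewrite !subn0 S2 vee_cons.
- move=> m _; rewrite /S'; case: ifP => mk; last first.
    by rewrite l10 !mulr_ge0 ?exprn_ge0 ?bnorm_ge0.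
  apply: (le_trans (l1_sum _ _ _ _)).
  apply: (@le_trans _ _ (\sum_(j < m.+1) 2 ^+ j * (2 ^+ k * beta ^+ m * (k ^_ m)%:R))).
    apply: ler_sum => -[j /= jm] _; have jk : (j <= k)%N by lia.
    have [_ _ H _] := AP j jk; have := H (m - j)%N.
    rewrite (_ : (k - j).+1 - (m - j) = k.+1 - m)%N; last by lia.
    move=> H'; apply: (le_trans (H' _)); first by lia.
    rewrite vnorm_delta mulr1.
    apply: (le_trans (ler_wpM2l _ (S3 j jk))).
      by rewrite mulr_ge0 ?exprn_ge0 ?bnorm_ge0.
    have jm' : (j <= m)%N by rewrite -ltnS.
    rewrite le_eqVlt; apply/orP; left; apply/eqP.
    have <- : (k ^_ j * (k - j) ^_ (m - j))%N = k ^_ m by rewrite ffact_split subnKC.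
    rewrite -{3}(subnKC jm') !exprD natrM; ring.
  rewrite -mulr_suml; apply: (le_trans (ler_wpM2r _ (sum_pow2 _))).
    by rewrite !mulr_ge0 ?exprn_ge0 ?bnorm_ge0.
  rewrite !mulrA -exprD (_ : m.+1 + k = k.+1 + m)%N; last by lia.
  rewrite ler_wpM2l ?mulr_ge0 ?exprn_ge0 ?bnorm_ge0// ler_nat.
  exact: leq_ffact.
- rewrite -lmul_word; apply: (eqv_trans (lmul_eqv i S4)); rewrite lmul_sum.
  have E : eqv (\sum_(m < k.+1) lmul i (S m)) (\sum_(m < k.+1) \sum_(j < k.+1 - m) A m j).
    apply: eqv_sum => m _; have mk := ltnSE (ltn_ord m).
    have [_ _ _] := AP m mk; rewrite ins0_delta; last by case: (S1 m mk).
    by rewrite subSn.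
  apply: (eqv_trans E); rewrite -big_triangle [X in eqv _ X]big_ord_recr /=.
  rewrite {2}/S' ltnn addr0.
  rewrite (eq_bigr (fun m : 'I_k.+1 => S' m)); first exact: eqv_refl.
  by move=> m _; rewrite /S' (ltnSE (ltn_ord m)).
Qed.

Lemma fsum_words_deg (V : nmodType) k (F : W -> V) :
  (forall w, size w <> k -> F w = 0) -> \sum_(w \in [set: W]) F w = wsum k F.
Proof.
move=> F0; rewrite (@fsum_words _ _ k.+1).
  rewrite big_ord_recr/= big1 ?add0r// => j _; apply: wsum_eq0 => w wj; apply: F0.
  by rewrite wj => E; have := ltn_ord j; rewrite E ltnn.
by move=> w kw; apply: F0 => E; move: kw; rewrite E ltnn.
Qed.

Lemma sym_prod_vee (a b : W) : sym_prod (vee R a) (vee R b) = vee R (a ++ b).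
Proof.
have a0 := (vee_symk R a).1; have b0 := (vee_symk R b).1.
rewrite /sym_prod (@fsum_words_deg _ (size a)); last first.
  by move=> w wa; apply: fsbig1 => u _; rewrite a0// mul0r scale0r.
transitivity (wsum (size a) (fun w => vee R a w *: vee R (w ++ b))).
  apply: eq_wsum => w _; rewrite (@fsum_words_deg _ (size b)); last first.
    by move=> u ub; rewrite b0// mulr0 scale0r.
  rewrite -[vee R (w ++ b)](@vee_pairing R n _ (fun u => vee R (w ++ u)) b); last first.
    by move=> u u' uu; apply: vee_perm; rewrite perm_cat2l.
  by rewrite -wsum_scale; apply: eq_wsum => u _; exact/esym/scalerA.
apply: (@vee_pairing R n _ (fun w => vee R (w ++ b)) a) => u u' uu.
by apply: vee_perm; rewrite perm_cat2r.
Qed.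

(** Functionals that annihilate the ideal and are triangular with respect to the degree;
    [pbw_pairing] supplies them for the bracket of the group. *)
Hypothesis pbw : forall u : W, exists e : W -> R,
  [/\ forall w, (size w < size u)%N -> e w = 0,
      forall w, size w = size u -> e w = (matchings w u)%:R &
      forall (a b : W) i j, e (a ++ [:: i, j & b]) - e (a ++ [:: j, i & b]) -
        \sum_k br i j 0 k * e (a ++ k :: b) = 0].

(** Cut off at degree [D] because a function on words need not have finite support. *)
Definition pair D (e : W -> R) t : C :=
  \sum_(k < D) wsum k (fun w => t w * ((e w)%:C%C : C)).

Lemma pairD D e a b : pair D e (a + b) = pair D e a + pair D e b.
Proof.
rewrite /pair -big_split/=; apply: eq_bigr => k _; rewrite -wsumD.
by apply: eq_wsum => w _; rewrite -mulrDl.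
Qed.

Lemma pairZ D e c a : pair D e (c *: a) = c * pair D e a.
Proof.
rewrite /pair mulr_sumr; apply: eq_bigr => k _; rewrite -wsum_mull.
by apply: eq_wsum => w _; rewrite mulrA.
Qed.

Lemma pair0 D e : pair D e 0 = 0.
Proof. by apply: big1 => k _; apply: wsum_eq0 => w _; exact: mul0r. Qed.

Lemma pair_sum D e (I : Type) (s : seq I) (f : I -> W -> C) :
  pair D e (\sum_(i <- s) f i) = \sum_(i <- s) pair D e (f i).
Proof. by apply: (big_morph (pair D e)); [exact: pairD|exact: pair0]. Qed.

Lemma pair_word D e w : (size w < D)%N -> pair D e (word w) = (e w)%:C%C.
Proof.
move=> wD; rewrite /pair (bigD1 (Ordinal wD))//= (wsum_pred1 (u := w))//=.
  rewrite /Defs.word eqxx mul1r big1 ?addr0// => k kw; apply: wsum_eq0 => u uk.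
  case: eqP => [E|]; rewrite ?mul0r//; move: kw.
  by rewrite -val_eqE /= -uk E eqxx.
by move=> u _ uw; rewrite /Defs.word (negPf uw) mul0r.
Qed.

Lemma pair_rel D (e : W -> R) (a b : W) i j :
  (forall (a b : W) i j, e (a ++ [:: i, j & b]) - e (a ++ [:: j, i & b]) -
        \sum_k br i j 0 k * e (a ++ k :: b) = 0) ->
  (size a + (size b).+2 < D)%N -> pair D e (lie_rel br a i j b) = 0.
Proof.
have BN (y z : W -> C) : y - z = y + (-1) *: z by rewrite scaleN1r.
move=> e0 sD; rewrite /lie_rel !BN !pairD !pairZ pair_sum !pair_word ?size_cat//=.
under eq_bigr => k _.
  rewrite pairZ pair_word ?size_cat/=; last by rewrite (leq_trans _ sD)// ltnS leq_add2l.
  rewrite -rmorphM/=; over.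
by rewrite -rmorph_sum/= !mulN1r -!rmorphN -!rmorphD/= e0.
Qed.

Lemma pair_ideal (e : W -> R) t :
  (forall (a b : W) i j, e (a ++ [:: i, j & b]) - e (a ++ [:: j, i & b]) -
        \sum_k br i j 0 k * e (a ++ k :: b) = 0) ->
  env_ideal br t -> exists D0, forall D, (D0 <= D)%N -> pair D e t = 0.
Proof.
move=> e0 /idealP[s ->].
exists (\sum_(x <- s) (size x.1.2.1 + (size x.1.2.2).+2).+1)%N => D.
elim: s => [|x s IH]; first by rewrite !big_nil => _; exact: pair0.
rewrite !big_cons => sD; rewrite pairD pairZ pair_rel ?mulr0 ?add0r//.
  by apply: IH; apply: leq_trans sD; exact: leq_addl.
by apply: leq_trans sD; exact: leq_addr.
Qed.

(** Descending induction on the degree. The functional of [w] ignores lower degrees, the higher ones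
    are already known to vanish, and what it sees in degree [size w] is [(size w)!] times [t w]. *)
Lemma sym_ideal0 t : is_sym t -> env_ideal br t -> t = 0.
Proof.
move=> [[d td] tS] tI.
suff H m : forall w, (d.+1 - m <= size w)%N -> t w = 0.
  by apply/funext => w; apply: (H d.+1); rewrite subnn.
elim: m => [|m IH] w; first by rewrite subn0 => /td.
have [/IH//|wm mw] := leqP (d.+1 - m) (size w).
have wE : (d.+1 - m = (size w).+1)%N by apply/eqP; rewrite eqn_leq wm andbT; lia.
have [e [e1 e2 e3]] := pbw w; have [D0 H] := pair_ideal e3 tI.
have wD : (size w < maxn D0 (size w).+1)%N by rewrite leq_max leqnn orbT.
have := H (maxn D0 (size w).+1) (leq_maxl _ _).
rewrite /pair (bigD1 (Ordinal wD))//= big1 ?addr0; last first.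
  move=> k; rewrite -val_eqE/= neq_ltn => /orP[kw|wk]; apply: wsum_eq0 => u uk.
    by rewrite e1 ?uk// mulr0.
  by rewrite IH ?mul0r// uk wE.
rewrite (eq_wsum (F' := fun u => t u *+ matchings u w)); last first.
  by move=> u uw; rewrite e2// rmorph_nat mulr_natr.
rewrite (wsum_matchings w tS) => /eqP; rewrite mulrn_eq0 => /orP[|/eqP//].
by rewrite -leqn0 leqNgt fact_gt0.
Qed.

(** [sym_ideal0] makes the choice in [gutt] unique: two candidates differ by a symmetric tensor
    which, after an invertible scaling of each degree, lies in the ideal. *)
Lemma gutt_eq (z : C) (a b v : W -> C) : z != 0 -> is_sym v ->
  env_ideal br (quant z v - tensor_prod (quant z a) (quant z b)) -> gutt br z a b = v.
Proof.
move=> z0 vS vI; rewrite /gutt (negPf z0).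
set Q := [set x | _]; have Qv : Q v by [].
have := @xgetI _ 0 Q v Qv; set v' := xget 0 Q => -[v'S v'I].
have I2 : env_ideal br (quant z v' - quant z v).
  have := idealD v'I (idealN vI); rewrite opprB addrA subrK.
  by [].
have zS (x : W -> C) : is_sym x -> is_sym (fun u => z ^+ size u * x u : C).
  move=> [[d xd] xS]; split; first by exists d => w dw; rewrite xd// mulr0.
  by move=> w w' ww; rewrite (xS _ _ ww) (perm_size ww).
have dS : is_sym (v' - v).
  have [[[d xd] xS] [[d' xd'] xS']] := (v'S, vS); split.
    exists (maxn d d') => w; rewrite gtn_max => /andP[dw dw'].
    by rewrite -[LHS]/(v' w - v w) xd// xd'// subrr.
  by move=> w w' ww; rewrite -[LHS]/(v' w - v w) (xS _ _ ww) (xS' _ _ ww).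
have E : quant z v' - quant z v = fun u => z ^+ size u * (v' - v) u.
  by rewrite !quantE//; apply/funext => u; rewrite -[RHS]/(_ * (v' u - v u)) mulrBr.
have := sym_ideal0 (zS _ dS); rewrite -E => /(_ I2).
rewrite E => H; apply/funext => u.
have /eqP : z ^+ size u * (v' - v) u = 0 by move/(congr1 (fun f => f u)): H.
rewrite mulf_eq0 expf_eq0 (negPf z0) andbF /= => /eqP H'.
by apply/eqP; rewrite -subr_eq0; apply/eqP.
Qed.

(** The tensor product of two symmetrized words is an average of concatenations of permuted words,
    and [word_sym_expand] rewrites each of these as symmetric tensors. *)
Theorem gutt_expansion : exists2 K : R, 1 <= K & exists Cn : W -> W -> nat -> W -> C,
  forall a b : W, [/\
    forall m, (m <= size a + size b)%N -> symk (size a + size b - m) (Cn a b m),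
    forall m, (m <= size a + size b)%N ->
      l1 (size a + size b - m) (Cn a b m) <= K ^+ (size a + size b) * m`!%:R &
    forall z : C, gutt br z (vee R a) (vee R b) =
      \sum_(m < (size a + size b).+1) z ^+ m *: Cn a b m].
Proof.
have [S SP] := choice word_sym_expand.
pose b1 := Num.max 1 beta.
have b11 : 1 <= b1 by rewrite le_max lexx.
have b10 : 0 <= b1 by apply: le_trans b11.
(* For [m <= k], the factors [2 ^ (k + m) <= 4 ^ k], [beta ^ m <= b1 ^ k] and [k ^_ m <= 2 ^ k * m!]
   multiply to [(8 * b1) ^ k * m!]. *)
exists (8 * b1); first by rewrite -[1]mulr1 ler_pM//; lra.
pose cf (a b : W) : R[i] := ((size a)`!%:R * (size b)`!%:R)^-1.
pose Cn (a b : W) m : W -> C := cf a b *: \sum_(s : 'S_(size a)) \sum_(t : 'S_(size b))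
  S (permute s ++ permute t) m.
exists Cn => a b; set k := (size a + size b)%N.
have sk (s : 'S_(size a)) (t : 'S_(size b)) : size (permute s ++ permute t) = k.
  by rewrite size_cat !size_permute.
have sumP (V : lmodType R[i]) (x : V) :
    cf a b *: \sum_(s : 'S_(size a)) \sum_(t : 'S_(size b)) x = x.
  rewrite !sumr_const !card_Sn -mulrnA -[x *+ _]scaler_nat scalerA natrM /cf.
  by rewrite mulrC [X in X^-1]mulrC mulfV ?scale1r// mulf_neq0 ?fact_neq0.
have CS m : (m <= k)%N -> symk (k - m) (Cn a b m).
  move=> mk; apply: symkZ; apply: symk_sum => s _; apply: symk_sum => t _.
  by have [H _ _ _] := SP (permute s ++ permute t); rewrite sk in H; exact: H.
split=> // [m mk|z].
  rewrite l1Z; apply: (@le_trans _ _ (cn (cf a b) *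
     \sum_(s : 'S_(size a)) \sum_(t : 'S_(size b)) ((8 * b1) ^+ k * m`!%:R))).
    rewrite ler_wpM2l ?cn_ge0//; apply: (le_trans (l1_sum _ _ _ _)); apply: ler_sum => s _.
    apply: (le_trans (l1_sum _ _ _ _)); apply: ler_sum => t _.
    have [_ _ H _] := SP (permute s ++ permute t); rewrite sk in H.
    apply: (le_trans (H m mk)).
    apply: (@le_trans _ _ (4 ^+ k * b1 ^+ k * (2 ^+ k * m`!%:R))).
      apply: ler_pM; rewrite ?mulr_ge0 ?exprn_ge0 ?bnorm_ge0//.
        apply: ler_pM; rewrite ?exprn_ge0 ?bnorm_ge0//.
          rewrite exprD (_ : 4 = 2 * 2); last by lra.
          by rewrite exprMn ler_wpM2l ?exprn_ge0// ler_weXn2l// ler1n.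
        apply: (@le_trans _ _ (b1 ^+ m)); last by rewrite ler_weXn2l.
        by rewrite lerXn2r ?nnegrE ?bnorm_ge0// le_max lexx orbT.
      rewrite -natrX -natrM ler_nat -bin_ffact leq_mul2r.
      apply/orP; right; rewrite -[2%N]/(1 + 1)%N Pascal.
      rewrite (bigD1 (Ordinal (mk : (m < k.+1)%N)))//= !exp1n !muln1.
      exact: leq_addr.
    rewrite le_eqVlt; apply/orP; left; apply/eqP.
    rewrite (_ : 8 = 4 * 2); last by lra.
    by rewrite !exprMn; ring.
  rewrite !sumr_const !card_Sn -mulrnA -[X in _ * X]mulr_natl /cf cnV cnM !cn_nat natrM.
  rewrite le_eqVlt; apply/orP; left; apply/eqP; field.
  by rewrite !pnatr_eq0 -!lt0n !fact_gt0.
(* At [z = 0] only [m = 0] survives, and the leading coefficients of the expansions are the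
   symmetric products. *)
have [z0|z0] := eqVneq z 0.
  rewrite /gutt z0 eqxx sym_prod_vee big_ord_recl expr0 scale1r big1 ?addr0; last first.
    by move=> m _; rewrite lift0 exprS mul0r scale0r.
  rewrite /Cn -[LHS]sumP; congr (_ *: _); apply: eq_bigr => s _; apply: eq_bigr => t _.
  have [_ -> _ _] := SP (permute s ++ permute t); apply: vee_perm.
  by rewrite perm_sym; apply: perm_cat; exact: perm_permute.
have vS : is_sym (\sum_(m < k.+1) z ^+ m *: Cn a b m).
  split.
    exists k => w kw; rewrite fct_sumE big1// => m _.
    rewrite -[LHS]/(z ^+ m * Cn a b m w) (CS m (ltnSE (ltn_ord m))).1 ?mulr0// => E.
    by move: kw; rewrite E ltnNge leq_subr.
  move=> w w' ww; rewrite !fct_sumE; apply: eq_bigr => m _.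
  by rewrite -[LHS]/(z ^+ m * Cn a b m w) ((CS m (ltnSE (ltn_ord m))).2 _ _ ww).
apply: gutt_eq => //.
(* [quant] scales the part of degree [k - m] by [z ^ (k - m)]; with the coefficient [z ^ m] all
   parts get the common factor [z ^ k]. *)
have E1 : quant z (\sum_(m < k.+1) z ^+ m *: Cn a b m) = z ^+ k *: \sum_(m < k.+1) Cn a b m.
  rewrite quantE//; apply/funext => u; rewrite -[RHS]/(_ * _) !fct_sumE !mulr_sumr.
  apply: eq_bigr => m _; rewrite -[X in _ * X = _]/(z ^+ m * Cn a b m u) mulrA -exprD.
  have mk := ltnSE (ltn_ord m).
  have [uk|/eqP uk] := eqVneq (size u) (k - m)%N; first by rewrite uk subnK.
  by rewrite (CS m mk).1 ?mulr0.
have E2 : tensor_prod (quant z (vee R a)) (quant z (vee R b)) =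
    z ^+ k *: tensor_prod (vee R a) (vee R b).
  rewrite !quantE; [|exact: is_sym_vee..].
  apply/funext => u; rewrite -[RHS]/(_ * _) mulr_sumr; apply: eq_bigr => j _.
  have [ja|/eqP ja] := eqVneq (size (take j u)) (size a); last first.
    by rewrite (vee_symk R a).1// !(mulr0, mul0r).
  have [jb|/eqP jb] := eqVneq (size (drop j u)) (size b); last first.
    by rewrite (vee_symk R b).1// !(mulr0, mul0r).
  by rewrite ja jb /k exprD; ring.
rewrite E1 E2 -scalerBr; apply: idealZ; apply: eqv_sym.
rewrite /vee tensor_prodZl tensor_prodZr scalerA -invfM -/(cf a b).
rewrite tensor_prod_suml -scaler_sumr exchange_big /=; apply: eqvZ.
apply: eqv_sum => s _; rewrite tensor_prod_sumr exchange_big; apply: eqv_sum => t _.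
rewrite tensor_prod_word; have [_ _ _] := SP (permute s ++ permute t).
by rewrite sk.
Qed.

End GuttExpansion.

(** * Seminorms on the entire functions *)

Section FactorialWeights.
Context (R : realType).
Implicit Types (s t : R) (k a b : nat).

Definition wt s k : R := k`!%:R `^ s.

Lemma fact1 k : (1 <= k`!%:R :> R).
Proof. by rewrite ler1n fact_gt0. Qed.

Lemma wt_gt0 s k : 0 < wt s k.
Proof. by apply: powR_gt0; rewrite ltr0n fact_gt0. Qed.

Lemma wt_ge0 s k : 0 <= wt s k.
Proof. exact: ltW (wt_gt0 _ _). Qed.

Lemma wtD s t k : wt (s + t) k = wt s k * wt t k.
Proof. by rewrite /wt powRD//; apply/implyP => _; rewrite pnatr_eq0 -lt0n fact_gt0. Qed.

Lemma wtN s k : wt (- s) k = (wt s k)^-1.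
Proof. exact: powRN. Qed.

Lemma wt1 k : wt 1 k = k`!%:R.
Proof. exact: powRr1. Qed.

Lemma wt_mono s t k : s <= t -> wt s k <= wt t k.
Proof. by move=> st; apply: ler_powR => //; exact: fact1. Qed.

(** The geometric price of splitting a factorial weight, from
    [a! b! <= (a + b)! <= 2 ^ (a + b) a! b!]. The absolute value covers negative exponents. *)
Definition wtc s : R := 2 `^ `|s|.

Lemma wtc1 s : 1 <= wtc s.
Proof. by rewrite -(powRr0 2); apply: ler_powR; rewrite ?ler1n. Qed.

Lemma wtc_ge0 s : 0 <= wtc s.
Proof. exact: powR_ge0. Qed.

Lemma fact_mul_le a b : (a`! * b`! <= (a + b)`!)%N.
Proof.
have <- := bin_fact (leq_addr b a); rewrite addKn leq_pmull//.
by rewrite bin_gt0 leq_addr.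
Qed.

Lemma bin_le_pow2 a b : ('C(a, b) <= 2 ^ a)%N.
Proof.
have [ab|ba] := leqP b a; last by rewrite bin_small.
rewrite -[2%N]/(1 + 1)%N Pascal (bigD1 (Ordinal (ab : (b < a.+1)%N)))//= !exp1n !muln1.
exact: leq_addr.
Qed.

Lemma fact_add_le a b : ((a + b)`! <= 2 ^ (a + b) * (a`! * b`!))%N.
Proof.
by have <- := bin_fact (leq_addr b a); rewrite addKn leq_mul2r bin_le_pow2 orbT.
Qed.

Lemma wt_both s a b : 0 <= s ->
  wt s a * wt s b <= wt s (a + b) /\ wt s (a + b) <= wtc s ^+ (a + b) * (wt s a * wt s b).
Proof.
move=> s0; rewrite /wt -powRM ?ler0n// -natrM; split.
  by apply: ge0_ler_powR => //; rewrite ?nnegrE ?ler0n// ler_nat fact_mul_le.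
have -> : wtc s ^+ (a + b) = (2 ^+ (a + b)) `^ s.
  by rewrite /wtc ger0_norm// -powR_mulrn ?powR_ge0// -powRrM mulrC powRrM powR_mulrn ?ler0n.
rewrite -powRM ?exprn_ge0 ?ler0n//; apply: ge0_ler_powR => //; rewrite ?nnegrE ?mulr_ge0 ?exprn_ge0 ?ler0n//.
by rewrite -natrX -natrM ler_nat fact_add_le.
Qed.

Lemma wt_mul_le s a b : wt s a * wt s b <= wtc s ^+ (a + b) * wt s (a + b).
Proof.
have [s0|s0] := leP 0 s.
  apply: (le_trans (wt_both a b s0).1); rewrite ler_peMl ?wt_ge0//.
  by apply: exprn_ege1; exact: wtc1.
have s0' : 0 <= - s by rewrite oppr_ge0 ltW.
have [_ H] := wt_both a b s0'; rewrite -[s]opprK !(wtN (- s)) -invfM.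
rewrite -[X in _ <= X * _](_ : wtc (- s) ^+ (a + b) = _); last by rewrite /wtc !normrN.
rewrite ler_pdivlMr ?wt_gt0// mulrC ler_pdivrMr ?mulr_gt0 ?wt_gt0//.
Qed.

Lemma wt_add_le s a b : wt s (a + b) <= wtc s ^+ (a + b) * (wt s a * wt s b).
Proof.
have [s0|s0] := leP 0 s; first by have [] := wt_both a b s0.
have s0' : 0 <= - s by rewrite oppr_ge0 ltW.
have [H _] := wt_both a b s0'; rewrite -[s]opprK !(wtN (- s)) -invfM.
apply: (@le_trans _ _ (wt (- s) a * wt (- s) b)^-1).
  by rewrite lef_pV2 ?posrE ?mulr_gt0 ?wt_gt0.
rewrite ler_peMl ?invr_ge0 ?mulr_ge0 ?wt_ge0//.
by apply: exprn_ege1; exact: wtc1.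
Qed.

End FactorialWeights.

Section NonnegativeSeries.
Context (R : realType).

Lemma nneseries_le (u : nat -> R) M : (forall k, 0 <= u k) ->
  (forall K, \sum_(k < K) u k <= M) -> (\sum_(0 <= k <oo) (u k)%:E <= M%:E)%E.
Proof.
move=> u0 uM; apply: lime_le.
  by apply: is_cvg_nneseries => k _ _; rewrite lee_fin.
by apply: nearW => K; rewrite sumEFin lee_fin big_mkord.
Qed.

Lemma nneseries_ge (u : nat -> \bar R) K : (forall k, 0 <= u k)%E ->
  (\sum_(k < K) u k <= \sum_(0 <= k <oo) u k)%E.
Proof.
move=> u0; rewrite -(big_mkord xpredT u).
by apply: nneseries_lim_ge => k _ _.
Qed.

End NonnegativeSeries.

(** * Jets at the unit and the norms of entire functions *)

Section EntireFunctions.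
Context (R : realType) (n : nat) (G : lieGroupType R n).
Context (c : chart R n G) (c_atlas : lie_atlas c) (c_unit : cdom c 1%g).
Context (B : 'M[R]_n) (r : R).
Local Notation C := (R[i]^o).
Local Notation W := (seq 'I_n).
Local Notation cn := (@Normc.normc R).
Implicit Types (phi psi : G -> C) (w : W).
Local Notation lw := (lie_word c B).
Local Notation entire_fun := (entire_fun c B r).

Definition jet m phi : R := wsum m (fun w => cn (lw w phi 1%g)).

Lemma jet_ge0 m phi : 0 <= jet m phi.
Proof. by apply: wsum_ge0 => w _; exact: cn_ge0. Qed.

Lemma jet0 m : jet m (fun=> 0) = 0.
Proof. by apply: wsum_eq0 => w _; rewrite lie_word_cst0 cn0. Qed.

Lemma jetD m phi psi : Canalytic phi -> Canalytic psi ->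
  jet m (fun g => phi g + psi g) <= jet m phi + jet m psi.
Proof.
move=> fA gA; rewrite /jet -wsumD; apply: ler_wsum => w _.
by rewrite lie_word_D//; exact: cnD.
Qed.

Lemma jetZ m (a : C) phi : Canalytic phi -> jet m (fun g => a * phi g) = cn a * jet m phi.
Proof.
move=> fA; rewrite /jet -wsum_mull; apply: eq_wsum => w _.
by rewrite lie_word_Z// cnM.
Qed.

Lemma jet_word p m phi : wsum p (fun w => jet m (lw w phi)) = jet (m + p) phi.
Proof.
rewrite /jet wsum_cat wsum_wsum; apply: eq_wsum => u _; apply: eq_wsum => v _.
by rewrite lie_word_cat.
Qed.

Lemma jet_word_le w m phi : jet m (lw w phi) <= jet (m + size w) phi.
Proof.
rewrite -jet_word; apply: (@wsum_ge _ _ _ (fun w => jet m (lw w phi))) => // v.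
exact: jet_ge0.
Qed.

(** Induction on the order through the derivation that acts first, with Pascal's rule. *)
Lemma jetM m phi psi : Canalytic phi -> Canalytic psi ->
  jet m (fun g => phi g * psi g) <= \sum_(i < m.+1) 'C(m, i)%:R * (jet i phi * jet (m - i) psi).
Proof.
elim: m phi psi => [|m IH] phi psi fA gA.
  by rewrite big_ord1 bin0 mul1r subnn /jet /= cnM.
have step f : Canalytic f -> jet m.+1 f = \sum_i jet m (lie_derC c (row i B) f).
  by move=> _; rewrite -addn1 -jet_word.
rewrite step; last exact: CanalyticM.
have dA i f : Canalytic f -> Canalytic (lie_derC c (row i B) f) by exact: Canalytic_lie_derC.
apply: (@le_trans _ _ (\sum_i (\sum_(j < m.+1) 'C(m, j)%:R * (jet j (lie_derC c (row i B) phi) * jet (m - j) psi) +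
   \sum_(j < m.+1) 'C(m, j)%:R * (jet j phi * jet (m - j) (lie_derC c (row i B) psi))))).
  apply: ler_sum => i _; rewrite lie_derC_M//.
  apply: (le_trans (jetD _ (CanalyticM (dA i _ fA) gA) (CanalyticM fA (dA i _ gA)))).
  by rewrite lerD// IH//; exact: dA.
have stepj j f : \sum_i jet j (lie_derC c (row i B) f) = jet j.+1 f.
  by rewrite -[j.+1]addn1 -jet_word.
rewrite big_split/= exchange_big /= [X in _ + X]exchange_big /=.
rewrite (eq_bigr (fun j : 'I_m.+1 => 'C(m, j)%:R * (jet j.+1 phi * jet (m - j) psi))); last first.
  by move=> j _; rewrite -mulr_sumr -mulr_suml stepj.
rewrite [X in _ + X](eq_bigr (fun j : 'I_m.+1 => 'C(m, j)%:R * (jet j phi * jet (m - j).+1 psi))); last first.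
  by move=> j _; rewrite -mulr_sumr -mulr_sumr stepj.
rewrite [leRHS]big_ord_recl [X in _ <= _ + X](eq_bigr (fun j : 'I_m.+1 =>
   'C(m, j)%:R * (jet j.+1 phi * jet (m - j) psi) +
   'C(m, j.+1)%:R * (jet j.+1 phi * jet (m - j) psi))); last first.
  by move=> j _; rewrite lift0 subSS binS natrD mulrDl addrC.
rewrite big_split/= addrCA lerD2l.
rewrite big_ord_recl /= !bin0 !subn0 lerD2l [leRHS]big_ord_recr/= bin_small// mul0r addr0.
apply: ler_sum => j _; rewrite /bump /= add1n.
by rewrite subnSK// lexx.
Qed.

Definition qterm cc phi k : R := wt (r - 1) k * cc ^+ k * jet k phi.

Lemma q_normE cc phi : q_norm c B r cc phi = (\sum_(0 <= k <oo) (qterm cc phi k)%:E)%E.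
Proof.
rewrite /q_norm; apply: eq_eseriesr => k _; congr EFin; rewrite /qterm; congr (_ * _).
exact: (wsum_tuple k (fun w => cn (lw w phi 1%g))).
Qed.

Lemma qterm_ge0 cc phi k : 0 <= cc -> 0 <= qterm cc phi k.
Proof. by move=> c0; rewrite !mulr_ge0 ?wt_ge0 ?exprn_ge0 ?jet_ge0. Qed.

Lemma q_norm_ge0 cc phi : 0 <= cc -> (0 <= q_norm c B r cc phi)%E.
Proof. by move=> c0; rewrite q_normE; apply: nneseries_ge0 => k _ _; rewrite lee_fin qterm_ge0. Qed.

Definition qn cc phi : R := fine (q_norm c B r cc phi).

Lemma qnE cc phi : entire_fun phi -> 0 <= cc -> q_norm c B r cc phi = (qn cc phi)%:E.
Proof.
move=> [_ f] c0; rewrite fineK// fin_numE gt_eqF ?lt_eqF ?f//.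
by apply: (@lt_le_trans _ _ 0%E); [exact: ltNyr|exact: q_norm_ge0].
Qed.

Lemma qn_ge0 cc phi : 0 <= cc -> 0 <= qn cc phi.
Proof. by move=> c0; apply: fine_ge0; exact: q_norm_ge0. Qed.

Lemma qn_partial cc phi K : entire_fun phi -> 0 <= cc ->
  \sum_(k < K) qterm cc phi k <= qn cc phi.
Proof.
move=> fE c0; rewrite -lee_fin -(qnE fE c0) q_normE -sumEFin.
by apply: (nneseries_ge (u := fun k => (qterm cc phi k)%:E)) => k; rewrite lee_fin qterm_ge0.
Qed.

Lemma q_norm_le cc phi M : 0 <= cc -> (forall K, \sum_(k < K) qterm cc phi k <= M) ->
  (q_norm c B r cc phi <= M%:E)%E.
Proof.
move=> c0 H; rewrite q_normE; apply: nneseries_le => // k.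
exact: qterm_ge0.
Qed.

Lemma qn_le cc phi M : entire_fun phi -> 0 <= cc ->
  (forall K, \sum_(k < K) qterm cc phi k <= M) -> qn cc phi <= M.
Proof. by move=> fE c0 H; rewrite -lee_fin -(qnE fE c0); exact: q_norm_le. Qed.

Lemma entire_intro phi : Canalytic phi ->
  (forall cc, 0 <= cc -> exists M, forall K, \sum_(k < K) qterm cc phi k <= M) ->
  entire_fun phi.
Proof.
move=> fA H; split=> // cc c0; have [M HM] := H cc c0.
by apply: (le_lt_trans (q_norm_le c0 HM)); exact: ltry.
Qed.

Lemma sum_qterm0 cc K : \sum_(k < K) qterm cc (fun=> 0) k = 0.
Proof. by apply: big1 => k _; rewrite /qterm jet0 mulr0. Qed.

Lemma entire0 : entire_fun (fun=> 0).
Proof.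
apply: entire_intro; first exact: Canalytic_cst.
by move=> cc c0; exists 0 => K; rewrite sum_qterm0.
Qed.

Lemma qn0 cc : 0 <= cc -> qn cc (fun=> 0) = 0.
Proof.
move=> c0; apply/eqP; rewrite eq_le qn_ge0// andbT.
by apply: (qn_le entire0 c0) => K; rewrite sum_qterm0.
Qed.

Lemma sum_qtermD cc phi psi K : Canalytic phi -> Canalytic psi -> 0 <= cc ->
  \sum_(k < K) qterm cc (fun g => phi g + psi g) k <=
  \sum_(k < K) qterm cc phi k + \sum_(k < K) qterm cc psi k.
Proof.
move=> fA gA c0; rewrite -big_split/=; apply: ler_sum => k _; rewrite -mulrDr.
by rewrite ler_wpM2l ?mulr_ge0 ?wt_ge0 ?exprn_ge0//; exact: jetD.
Qed.

Lemma entireD phi psi : entire_fun phi -> entire_fun psi -> entire_fun (fun g => phi g + psi g).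
Proof.
move=> fE gE; have [fA _] := fE; have [gA _] := gE; apply: entire_intro => [|cc c0].
  exact: CanalyticD.
exists (qn cc phi + qn cc psi) => K; apply: (le_trans (sum_qtermD _ fA gA c0)).
by rewrite lerD// qn_partial.
Qed.

Lemma qnD cc phi psi : entire_fun phi -> entire_fun psi -> 0 <= cc ->
  qn cc (fun g => phi g + psi g) <= qn cc phi + qn cc psi.
Proof.
move=> fE gE c0; have [fA _] := fE; have [gA _] := gE.
apply: (qn_le (entireD fE gE) c0) => K; apply: (le_trans (sum_qtermD _ fA gA c0)).
by rewrite lerD// qn_partial.
Qed.

Lemma sum_qtermZ cc a phi K : Canalytic phi ->
  \sum_(k < K) qterm cc (fun g => a * phi g) k = cn a * \sum_(k < K) qterm cc phi k.
Proof.
by move=> fA; rewrite mulr_sumr; apply: eq_bigr => k _; rewrite /qterm jetZ// mulrCA.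
Qed.

Lemma entireZ a phi : entire_fun phi -> entire_fun (fun g => a * phi g).
Proof.
move=> fE; have [fA _] := fE; apply: entire_intro => [|cc c0].
  by apply: CanalyticM => //; exact: Canalytic_cst.
by exists (cn a * qn cc phi) => K; rewrite sum_qtermZ// ler_wpM2l ?cn_ge0// qn_partial.
Qed.

Lemma qnZ_le cc a phi : entire_fun phi -> 0 <= cc ->
  qn cc (fun g => a * phi g) <= cn a * qn cc phi.
Proof.
move=> fE c0; have [fA _] := fE; apply: (qn_le (entireZ a fE) c0) => K.
by rewrite sum_qtermZ// ler_wpM2l ?cn_ge0// qn_partial.
Qed.

Lemma qn_mono cc cc' phi : entire_fun phi -> 0 <= cc -> cc <= cc' -> qn cc phi <= qn cc' phi.
Proof.
move=> fE c0 ccc; apply: (qn_le fE c0) => K.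
have c'0 := le_trans c0 ccc.
apply: (le_trans _ (qn_partial K fE c'0)); apply: ler_sum => k _.
rewrite ler_wpM2r ?jet_ge0// ler_wpM2l ?wt_ge0//.
by rewrite lerXn2r ?nnegrE.
Qed.

(** A jet of order [k] of the derivative is part of the jet of order [k + size w] of [phi]. Adapting
    the weight [k!^(r - 1)] to the higher order costs [(size w)!^(1 - r)] and a geometric factor;
    [1 <= cc] lets [cc ^ k] grow along. *)
Lemma sum_qterm_word cc w phi K : entire_fun phi -> 1 <= cc ->
  \sum_(k < K) qterm cc (lw w phi) k <=
  wt (1 - r) (size w) * qn (wtc (r - 1) * cc) phi.
Proof.
move=> fE c1; set p := size w; have c0 : 0 <= cc by apply: le_trans c1.
set c' := wtc (r - 1) * cc; have c'0 : 0 <= c' by rewrite mulr_ge0 ?wtc_ge0.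
apply: (@le_trans _ _ (wt (1 - r) p * \sum_(k < K + p) qterm c' phi k)); last first.
  by rewrite ler_wpM2l ?wt_ge0// qn_partial.
rewrite [(K + p)%N]addnC big_split_ord mulrDr.
apply: (@le_trans _ _ (wt (1 - r) p * \sum_(i < K) qterm c' phi (p + i))); last first.
  rewrite lerDr mulr_ge0 ?wt_ge0// sumr_ge0// => i _; exact: qterm_ge0.
rewrite mulr_sumr; apply: ler_sum => k _.
rewrite /qterm; apply: (@le_trans _ _ (wt (r - 1) k * cc ^+ k * jet (k + p) phi)).
  by rewrite ler_wpM2l ?mulr_ge0 ?wt_ge0 ?exprn_ge0// jet_word_le.
rewrite [(p + k)%N]addnC mulrA ler_wpM2r ?jet_ge0//.
have H := wt_mul_le (r - 1) k p.
have E : wt (1 - r) p * wt (r - 1) p = 1.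
  by rewrite -wtD (_ : 1 - r + (r - 1) = 0) ?/wt ?powRr0//; ring.
rewrite mulrA; apply: (@le_trans _ _ (wt (1 - r) p * (wt (r - 1) k * wt (r - 1) p) * cc ^+ (k + p))).
  rewrite [wt (1 - r) p * _]mulrCA E mulr1 ler_wpM2l ?wt_ge0//.
  by rewrite ler_weXn2l// leq_addr.
rewrite exprMn [wtc _ ^+ _ * _]mulrC mulrACA -!mulrA ler_wpM2l ?wt_ge0//.
rewrite [leRHS](_ : _ = wtc (r - 1) ^+ (k + p) * wt (r - 1) (k + p) * cc ^+ (k + p)); last by ring.
by rewrite mulrA ler_wpM2r ?exprn_ge0.
Qed.

Lemma entire_word w phi : entire_fun phi -> entire_fun (lw w phi).
Proof.
move=> fE; have [fA _] := fE; apply: entire_intro => [|cc c0].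
  exact: Canalytic_lie_word.
have c1 : 1 <= Num.max 1 cc by rewrite le_max lexx.
eexists => K; apply: (le_trans _ (sum_qterm_word w K fE c1)); apply: ler_sum => k _.
rewrite ler_wpM2r ?jet_ge0// ler_wpM2l ?wt_ge0//.
by rewrite lerXn2r ?nnegrE// ?le_max ?lexx ?orbT// ?ler01.
Qed.

Lemma qn_word cc w phi : entire_fun phi -> 1 <= cc ->
  qn cc (lw w phi) <= wt (1 - r) (size w) * qn (wtc (r - 1) * cc) phi.
Proof.
move=> fE c1; apply: qn_le; first exact: entire_word.
  exact: le_trans c1.
by move=> K; exact: sum_qterm_word.
Qed.

(** The binomial coefficient of the Leibniz rule raises the exponents of the weights from [r - 1] to
    [r], and [k!^r] splits by [wt_add_le]. *)
Lemma sum_qtermM cc phi psi K : 0 <= r -> entire_fun phi -> entire_fun psi -> 0 <= cc ->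
  \sum_(k < K) qterm cc (fun g => phi g * psi g) k <=
  qn (wtc r * cc) phi * qn (wtc r * cc) psi.
Proof.
move=> r0 fE gE c0; have [fA _] := fE; have [gA _] := gE.
set c' := wtc r * cc; have c'0 : 0 <= c' by rewrite mulr_ge0 ?wtc_ge0.
apply: (@le_trans _ _ (\sum_(k < K) \sum_(i < k.+1) qterm c' phi i * qterm c' psi (k - i))).
  apply: ler_sum => k _; rewrite /qterm.
  apply: (le_trans (ler_wpM2l _ (jetM k fA gA))).
    by rewrite mulr_ge0 ?wt_ge0 ?exprn_ge0.
  rewrite mulr_sumr; apply: ler_sum => -[i /= ik] _; have ik' : (i <= k)%N by [].
  rewrite [leRHS](_ : _ = wt (r - 1) i * wt (r - 1) (k - i) * (c' ^+ i * c' ^+ (k - i)) *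
     (jet i phi * jet (k - i) psi)); last by ring.
  rewrite [leLHS]mulrA ler_wpM2r ?mulr_ge0 ?jet_ge0// -exprD subnKC//.
  rewrite /c' exprMn mulrAC mulrA ler_wpM2r ?exprn_ge0//.
  have -> : 'C(k, i)%:R = wt 1 k / (wt 1 i * wt 1 (k - i)) :> R.
    rewrite !wt1 -natrM -(bin_fact ik') natrM mulfK// pnatr_eq0 -lt0n muln_gt0 !fact_gt0//.
  rewrite mulrA -wtD subrK ler_pdivrMr ?mulr_gt0 ?wt_gt0//.
  rewrite [leRHS](_ : _ = wtc r ^+ k * ((wt (r - 1) i * wt 1 i) * (wt (r - 1) (k - i) * wt 1 (k - i)))); last by ring.
  rewrite -!wtD subrK; have := wt_add_le r i (k - i); rewrite subnKC//.
rewrite (big_triangle (fun i j => qterm c' phi i * qterm c' psi j)).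
apply: (@le_trans _ _ (\sum_(i < K) \sum_(j < K) qterm c' phi i * qterm c' psi j)).
  apply: ler_sum => i _.
  rewrite (big_ord_widen K (fun j => qterm c' phi i * qterm c' psi j) (leq_subr i K)).
  rewrite [leRHS](bigID (fun j : 'I_K => (j < K - i)%N))/= lerDl sumr_ge0// => j _.
  by rewrite mulr_ge0 ?qterm_ge0.
rewrite (eq_bigr (fun i : 'I_K => qterm c' phi i * \sum_(j < K) qterm c' psi j)); last first.
  by move=> i _; rewrite mulr_sumr.
rewrite -mulr_suml ler_pM ?qn_partial//; apply: sumr_ge0 => k _; exact: qterm_ge0.
Qed.

Lemma entireM phi psi : 0 <= r -> entire_fun phi -> entire_fun psi ->
  entire_fun (fun g => phi g * psi g).
Proof.
move=> r0 fE gE; have [fA _] := fE; have [gA _] := gE; apply: entire_intro => [|cc c0].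
  exact: CanalyticM.
by eexists => K; exact: sum_qtermM.
Qed.

Lemma qnM cc phi psi : 0 <= r -> entire_fun phi -> entire_fun psi -> 0 <= cc ->
  qn cc (fun g => phi g * psi g) <= qn (wtc r * cc) phi * qn (wtc r * cc) psi.
Proof.
move=> r0 fE gE c0; apply: qn_le => //; first exact: entireM.
by move=> K; exact: sum_qtermM.
Qed.

End EntireFunctions.

(** * The topology of the polynomial functions *)

Section ProjectivePower.
Context (R : realType) (n : nat).
Local Notation C := (R[i]^o).
Local Notation W := (seq 'I_n).
Local Notation cn := (@Normc.normc R).
Implicit Types (t : W -> C).

Lemma cn_prod (I : Type) (s : seq I) (f : I -> R[i]) :
  cn (\prod_(i <- s) f i) = \prod_(i <- s) cn (f i).
Proof. by apply: (big_morph cn (@cnM R)); exact: Normc.normc1. Qed.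

Lemma sum_tuple_prod k (f : 'I_k -> 'I_n -> R) :
  \sum_(w : k.-tuple 'I_n) \prod_(i < k) f i (tnth w i) = \prod_(i < k) \sum_j f i j.
Proof.
rewrite bigA_distr_bigA /= (reindex (fun g : {ffun 'I_k -> 'I_n} => [tuple g i | i < k])) /=.
  by apply: eq_bigr => g _; apply: eq_bigr => i _; rewrite tnth_mktuple.
exists (fun w : k.-tuple 'I_n => [ffun i => tnth w i]) => [g _|w _].
  by apply/ffunP => i; rewrite ffunE tnth_mktuple.
by apply: eq_from_tnth => i; rewrite tnth_mktuple ffunE.
Qed.

(** The expansion into words of basis vectors attains the infimum. No other decomposition does
    better, since the coefficients of a product of vectors have absolute values summing to the
    product of the l^1-norms. *)
Lemma proj_powerE k t : proj_power k t = (l1 k t)%:E.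
Proof.
apply/eqP; rewrite eq_le; apply/andP; split.
  apply: ge_ereal_inf; exists (l1 k t)%:E => //.
  pose b (j : 'I_n) : 'rV[C]_n := \row_l (l == j)%:R.
  exists (map (fun u : k.-tuple 'I_n => (t u, [tuple b (tnth u i) | i < k])) (enum {: k.-tuple 'I_n})).
  split=> [w|].
    rewrite big_map big_enum (bigD1 w)//= [X in _ * X]big1 ?mulr1 => [|i _]; last by rewrite tnth_mktuple mxE eqxx.
    rewrite big1 ?addr0// => u uw; have [i ui] : exists i, tnth u i != tnth w i.
      apply/existsP; rewrite -negb_forall; apply: contra uw => /forallP H.
      by apply/eqP/eq_from_tnth => i; apply/eqP.
    by rewrite (bigD1 i)//= tnth_mktuple mxE eq_sym (negPf ui) mul0r mulr0.
  congr EFin; rewrite big_map big_enum /l1 -wsum_tuple; apply: eq_bigr => u _ /=.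
  rewrite big1 ?mulr1// => i _; rewrite tnth_mktuple /l1norm (bigD1 (tnth u i))//= mxE eqxx.
  by rewrite Normc.normc1 big1 ?addr0// => j /negPf ji; rewrite mxE ji cn0.
apply/ereal_infP => _ [s [ts ->]]; rewrite lee_fin /l1 -wsum_tuple.
apply: (@le_trans _ _ (\sum_(w : k.-tuple 'I_n) \sum_(x <- s)
    cn x.1 * \prod_(i < k) cn ((tnth x.2 i) 0 (tnth w i)))).
  apply: ler_sum => w _; rewrite ts; apply: (le_trans (cn_sum _ _ _)).
  by apply: ler_sum => x _; rewrite cnM cn_prod.
rewrite exchange_big; apply: ler_sum => x _; rewrite -mulr_sumr.
by rewrite (sum_tuple_prod (fun i j => cn ((tnth x.2 i) 0 j))).
Qed.

Lemma p_norm_le (r' cc : R) t M : 0 <= cc ->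
  (forall K, \sum_(k < K) wt r' k * cc ^+ k * l1 k t <= M) -> (p_norm r' cc t <= M%:E)%E.
Proof.
move=> c0 H; rewrite /p_norm.
rewrite (eq_eseriesr (g := fun k => (wt r' k * cc ^+ k * l1 k t)%:E)); last first.
  by move=> k _; rewrite proj_powerE.
apply: nneseries_le => // k.
by rewrite !mulr_ge0 ?wt_ge0 ?exprn_ge0 ?l1_ge0.
Qed.

Lemma p_norm_ge (r' cc : R) t K : 0 <= cc ->
  ((\sum_(k < K) wt r' k * cc ^+ k * l1 k t)%:E <= p_norm r' cc t)%E.
Proof.
move=> c0; rewrite /p_norm.
rewrite (eq_eseriesr (g := fun k => (wt r' k * cc ^+ k * l1 k t)%:E)); last first.
  by move=> k _; rewrite proj_powerE.
rewrite -sumEFin.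
apply: (nneseries_ge (u := fun k => (wt r' k * cc ^+ k * l1 k t)%:E)) => k.
by rewrite lee_fin !mulr_ge0 ?wt_ge0 ?exprn_ge0 ?l1_ge0.
Qed.

Lemma p_norm_vee (r' cc : R) (w : W) : 0 <= cc ->
  (p_norm r' cc (vee R w) <= (wt r' (size w) * cc ^+ size w)%:E)%E.
Proof.
move=> c0; have wc0 k : 0 <= wt r' k * cc ^+ k by rewrite mulr_ge0 ?wt_ge0 ?exprn_ge0.
apply: p_norm_le => // K.
have E k : l1 k (vee R w) <= (k == size w)%:R.
  case: eqP => [->|kw]; first exact: l1_vee.
  rewrite (_ : l1 _ _ = 0)//; apply: wsum_eq0 => u uk; rewrite (vee_symk R w).1 ?cn0//.
  by rewrite uk.
apply: (@le_trans _ _ (\sum_(k < K) wt r' k * cc ^+ k * (k == size w :> nat)%:R)).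
  by apply: ler_sum => k _; rewrite ler_wpM2l.
have [wK|Kw] := ltnP (size w) K.
  rewrite (bigD1 (Ordinal wK))//= eqxx mulr1 big1 ?addr0// => k.
  by rewrite -val_eqE/= => /negPf ->; rewrite mulr0.
by rewrite big1// => k _; rewrite ltn_eqF ?mulr0// (leq_trans (ltn_ord k)).
Qed.

End ProjectivePower.

(** * Symmetric families of entire functions and the norms [nu] *)

Section PolynomialFunctions.
Context (R : realType) (n : nat) (G : lieGroupType R n).
Context (c : chart R n G) (c_atlas : lie_atlas c) (c_unit : cdom c 1%g).
Context (B : 'M[R]_n) (r r' : R).
Local Notation C := (R[i]^o).
Local Notation W := (seq 'I_n).
Local Notation cn := (@Normc.normc R).
Local Notation entire_fun := (entire_fun c B r).
Local Notation qn := (qn c B r).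
Local Notation is_pol := (is_pol c B r).
Implicit Types (P Q : pol G) (phi : G -> C) (w u : W) (v : W -> C).

Lemma polD P Q w : (P + Q) w = (fun g => P w g + Q w g). Proof. by []. Qed.
Lemma polZ (a : C) P w : (a *: P) w = (fun g => a * P w g). Proof. by []. Qed.
Definition degree_lt D P := forall w, (D <= size w)%N -> P w = (fun=> 0).

Lemma degree_lt_widen D D' P : (D <= D')%N -> degree_lt D P -> degree_lt D' P.
Proof. by move=> DD PD w /(leq_trans DD)/PD. Qed.

Definition sym_pol P := [/\ exists D, degree_lt D P,
  forall w w', perm_eq w w' -> P w = P w' & forall w, entire_fun (P w)].

Lemma sym_polD P Q : sym_pol P -> sym_pol Q -> sym_pol (P + Q).
Proof.
move=> [[D PD] PS PE] [[D' QD] QS QE]; split.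
- exists (maxn D D') => w; rewrite geq_max => /andP[Dw D'w]; rewrite polD PD// QD//.
  by apply/funext => g; rewrite addr0.
- by move=> w w' ww; rewrite !polD (PS _ _ ww) (QS _ _ ww).
- by move=> w; rewrite polD; exact: entireD.
Qed.

Lemma sym_polZ (a : C) P : sym_pol P -> sym_pol (a *: P).
Proof.
move=> [[D PD] PS PE]; split.
- by exists D => w Dw; rewrite polZ PD//; apply/funext => g; rewrite mulr0.
- by move=> w w' ww; rewrite !polZ (PS _ _ ww).
- by move=> w; rewrite polZ; exact: entireZ.
Qed.

Lemma sym_pol0 : sym_pol 0.
Proof. by split=> //; [exists 0%N|move=> w; exact: entire0]. Qed.

Lemma sym_pol_sum (I : Type) (s : seq I) (p : pred I) (f : I -> pol G) :
  (forall i, p i -> sym_pol (f i)) -> sym_pol (\sum_(i <- s | p i) f i).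
Proof. by move=> H; apply: big_ind => //; [exact: sym_pol0|exact: sym_polD]. Qed.

Lemma sym_pol_wsum k (F : W -> pol G) :
  (forall w, size w = k -> sym_pol (F w)) -> sym_pol (wsum k F).
Proof.
elim: k F => [|k IH] F Fs /=; first exact: Fs.
by apply: sym_pol_sum => i _; apply: IH => v sv; apply: Fs; rewrite /= sv.
Qed.

Lemma sym_polB P Q : sym_pol P -> sym_pol Q -> sym_pol (P - Q).
Proof. by move=> PS QS; rewrite -scaleN1r; apply: sym_polD => //; exact: sym_polZ. Qed.

Lemma sym_pol_elem phi v : entire_fun phi -> is_sym v -> sym_pol (elem phi v).
Proof.
move=> fE [[d vd] vS]; split.
- by exists d.+1 => w dw; apply/funext => g; rewrite /elem vd ?mulr0.
- by move=> w w' ww; rewrite /elem (vS _ _ ww).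
- move=> w; rewrite /elem (_ : (fun g => _) = (fun g => v w * phi g)); first exact: entireZ.
  by apply/funext => g; rewrite mulrC.
Qed.

Definition pol_repr D P : seq ((G -> C) * (W -> C)) := [seq (P w, vee R w) | w <- words n D].

Lemma pol_reprE D P : degree_lt D P -> sym_pol P -> P = elem_sum (pol_repr D P).
Proof.
move=> PD [_ PS _]; rewrite /elem_sum big_map big_words.
apply/funext => u; apply/funext => g; rewrite /= fct_sumE fct_sumE.
have E k : wsum k (fun w => elem (P w) (vee R w)) u g = if size u == k then P u g else 0.
  rewrite (wsum_additive _ _ (f := fun Q : pol G => Q u g))//.
  case: eqP => uk.
    rewrite -[RHS](@vee_sum_sym R n _ (fun w => P w g) k u)//; last first.
      by move=> w w' /PS ->.
    by apply: eq_wsum => w _; rewrite /elem mulrC.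
  apply: wsum_eq0 => w wk; rewrite /elem (vee_symk R w).1 ?mulr0// => uw.
  by apply: uk; rewrite uw wk.
under eq_bigr do rewrite E.
have [uD|Du] := ltnP (size u) D.
  rewrite (bigD1 (Ordinal uD))//= eqxx big1 ?addr0// => k; rewrite -val_eqE /= eq_sym.
  by move/negPf ->.
by rewrite PD// big1// => k _; rewrite gtn_eqF// (leq_trans (ltn_ord k)).
Qed.

Lemma pol_repr_in D P : sym_pol P -> elem_in c B r (pol_repr D P).
Proof.
by move=> [_ _ PE] x /mapP[w _ ->] /=; split; [exact: PE|exact: is_sym_vee].
Qed.

Lemma is_polP P : is_pol P <-> sym_pol P.
Proof.
split=> [[s sE ->]|PS].
  rewrite /elem_sum big_seq; apply: sym_pol_sum => x /sE[xE xS].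
  exact: sym_pol_elem.
have [[D PD] _ _] := PS; exists (pol_repr D P); first exact: pol_repr_in.
exact: pol_reprE.
Qed.

Definition nu cc P : R :=
  \sum_(w \in [set: W]) wt r' (size w) * cc ^+ size w * qn cc (P w).

Lemma nuE cc D P : 0 <= cc -> degree_lt D P ->
  nu cc P = \sum_(k < D) wt r' k * cc ^+ k * wsum k (fun w => qn cc (P w)).
Proof.
move=> c0 PD; rewrite /nu (@fsum_words _ _ D).
  apply: eq_bigr => k _; rewrite -wsum_mull; apply: eq_wsum => w ->.
  by [].
by move=> w /PD ->; rewrite qn0 ?mulr0.
Qed.

Lemma nu_ge0 cc P : 0 <= cc -> 0 <= nu cc P.
Proof.
by move=> c0; apply: fsumr_ge0 => w _; rewrite !mulr_ge0 ?wt_ge0 ?exprn_ge0 ?qn_ge0.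
Qed.

Lemma nu0 cc : 0 <= cc -> nu cc 0 = 0.
Proof. by move=> c0; rewrite (@nuE cc 0)// big_ord0. Qed.

Lemma nuD cc P Q : 0 <= cc -> sym_pol P -> sym_pol Q -> nu cc (P + Q) <= nu cc P + nu cc Q.
Proof.
move=> c0 PS QS; have [[D PD] _ PE] := PS; have [[D' QD] _ QE] := QS.
have PD' := degree_lt_widen (leq_maxl D D') PD.
have QD' := degree_lt_widen (leq_maxr D D') QD.
have PQD : degree_lt (maxn D D') (P + Q).
  by move=> w Dw; rewrite polD PD'// QD'//; apply/funext => g; rewrite addr0.
rewrite (nuE c0 PD') (nuE c0 QD') (nuE c0 PQD) -big_split/=.
apply: ler_sum => k _; rewrite -mulrDr ler_wpM2l ?mulr_ge0 ?wt_ge0 ?exprn_ge0//.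
by rewrite -wsumD; apply: ler_wsum => w _; rewrite polD qnD.
Qed.

Lemma nuZ_le cc (a : C) P : 0 <= cc -> sym_pol P -> nu cc (a *: P) <= cn a * nu cc P.
Proof.
move=> c0 PS; have [[D PD] _ PE] := PS.
have aPD : degree_lt D (a *: P).
  by move=> w Dw; rewrite polZ PD//; apply/funext => g; rewrite mulr0.
rewrite (nuE c0 PD) (nuE c0 aPD) mulr_sumr; apply: ler_sum => k _.
rewrite mulrCA ler_wpM2l ?mulr_ge0 ?wt_ge0 ?exprn_ge0// -wsum_mull.
by apply: ler_wsum => w _; rewrite polZ qnZ_le.
Qed.

Lemma nu_sum cc (I : Type) (s : seq I) (p : pred I) (f : I -> pol G) : 0 <= cc ->
  (forall i, p i -> sym_pol (f i)) ->
  nu cc (\sum_(i <- s | p i) f i) <= \sum_(i <- s | p i) nu cc (f i).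
Proof.
move=> c0 fS.
suff [] : sym_pol (\sum_(i <- s | p i) f i) /\
  nu cc (\sum_(i <- s | p i) f i) <= \sum_(i <- s | p i) nu cc (f i) by [].
elim: s => [|i s [IH1 IH2]]; first by rewrite !big_nil nu0//; split=> //; exact: sym_pol0.
rewrite !big_cons; case: ifP => // pi; split; first by apply: sym_polD => //; exact: fS.
by apply: (le_trans (nuD c0 (fS _ pi) IH1)); rewrite lerD2l.
Qed.

Lemma nu_wsum cc k (F : W -> pol G) : 0 <= cc ->
  (forall w, size w = k -> sym_pol (F w)) ->
  nu cc (wsum k F) <= wsum k (fun w => nu cc (F w)).
Proof.
move=> c0; elim: k F => [|k IH] F FS //=.
apply: (le_trans (nu_sum _ c0 _)).
  by move=> i _; apply: sym_pol_wsum => w wk; apply: FS; rewrite /= wk.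
by apply: ler_sum => i _; apply: IH => w wk; apply: FS; rewrite /= wk.
Qed.

Lemma nu_mono cc cc' P : sym_pol P -> 0 <= cc -> cc <= cc' -> nu cc P <= nu cc' P.
Proof.
move=> [[D PD] _ PE] c0 ccc; have c'0 := le_trans c0 ccc.
rewrite (nuE c0 PD) (nuE c'0 PD); apply: ler_sum => k _.
apply: ler_pM; rewrite ?mulr_ge0 ?wt_ge0 ?exprn_ge0//.
- by apply: wsum_ge0 => w _; exact: qn_ge0.
- by rewrite ler_wpM2l ?wt_ge0// lerXn2r ?nnegrE.
- by apply: ler_wsum => w _; exact: qn_mono.
Qed.

Lemma nu_elem cc phi v D : 0 <= cc -> entire_fun phi ->
  (forall w, (D <= size w)%N -> v w = 0) ->
  nu cc (elem phi v) <= qn cc phi * \sum_(k < D) wt r' k * cc ^+ k * l1 k v.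
Proof.
move=> c0 fE vD; have eD : degree_lt D (elem phi v).
  by move=> w /vD vw; apply/funext => g; rewrite /elem vw mulr0.
rewrite (nuE c0 eD) mulr_sumr; apply: ler_sum => k _.
rewrite mulrCA ler_wpM2l ?mulr_ge0 ?wt_ge0 ?exprn_ge0// /l1 -wsum_mull.
apply: ler_wsum => w _; rewrite /elem (_ : (fun g => _) = (fun g => v w * phi g)).
  by rewrite [leRHS]mulrC; exact: qnZ_le.
by apply/funext => g; rewrite mulrC.
Qed.

(** The decomposition along symmetrized words already gives this bound on the infimum. *)
Lemma pol_norm_le cc cc' M P : 0 <= cc -> 0 <= cc' -> cc <= M -> cc' <= M -> sym_pol P ->
  (pol_norm c B r r' cc cc' P <= (nu M P)%:E)%E.
Proof.
move=> c0 c'0 cM c'M PS; have [[D PD] _ PE] := PS; have M0 := le_trans c0 cM.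
apply: ge_ereal_inf; exists (\sum_(x <- pol_repr D P) q_norm c B r cc x.1 * p_norm r' cc' x.2)%E.
  by exists (pol_repr D P); split=> //; [exact: pol_repr_in|exact: pol_reprE].
rewrite big_map (nuE M0 PD).
rewrite (eq_bigr (fun k : 'I_D => wsum k (fun w => wt r' (size w) * M ^+ size w * qn M (P w)))); last first.
  by move=> k _; rewrite -wsum_mull; apply: eq_wsum => w ->.
rewrite -big_words -sumEFin; apply: lee_sum => w _ /=.
rewrite (qnE (PE w) c0).
apply: (@le_trans _ _ ((qn cc (P w))%:E * (wt r' (size w) * cc' ^+ size w)%:E)%E).
  by apply: lee_wpmul2l; [rewrite lee_fin qn_ge0|exact: p_norm_vee].
rewrite -EFinM lee_fin mulrC ler_pM ?mulr_ge0 ?wt_ge0 ?exprn_ge0 ?qn_ge0//.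
  by rewrite ler_wpM2l ?wt_ge0// lerXn2r ?nnegrE.
exact: qn_mono.
Qed.

(** [nu] is subadditive and on elementary tensors at most the product of the two norms, so it lies
    below every competitor in the infimum. *)
Lemma pol_norm_ge M P : 0 <= M -> ((nu M P)%:E <= pol_norm c B r r' M M P)%E.
Proof.
move=> M0; apply/ereal_infP => _ [s [sE -> ->]].
have sS x : x \in s -> sym_pol (elem x.1 x.2).
  by move=> /sE[]; exact: sym_pol_elem.
apply: (@le_trans _ _ (\sum_(x <- s) nu M (elem x.1 x.2))%:E).
  by rewrite lee_fin /elem_sum big_seq [leRHS]big_seq; apply: nu_sum.
rewrite -sumEFin big_seq [leRHS]big_seq; apply: lee_sum => x xs.
have [xE xS] := sE x xs; have [[d xd] _] := xS.
apply: (@le_trans _ _ (qn M x.1 * \sum_(k < d.+1) wt r' k * M ^+ k * l1 k x.2)%:E).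
  by rewrite lee_fin; apply: nu_elem => // w dw; exact: xd.
rewrite EFinM (qnE xE M0); apply: lee_wpmul2l; first by rewrite lee_fin qn_ge0.
exact: p_norm_ge.
Qed.

(** Countably many parameters suffice, as [nu] increases with its parameter. They start at 1, where
    the estimates for derivatives begin to hold. *)
Definition nuN (N : nat) P := nu N.+1%:R P.

Lemma pol_nbhsP P A : sym_pol P ->
  pol_nbhs c B r r' P A <->
  exists N (e : R), 0 < e /\ forall Q, sym_pol Q -> nuN N (Q - P) < e -> A Q.
Proof.
move=> PS; split.
  move=> [s [e [e0 s0 H]]].
  (* A basic neighbourhood involves finitely many pairs of parameters, and one [N.+1] exceeds them
     all. *)
  have [N HN] : exists N : nat, forall x, x \in s -> x.1 <= N.+1%:R /\ x.2 <= N.+1%:R.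
    elim: s {H} s0 => [|x s IH] s0; first by exists 0%N.
    have [|N HN] := IH; first by move=> y ys; apply: s0; rewrite inE ys orbT.
    have up (z : R) : 0 <= z -> z <= (Num.trunc z).+1%:R.
      by move=> z0; apply: ltW; have /andP[] := truncn_itv z0.
    exists (maxn N (maxn (Num.trunc x.1) (Num.trunc x.2))) => y.
    have [x1 x2] := s0 x (mem_head _ _).
    rewrite inE => /predU1P[->|/HN[y1 y2]].
      split; [apply: (le_trans (up _ x1))|apply: (le_trans (up _ x2))]; rewrite ler_nat ltnS; move: (Num.trunc _) (Num.trunc _) => a b; lia.
    split; [apply: (le_trans y1)|apply: (le_trans y2)]; by rewrite ler_nat ltnS leq_maxl.
  exists N, e; split=> // Q QS Qe; apply: H; first exact/is_polP.
  move=> x xs; have [x1 x2] := s0 x xs; have [y1 y2] := HN x xs.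
  apply: (le_lt_trans (pol_norm_le x1 x2 y1 y2 (sym_polB QS PS))).
  by rewrite lte_fin.
move=> [N [e [e0 H]]]; exists [:: (N.+1%:R, N.+1%:R)], e; split=> //.
  by move=> x; rewrite inE => /eqP ->.
move=> Q /is_polP QS Qe; apply: H => //.
have := Qe _ (mem_head _ _); rewrite -lte_fin; apply: le_lt_trans.
exact: pol_norm_ge.
Qed.

End PolynomialFunctions.

(** * The Neumaier operator *)

Section Neumaier.
Context (R : realType) (n : nat) (G : lieGroupType R n).
Context (c : chart R n G) (c_atlas : lie_atlas c) (c_unit : cdom c 1%g).
Context (B : 'M[R]_n) (r r' : R).
Local Notation C := (R[i]^o).
Local Notation W := (seq 'I_n).
Local Notation cn := (@Normc.normc R).
Local Notation entire_fun := (entire_fun c B r).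
Local Notation qn := (qn c B r).
Local Notation nu := (nu c B r r').
Local Notation sym_pol := (sym_pol c B r).
Local Notation lw := (lie_word c B).
Implicit Types (P Q : pol G) (phi psi : G -> C) (u : W).

Lemma lie_derC_wsum xi k (F : W -> G -> C) : (forall w, Canalytic (F w)) ->
  Canalytic (wsum k F) /\
  lie_derC c xi (wsum k F) = wsum k (fun w => lie_derC c xi (F w)).
Proof.
elim: k F => [|k IH] F FA /=; first by split.
apply: (big_ind2 (fun phi psi => Canalytic phi /\ lie_derC c xi phi = psi)).
- by split; [exact: Canalytic_cst|exact: lie_derC_cst].
- move=> phi phi' psi psi' [pA pE] [qA qE]; split; first exact: CanalyticD.
  by rewrite (lie_derC_D c_atlas c_unit)// pE qE.
- by move=> i _; apply: IH.
Qed.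

Lemma entire_wsum k (F : W -> G -> C) :
  (forall w, size w = k -> entire_fun (F w)) -> entire_fun (wsum k F).
Proof.
elim: k F => [|k IH] F FE /=; first exact: FE.
apply: big_ind => [||i _]; [exact: entire0|exact: entireD|].
by apply: IH => w wk; apply: FE; rewrite /= wk.
Qed.

Lemma qn_wsum cc k (F : W -> G -> C) : 0 <= cc ->
  (forall w, size w = k -> entire_fun (F w)) ->
  qn cc (wsum k F) <= wsum k (fun w => qn cc (F w)).
Proof.
move=> c0; elim: k F => [|k IH] F FE //=.
suff [] : entire_fun (\sum_i wsum k (fun w => F (i :: w))) /\
  qn cc (\sum_i wsum k (fun w => F (i :: w))) <=
  \sum_i wsum k (fun w => qn cc (F (i :: w))) by [].
apply: (big_ind2 (fun phi x => entire_fun phi /\ qn cc phi <= x)).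
- by split; [exact: entire0|rewrite qn0].
- move=> phi x psi y [pE px] [qE qy]; split; first exact: entireD.
  by apply: (le_trans (qnD c_atlas c_unit pE qE c0)); exact: lerD.
- move=> i _; have FE' w : size w = k -> entire_fun (F (i :: w)).
    by move=> wk; apply: FE; rewrite /= wk.
  by split; [exact: entire_wsum|exact: IH].
Qed.

(** By the symmetry of [P] the [(size u).+1] positions of the omitted factor contribute equally;
    summing the symmetrized words against a symmetric family gives its value at [u]. *)
Lemma DeltaE P u : sym_pol P -> neumaier_Delta c B P u =
  ((size u).+1%:R : R[i]) *: \sum_i lie_derC c (row i B) (P (i :: u)).
Proof.
move=> [[D PD] PS PE].
rewrite /neumaier_Delta (@fsum_words n _ D); last first.
  move=> w Dw; apply: big1 => l _; rewrite PD// lie_derC_cst.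
  by apply/funext => v; apply/funext => g; rewrite /elem mul0r.
pose S k := wsum k (fun w => \sum_(l < size w)
  elem (lie_derC c (row (tnth (in_tuple w) l) B) (P w)) (vee R (take l w ++ drop l.+1 w))).
have S0 : S 0%N u = 0 by rewrite /S /= big_ord0.
have SE k : S k.+1 u = if size u == k then
    (k.+1%:R : R[i]) *: \sum_i lie_derC c (row i B) (P (i :: u)) else 0.
  rewrite /S (wsum_additive _ _ (f := fun Q : pol G => Q u))//.
  pose F a v i : G -> C := elem (lie_derC c (row i B) (P (i :: a ++ v))) (vee R (a ++ v)) u.
  transitivity (wsum k.+1 (fun w => \sum_(l < k.+1)
      if drop l w is i :: v then F (take l w) v i else 0)).
    apply: eq_wsum => w wk.
    transitivity (\sum_(l < size w) if drop l w is i :: v then F (take l w) v i else 0).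
      rewrite fct_sumE; apply: eq_bigr => l _.
      have [x0 _] : exists x : 'I_n, true by exists (tnth (in_tuple w) l).
      rewrite [in RHS](drop_nth x0 (ltn_ord l)) (tnth_nth x0) /F.
      rewrite [in LHS]/=.
      rewrite -(PS w (nth x0 w l :: take l w ++ drop l.+1 w))//.
      rewrite -{1}(cat_take_drop l w) (drop_nth x0 (ltn_ord l)).
      by apply/seq.permP => p; rewrite /= !count_cat /= addnCA.
    by rewrite wk.
  rewrite wsum_sum (eq_bigr (fun=> if size u == k then
    \sum_i lie_derC c (row i B) (P (i :: u)) else 0)).
    rewrite sumr_const card_ord; case: eqP => _; first by rewrite -scaler_nat.
    by rewrite mul0rn.
  move=> [l /= lk] _; rewrite ltnS in lk.
  transitivity (\sum_i wsum k (fun w => F (take l w) (drop l w) i)).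
    exact: (wsum_take_drop F lk).
  have E i : wsum k (fun w => F (take l w) (drop l w) i) =
      wsum k (fun w => (vee R w u : R[i]) *: lie_derC c (row i B) (P (i :: w))).
    apply: eq_wsum => w _; rewrite /F cat_take_drop; apply/funext => g.
    by rewrite /elem mulrC.
  rewrite (eq_bigr _ (fun i _ => E i)); case: eqP => uk.
    apply: eq_bigr => i _.
    rewrite (@vee_sum_sym R n _ (fun w => lie_derC c (row i B) (P (i :: w))) k u)//.
    by move=> w w' ww; rewrite (PS (i :: w) (i :: w'))// perm_cons.
  apply: big1 => i _; apply: wsum_eq0 => w wk; rewrite (vee_symk R w).1 ?scale0r// => uw.
  by apply: uk; rewrite uw wk.
transitivity (\sum_(k < D) S k u); first by rewrite fct_sumE.
have [uD|Du] := ltnP (size u).+1 D.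
  rewrite (bigD1 (Ordinal uD))//= SE eqxx [X in _ + X]big1 ?addr0// => -[[|k] kD] //=.
  by rewrite -val_eqE /= eqSS eq_sym SE => /negPf ->.
rewrite big1 => [|[[|k] kD] _]; rewrite ?SE//.
  rewrite big1 ?scaler0// => i _; rewrite PD//= lie_derC_cst//.
by case: eqP => // uk; move: kD Du; rewrite /= uk ltnNge => /negPf ->.
Qed.

(** Closed form of the [l]-th power of [neumaier_Delta] on Pol; the falling factorial is the product
    of the factors [(size u).+1] that [DeltaE] produces in [l] successive degrees. *)
Definition Delta_pow l P : pol G :=
  fun u => (((size u + l) ^_ l)%:R : R[i]) *: wsum l (fun a => lw a (P (a ++ u))).

Lemma sym_Delta_pow l P : sym_pol P -> sym_pol (Delta_pow l P).
Proof.
move=> [[D PD] PS PE]; split.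
- exists D => w Dw; rewrite /Delta_pow wsum_eq0 ?scaler0// => a _.
  rewrite PD ?lie_word_cst0// size_cat; exact: (leq_trans Dw (leq_addl _ _)).
- move=> w w' ww; rewrite /Delta_pow (perm_size ww); congr (_ *: _).
  by apply: eq_wsum => a _; rewrite (PS (a ++ w) (a ++ w'))// perm_cat2l.
- move=> w; apply: (entireZ c_atlas c_unit); apply: entire_wsum => a _.
  exact: (entire_word c_atlas c_unit).
Qed.

Lemma iter_DeltaE l P : sym_pol P -> iter l (neumaier_Delta c B) P = Delta_pow l P.
Proof.
move=> PS; elim: l => [|l IH]; apply/funext => u.
  by rewrite /Delta_pow ffactn0 scale1r.
rewrite iterS IH DeltaE; last exact: sym_Delta_pow.
have [_ PS' PE] := PS.
have A i (a : W) : Canalytic (lw a (P (a ++ i :: u))).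
  by apply: (Canalytic_lie_word c_atlas c_unit); have [] := PE (a ++ i :: u).
have E i : lie_derC c (row i B) (Delta_pow l P (i :: u)) =
    (((size u + l.+1) ^_ l)%:R : R[i]) *:
      wsum l (fun a => lw (i :: a) (P ((i :: a) ++ u))).
  rewrite /Delta_pow (lie_derC_Z c_atlas c_unit); last exact: (lie_derC_wsum 0 l (A i)).1.
  rewrite (lie_derC_wsum _ l (A i)).2 addnS; congr (_ *: _).
  apply: eq_wsum => a _; rewrite /=; congr (lie_derC _ _ (lie_word _ _ _ _)).
  by apply: PS'; rewrite perm_catC /= perm_cons perm_catC.
under eq_bigr do rewrite E.
rewrite -scaler_sumr scalerA -natrM /Delta_pow.
by rewrite ffactnSr mulnC addnS subSn ?leq_addl// addnK.
Qed.

Lemma Delta_pow_linear l (a : R[i]) P Q : sym_pol P -> sym_pol Q ->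
  Delta_pow l (a *: P + Q) = a *: Delta_pow l P + Delta_pow l Q.
Proof.
move=> [_ _ PE] [_ _ QE]; apply/funext => u.
rewrite polD polZ; apply/funext => g; rewrite /Delta_pow.
have E (F : W -> G -> C) : wsum l F g = wsum l (fun w => F w g).
  by rewrite (wsum_additive _ _ (f := fun f : G -> C => f g)).
have S (x : R[i]) (f : G -> C) : (x *: f) g = x * f g by [].
rewrite !S !E mulrCA -mulrDr; congr (_ * _).
rewrite -wsum_mull -wsumD; apply: eq_wsum => w _.
rewrite polD polZ (lie_word_D c_atlas c_unit)//; last by have [] := QE (w ++ u).
  by rewrite (lie_word_Z c_atlas c_unit)//; have [] := PE (w ++ u).
by apply: CanalyticM; [exact: Canalytic_cst|have [] := PE (w ++ u)].
Qed.

(* Uses [l!^(1 - r) <= l!^r'], which is where [1 <= r + r'] enters. *)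
Lemma nu_Delta_pow l (T cc : R) P : 1 <= r + r' -> 1 <= T -> 1 <= cc -> sym_pol P ->
  T ^+ l * nu cc ((l`!%:R : R[i])^-1 *: Delta_pow l P) <=
  nu (T * 2 * wtc r' * wtc (r - 1) * cc) P.
Proof.
move=> rr T1 c1 PS; have [[D PD] _ PE] := PS.
set A := wtc (r - 1); set M := _ * cc.
have c0 : 0 <= cc by lra.
have T0 : 0 <= T by lra.
have A1 : 1 <= A by exact: wtc1.
have w1 : 1 <= wtc r' by exact: wtc1.
have Tw1 : 1 <= T * 2 * wtc r' by rewrite mulr_ege1// mulr_ege1//; lra.
have AM : A * cc <= M by rewrite /M -mulrA ler_peMl// mulr_ge0//; lra.
have M0 : 0 <= M by apply: le_trans AM; rewrite mulr_ge0//; lra.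
have LD : degree_lt D ((l`!%:R : R[i])^-1 *: Delta_pow l P).
  move=> w Dw; rewrite polZ /Delta_pow wsum_eq0 ?scaler0//.
    by apply/funext => g; rewrite mulr0.
  move=> a _; rewrite PD ?lie_word_cst0// size_cat; exact: (leq_trans Dw (leq_addl _ _)).
have PD' : degree_lt (l + D) P by apply: degree_lt_widen PD; exact: leq_addl.
rewrite (nuE _ _ _ _ c0 LD) (nuE _ _ _ _ M0 PD') big_split_ord /=.
rewrite -[leLHS]add0r; apply: lerD.
  apply: sumr_ge0 => k _; rewrite !mulr_ge0 ?wt_ge0 ?exprn_ge0//.
  by apply: wsum_ge0 => w _; exact: qn_ge0.
rewrite mulr_sumr; apply: ler_sum => -[k /= _] _.
pose X := wsum (l + k) (fun v => qn (A * cc) (P v)).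
have X0 : 0 <= X by apply: wsum_ge0 => v _; apply: qn_ge0; rewrite mulr_ge0//; lra.
apply: (@le_trans _ _ (T ^+ l * (wt r' k * cc ^+ k * ('C(l + k, l)%:R * wt (1 - r) l * X)))).
  apply: ler_wpM2l; first by rewrite exprn_ge0.
  apply: ler_wpM2l; first by rewrite mulr_ge0 ?wt_ge0 ?exprn_ge0.
  rewrite /X wsum_cat wsum_wsum -wsum_mull; apply: ler_wsum => u uk.
  have FE (a : W) : entire_fun (lw a (P (a ++ u))).
    exact: (entire_word c_atlas c_unit).
  (* Division by [l!] leaves a binomial coefficient, which is at most [2 ^ (l + k)]. *)
  have -> : ((l`!%:R : R[i])^-1 *: Delta_pow l P) u =
      (fun g => ('C(l + k, l)%:R : R[i]) * wsum l (fun a => lw a (P (a ++ u))) g).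
    rewrite polZ /Delta_pow; apply/funext => g.
    rewrite uk addnC -bin_ffact natrM /= /GRing.scale /= mulrA; congr (_ * _).
    by rewrite mulrC mulfK ?fact_neq0.
  apply: (le_trans (qnZ_le c_atlas c_unit _ (entire_wsum (fun a _ => FE a)) c0)).
  rewrite cn_nat -mulrA; apply: ler_wpM2l => //.
  apply: (le_trans (qn_wsum c0 (fun a _ => FE a))); rewrite -wsum_mull.
  by apply: ler_wsum => a al; rewrite -al; exact: (qn_word c_atlas c_unit).
have XX : X <= wsum (l + k) (fun w => qn M (P w)).
  apply: ler_wsum => v _; apply: qn_mono => //.
  by rewrite mulr_ge0//; lra.
apply: (@le_trans _ _ (wt r' (l + k) * M ^+ (l + k) * X)); last first.
  by rewrite ler_wpM2l// mulr_ge0 ?wt_ge0 ?exprn_ge0.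
rewrite (_ : T ^+ l * _ = (T ^+ l * cc ^+ k * 'C(l + k, l)%:R) * (wt (1 - r) l * wt r' k) * X); last by ring.
rewrite ler_wpM2r//.
apply: (@le_trans _ _ ((T ^+ (l + k) * cc ^+ (l + k) * 2 ^+ (l + k)) *
    (wtc r' ^+ (l + k) * wt r' (l + k)))).
  apply: ler_pM; rewrite ?mulr_ge0 ?exprn_ge0 ?wt_ge0//.
    apply: ler_pM; rewrite ?mulr_ge0 ?exprn_ge0//.
      by apply: ler_pM; rewrite ?exprn_ge0//; apply: ler_weXn2l => //; rewrite ?leq_addr ?leq_addl.
    by rewrite -natrX ler_nat bin_le_pow2.
  apply: le_trans (wt_mul_le _ _ _); rewrite ler_wpM2r ?wt_ge0//; apply: wt_mono; lra.
rewrite -!exprMn mulrA [leRHS]mulrC -exprMn ler_wpM2r ?wt_ge0//.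
rewrite lerXn2r ?nnegrE// ?mulr_ge0 ?wtc_ge0//.
rewrite (_ : M = A * (T * cc * 2 * wtc r')); last by rewrite /M; ring.
by rewrite ler_peMl// ?mulr_ge0 ?wtc_ge0//.
Qed.

End Neumaier.

(** * The star product *)

Section StarProduct.
Context (R : realType) (n : nat) (G : lieGroupType R n).
Context (c : chart R n G) (c_atlas : lie_atlas c) (c_unit : cdom c 1%g).
Context (B : 'M[R]_n) (r r' : R).
Local Notation C := (R[i]^o).
Local Notation W := (seq 'I_n).
Local Notation cn := (@Normc.normc R).
Local Notation entire_fun := (entire_fun c B r).
Local Notation qn := (qn c B r).
Local Notation nu := (nu c B r r').
Local Notation sym_pol := (sym_pol c B r).
Local Notation lw := (lie_word c B).
Implicit Types (P Q : pol G) (phi psi : G -> C) (w u : W).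

Lemma sum_ord_shift (V : nmodType) p L (F : nat -> V) : (p <= L)%N ->
  \sum_(b < L | (p <= b)%N) F b = \sum_(m < L - p) F (p + m)%N.
Proof.
move=> pL; rewrite -[in LHS](subnKC pL) big_mkcond /=; move: (L - p)%N => d.
rewrite big_split_ord /= big1 ?add0r => [|b _]; last by rewrite leqNgt ltn_ord.
by apply: eq_bigr => b _; rewrite leq_addr.
Qed.

Lemma elemD phi (a b : W -> C) : elem phi (a + b) = elem phi a + elem phi b :> pol G.
Proof. by apply/funext => v; apply/funext => g; rewrite /elem mulrDr. Qed.

Lemma elemZ phi (a : R[i]) (v : W -> C) : elem phi (a *: v) = a *: elem phi v :> pol G.
Proof. by apply/funext => x; apply/funext => g; rewrite /elem mulrCA. Qed.

Lemma elem0 phi : elem phi 0 = 0 :> pol G.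
Proof. by apply/funext => x; apply/funext => g; rewrite /elem mulr0. Qed.

Lemma elem0l (v : W -> C) : elem (fun=> 0) v = 0 :> pol G.
Proof. by apply/funext => x; apply/funext => g; rewrite /elem mul0r. Qed.

Lemma elem_bigsum phi (I : Type) (s : seq I) (p : pred I) (f : I -> W -> C) :
  elem phi (\sum_(i <- s | p i) f i) = \sum_(i <- s | p i) elem phi (f i) :> pol G.
Proof. exact: (big_morph _ (elemD phi) (elem0 phi)). Qed.

Lemma elem_linl (a : R[i]) phi phi' (v : W -> C) :
  elem (fun g => a * phi g + phi' g) v = a *: elem phi v + elem phi' v :> pol G.
Proof.
by apply/funext => x; apply/funext => g; rewrite /elem mulrDl -mulrA.
Qed.

Lemma symk_is_sym k (v : W -> C) : symk k v -> is_sym v.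
Proof.
by move=> [v0 vS]; split=> //; exists k => w kw; apply: v0 => wk; rewrite wk ltnn in kw.
Qed.

Lemma nu_elem_symk cc phi k (v : W -> C) : 0 <= cc -> entire_fun phi -> symk k v ->
  nu cc (elem phi v) <= qn cc phi * (wt r' k * cc ^+ k * l1 k v).
Proof.
move=> c0 fE [v0 _].
apply: (le_trans (nu_elem c_atlas c_unit r' c0 fE (D := k.+1) _)).
  by move=> w kw; apply: v0 => wk; rewrite wk ltnn in kw.
rewrite ler_wpM2l ?qn_ge0// big_ord_recr /= big1 ?add0r// => l _.
rewrite /l1 wsum_eq0 ?mulr0// => w wl; rewrite v0 ?cn0// wl => lk.
by have := ltn_ord l; rewrite lk ltnn.
Qed.

Context (K : R) (Cn : W -> W -> nat -> W -> C) (K1 : 1 <= K).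
Hypothesis CnP : forall a b : W,
  [/\ forall m, (m <= size a + size b)%N -> symk (size a + size b - m) (Cn a b m),
      forall m, (m <= size a + size b)%N ->
        l1 (size a + size b - m) (Cn a b m) <= K ^+ (size a + size b) * m`!%:R
    & forall z : C, gutt (structure_const c B) z (vee R a) (vee R b) =
        \sum_(m < (size a + size b).+1) z ^+ m *: Cn a b m].

(** Extended by zero, so that the estimates hold for all [m] and sums over [m] may be lengthened. *)
Definition gutt_coef (a b : W) m : W -> C :=
  if (m <= size a + size b)%N then Cn a b m else 0.

Lemma gutt_coef_symk (a b : W) m : symk (size a + size b - m) (gutt_coef a b m).
Proof.
rewrite /gutt_coef; case: ifP => mab; last by split.
by have [+ _ _] := CnP a b; apply.
Qed.

Lemma l1_gutt_coef (a b : W) m :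
  l1 (size a + size b - m) (gutt_coef a b m) <= K ^+ (size a + size b) * m`!%:R.
Proof.
rewrite /gutt_coef; case: ifP => // mab; first by have [_ + _] := CnP a b; apply.
by rewrite l10 mulr_ge0 ?exprn_ge0// (le_trans ler01).
Qed.

Lemma gutt_veeE (z : C) (a b : W) L : (size a + size b < L)%N ->
  gutt (structure_const c B) z (vee R a) (vee R b) =
  \sum_(m < L) (z ^+ m : R[i]) *: gutt_coef a b m.
Proof.
move=> /subnKC <-; have [_ _ ->] := CnP a b; rewrite big_split_ord /=.
rewrite [X in _ = _ + X]big1 ?addr0 => [|m _].
  by apply: eq_bigr => m _; rewrite /gutt_coef -ltnS ltn_ord.
by rewrite /gutt_coef leqNgt addSn ltnS leq_addr scaler0.
Qed.

(* Coefficient of [hbar ^+ b]; the power of 'i turns [(hbar / 'i) ^+ b] into it. *)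
Definition star_coef_gen b (w u : W) phi psi : pol G :=
  \sum_(p < (size w).+1 | (p <= b)%N)
    (('i%C ^- b : R[i]) / (p`! * (size w - p)`!)%:R) *:
    \sum_(s : 'S_(size w))
      elem (fun g => phi g * lw (take p (permute s)) psi g)
           (gutt_coef (drop p (permute s)) u (b - p)).

Definition star_coef b P Q : pol G :=
  \sum_(w \in [set: W]) \sum_(u \in [set: W]) star_coef_gen b w u (P w) (Q u).

Lemma star_coef_gen_high b w u phi psi :
  (size w + size u < b)%N -> star_coef_gen b w u phi psi = 0.
Proof.
move=> wub; apply: big1 => p pb; rewrite big1 ?scaler0// => s _.
rewrite /gutt_coef size_drop size_permute ifF ?elem0//.
apply/negbTE; rewrite -ltnNge; have := ltn_ord p; rewrite ltnS => pw; lia.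
Qed.

(** The derivatives contribute the power [p] of [hbar / 'i] and the Gutt product the power [m];
    terms are sorted by [b = p + m]. *)
Lemma star_std_genE (h : C) w u phi psi L : (size w + size u < L)%N ->
  star_std_gen c B h phi w psi (vee R u) =
  \sum_(b < L) (h ^+ b : R[i]) *: star_coef_gen b w u phi psi.
Proof.
move=> wuL; pose z : R[i] := h / 'i%C.
pose Y p m : pol G := ((p`! * (size w - p)`!)%:R : R[i])^-1 *: \sum_(s : 'S_(size w))
      elem (fun g => phi g * lw (take p (permute s)) psi g)
           (gutt_coef (drop p (permute s)) u m).
have pL (p : 'I_(size w).+1) : (p <= L)%N by have := ltn_ord p; lia.
transitivity (\sum_(p < (size w).+1) \sum_(m < L - p) z ^+ (p + m) *: Y p m).
  apply: eq_bigr => p _.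
  transitivity ((z ^+ p / (p`! * (size w - p)`!)%:R) *: \sum_(s : 'S_(size w))
    \sum_(m < L - p) z ^+ m *: elem (fun g => phi g * lw (take p (permute s)) psi g)
           (gutt_coef (drop p (permute s)) u m)).
    congr (_ *: _); apply: eq_bigr => s _.
    rewrite (@gutt_veeE _ _ _ (L - p)).
      by rewrite elem_bigsum; apply: eq_bigr => m _; rewrite elemZ.
    by rewrite size_drop size_permute; have := ltn_ord p; lia.
  rewrite exchange_big scaler_sumr; apply: eq_bigr => m _.
  by rewrite -scaler_sumr !scalerA exprD; congr (_ *: _); ring.
under [RHS]eq_bigr do rewrite /star_coef_gen scaler_sumr big_mkcond.
rewrite exchange_big; apply: eq_bigr => p _ /=.
rewrite -big_mkcond (sum_ord_shift (fun b => h ^+ b *: ((('i%C ^- b : R[i]) / (p`! * (size w - p)`!)%:R) *: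
    \sum_(s : 'S_(size w))
      elem (fun g => phi g * lw (take p (permute s)) psi g)
           (gutt_coef (drop p (permute s)) u (b - p)))) (pL p)).
apply: eq_bigr => m _; rewrite addnC addnK !scalerA; congr (_ *: _).
by rewrite /z expr_div_n mulrA.
Qed.

Lemma star_coef_gen0l b w u psi : star_coef_gen b w u (fun=> 0) psi = 0.
Proof.
apply: big1 => p _; rewrite big1 ?scaler0// => s _.
rewrite (_ : (fun g => _) = (fun=> 0)) ?elem0l//.
by apply/funext => g; rewrite mul0r.
Qed.

Lemma star_coef_gen0r b w u phi : star_coef_gen b w u phi (fun=> 0) = 0.
Proof.
apply: big1 => p _; rewrite big1 ?scaler0// => s _.
rewrite lie_word_cst0 (_ : (fun g => _) = (fun=> 0)) ?elem0l//.
by apply/funext => g; rewrite mulr0.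
Qed.

Lemma star_coef_gen_linl b w u psi (a : R[i]) phi phi' :
  star_coef_gen b w u (fun g => a * phi g + phi' g) psi =
  a *: star_coef_gen b w u phi psi + star_coef_gen b w u phi' psi.
Proof.
rewrite scaler_sumr -big_split /=; apply: eq_bigr => p _.
rewrite [a *: (_ *: _)]scalerA [a * _]mulrC -[(_ * a) *: _]scalerA -scalerDr.
rewrite [a *: \sum_s _]scaler_sumr -big_split /=; congr (_ *: _).
apply: eq_bigr => s _; rewrite -elem_linl; congr (elem _ _).
by apply/funext => g; rewrite mulrDl mulrA.
Qed.

Lemma star_coef_gen_linr b w u phi (a : R[i]) psi psi' :
  Canalytic psi -> Canalytic psi' ->
  star_coef_gen b w u phi (fun g => a * psi g + psi' g) =
  a *: star_coef_gen b w u phi psi + star_coef_gen b w u phi psi'.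
Proof.
move=> pA p'A; rewrite scaler_sumr -big_split /=; apply: eq_bigr => p _.
rewrite [a *: (_ *: _)]scalerA [a * _]mulrC -[(_ * a) *: _]scalerA -scalerDr.
rewrite [a *: \sum_s _]scaler_sumr -big_split /=; congr (_ *: _).
apply: eq_bigr => s _; rewrite -elem_linl; congr (elem _ _).
rewrite (lie_word_D c_atlas c_unit)//; last first.
  by apply: CanalyticM => //; exact: Canalytic_cst.
rewrite (lie_word_Z c_atlas c_unit)//.
by apply/funext => g; rewrite mulrDr mulrCA.
Qed.

Lemma star_coefE b D E P Q : degree_lt D P -> degree_lt E Q ->
  star_coef b P Q = \sum_(k < D) wsum k (fun w => \sum_(l < E) wsum l (fun u =>
    star_coef_gen b w u (P w) (Q u))).
Proof.
move=> PD QE; rewrite /star_coef (@fsum_words n _ D) => [|w Dw].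
  apply: eq_bigr => k _; apply: eq_wsum => w _; apply: fsum_words => u /QE ->.
  exact: star_coef_gen0r.
by rewrite PD//; apply: fsbig1 => u _; exact: star_coef_gen0l.
Qed.

Lemma star_coef_high b D E P Q : degree_lt D P -> degree_lt E Q -> (D + E <= b)%N ->
  star_coef b P Q = 0.
Proof.
move=> PD QE DEb; rewrite (star_coefE b PD QE).
apply: big1 => k _; apply: wsum_eq0 => w wk; apply: big1 => l _.
apply: wsum_eq0 => u ul; apply: star_coef_gen_high.
by rewrite wk ul; have := ltn_ord k; have := ltn_ord l; lia.
Qed.

Lemma star_stdE (h : C) D E P Q : degree_lt D P -> degree_lt E Q ->
  star_std c B h P Q = \sum_(b < D + E) (h ^+ b : R[i]) *: star_coef b P Q.
Proof.
move=> PD QE; under [RHS]eq_bigr do rewrite (star_coefE _ PD QE).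
rewrite /star_std (@fsum_words n _ D) => [|w Dw]; last first.
  rewrite PD//; apply: fsbig1 => u _.
  rewrite (@star_std_genE _ _ _ _ _ (size w + size u).+1)// big1// => b _.
  by rewrite star_coef_gen0l scaler0.
under [RHS]eq_bigr do rewrite scaler_sumr.
rewrite exchange_big /=; apply: eq_bigr => k _.
under [RHS]eq_bigr do rewrite -wsum_scale.
rewrite -wsum_sum; apply: eq_wsum => w wk.
rewrite (@fsum_words n _ E) => [|u Eu]; last first.
  rewrite QE// (@star_std_genE _ _ _ _ _ (size w + size u).+1)// big1// => b _.
  by rewrite star_coef_gen0r scaler0.
under [RHS]eq_bigr do rewrite scaler_sumr.
rewrite exchange_big /=; apply: eq_bigr => l _.
under [RHS]eq_bigr do rewrite -wsum_scale.
rewrite -wsum_sum; apply: eq_wsum => u ul.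
by apply: star_std_genE; rewrite wk ul; have := ltn_ord k; have := ltn_ord l; lia.
Qed.

Lemma star_coef_linl b Q (a : R[i]) P P' : sym_pol P -> sym_pol P' -> sym_pol Q ->
  star_coef b (a *: P + P') Q = a *: star_coef b P Q + star_coef b P' Q.
Proof.
move=> [[D PD] _ _] [[D' PD'] _ _] [[E QE] _ _].
have {PD}PD := degree_lt_widen (leq_maxl D D') PD.
have {PD'}PD' := degree_lt_widen (leq_maxr D D') PD'.
have PPD : degree_lt (maxn D D') (a *: P + P').
  move=> w Dw; rewrite polD polZ PD// PD'//.
  by apply/funext => g; rewrite mulr0 addr0.
rewrite (star_coefE b PPD QE) (star_coefE b PD QE) (star_coefE b PD' QE).
rewrite scaler_sumr -big_split /=; apply: eq_bigr => k _.
rewrite -wsum_scale -wsumD; apply: eq_wsum => w _.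
rewrite scaler_sumr -big_split /=; apply: eq_bigr => l _.
rewrite -wsum_scale -wsumD; apply: eq_wsum => u _.
exact: star_coef_gen_linl.
Qed.

Lemma star_coef_linr b P (a : R[i]) Q Q' : sym_pol P -> sym_pol Q -> sym_pol Q' ->
  star_coef b P (a *: Q + Q') = a *: star_coef b P Q + star_coef b P Q'.
Proof.
move=> [[D PD] _ _] [[E QE] _ Qe] [[E' QE'] _ Qe'].
have {QE}QE := degree_lt_widen (leq_maxl E E') QE.
have {QE'}QE' := degree_lt_widen (leq_maxr E E') QE'.
have QQE : degree_lt (maxn E E') (a *: Q + Q').
  move=> w Dw; rewrite polD polZ QE// QE'//.
  by apply/funext => g; rewrite mulr0 addr0.
rewrite (star_coefE b PD QQE) (star_coefE b PD QE) (star_coefE b PD QE').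
rewrite scaler_sumr -big_split /=; apply: eq_bigr => k _.
rewrite -wsum_scale -wsumD; apply: eq_wsum => w _.
rewrite scaler_sumr -big_split /=; apply: eq_bigr => l _.
rewrite -wsum_scale -wsumD; apply: eq_wsum => u _.
by apply: star_coef_gen_linr; [have [] := Qe u|have [] := Qe' u].
Qed.

Section Bounds.
Hypotheses (r0 : 0 <= r) (r'1 : 1 <= r').

Lemma sym_star_coef b P Q : sym_pol P -> sym_pol Q -> sym_pol (star_coef b P Q).
Proof.
move=> [[D PD] _ PE] [[E QE] _ Qe]; rewrite (star_coefE b PD QE).
apply: sym_pol_sum => // k _; apply: sym_pol_wsum => // w _.
apply: sym_pol_sum => // l _; apply: sym_pol_wsum => // u _.
apply: sym_pol_sum => // p _; apply: sym_polZ => //.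
apply: sym_pol_sum => // s _; apply: sym_pol_elem => //.
  by apply: entireM => //; exact: entire_word.
exact: symk_is_sym (gutt_coef_symk _ _ _).
Qed.

(** [4] bounds the number of values of [p] and the binomial coefficient, by [2 ^ size w] each. Two
    factors [wtc r'] come from splitting the weight in the Gutt product and one from recombining
    [p!] with [(size w - p)!^r']; [wtc r] is due to the product of functions and [wtc (r - 1)] to
    the derivatives. *)
Definition star_rate (T cc : R) : R :=
  (T * 4 * wtc r' ^+ 3 * (cc * K)) * (wtc r * wtc (r - 1)).

(* [p`!] comes from [p!^(1 - r) <= p!], and it cancels against the coefficient of
   the star product; the [m!] of the Gutt product is absorbed by [m!^r']. *)
Lemma nu_star_term (cc : R) p m (u : W) phi psi (a d : W) : 1 <= cc ->
  entire_fun phi -> entire_fun psi -> size a = p -> (m <= size d + size u)%N ->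
  nu cc (elem (fun g => phi g * lw a psi g) (gutt_coef d u m)) <=
  (qn (wtc r * cc) phi * qn (wtc (r - 1) * (wtc r * cc)) psi) *
  (p`!%:R * ((wtc r' ^+ 2 * (cc * K)) ^+ (size d + size u) *
    (wt r' (size d) * wt r' (size u)))).
Proof.
move=> c1 pE sE ap md; have c0 : 0 <= cc by lra.
have A1 : 1 <= wtc r by exact: wtc1.
have lE : entire_fun (lw a psi) by exact: entire_word.
apply: (le_trans (nu_elem_symk c0 _ (gutt_coef_symk d u m))); first exact: entireM.
set t := (size d + size u)%N in md *.
have w0 : 0 <= wtc r' by exact: wtc_ge0.
have wt1' : 1 <= wtc r' by exact: wtc1.
rewrite [leRHS]mulrA; apply: ler_pM; first exact: qn_ge0.
- by rewrite !mulr_ge0 ?wt_ge0 ?exprn_ge0 ?l1_ge0.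
- apply: (le_trans (qnM c_atlas c_unit r0 pE lE c0)).
  rewrite -mulrA ler_wpM2l ?qn_ge0 ?mulr_ge0 ?wtc_ge0// [leRHS]mulrC.
  apply: (le_trans (qn_word c_atlas c_unit _ sE _)); first by rewrite mulr_ege1.
  have q0 : 0 <= qn (wtc (r - 1) * (wtc r * cc)) psi by rewrite qn_ge0 ?mulr_ge0 ?wtc_ge0.
  by rewrite ap ler_wpM2r// -wt1; apply: wt_mono; rewrite gerBl.
apply: (@le_trans _ _ (wt r' (t - m) * (cc ^+ t * (K ^+ t * wt r' m)))).
  rewrite -[leLHS]mulrA; apply: ler_wpM2l; first exact: wt_ge0.
  apply: ler_pM; rewrite ?exprn_ge0 ?l1_ge0//.
    by apply: ler_weXn2l => //; exact: leq_subr.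
  apply: (le_trans (l1_gutt_coef d u m)); apply: ler_wpM2l.
    by rewrite exprn_ge0// (le_trans ler01).
  by rewrite -wt1; exact: wt_mono.
have K0 : 0 <= K := le_trans ler01 K1.
rewrite (_ : wt r' (t - m) * _ = (cc * K) ^+ t * (wt r' (t - m) * wt r' m)); last first.
  by rewrite exprMn; ring.
rewrite [(wtc r' ^+ 2 * _) ^+ t](_ : _ = (cc * K) ^+ t * (wtc r' ^+ t * wtc r' ^+ t)); last first.
  by rewrite exprMn expr2 [(wtc r' * _) ^+ t]exprMn mulrC.
rewrite -[leRHS]mulrA; apply: ler_wpM2l; first by rewrite exprn_ge0 ?mulr_ge0.
apply: (le_trans (wt_mul_le _ _ _)); rewrite subnK// -[leRHS]mulrA.
apply: ler_wpM2l; first by rewrite exprn_ge0.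
exact: wt_add_le.
Qed.

(** The sum over permutations has ['C(s, p) * p! * (s - p)!] terms for [s = size w], and the
    denominator cancels the factorials. The [p!] caused by the derivatives is at most [p!^r'] and
    merges with [(s - p)!^r'] into [s!^r']. *)
Lemma nu_star_coef_gen (T cc : R) b (w u : W) phi psi : 1 <= T -> 1 <= cc ->
  entire_fun phi -> entire_fun psi ->
  T ^+ b * nu cc (star_coef_gen b w u phi psi) <=
  (wt r' (size w) * star_rate T cc ^+ size w * qn (star_rate T cc) phi) *
  (wt r' (size u) * star_rate T cc ^+ size u * qn (star_rate T cc) psi).
Proof.
move=> T1 c1 pE sE; set M := star_rate T cc.
have c0 : 0 <= cc := le_trans ler01 c1.
have T0 : 0 <= T := le_trans ler01 T1.
have K0 : 0 <= K := le_trans ler01 K1.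
have w1 : 1 <= wtc r' := wtc1 _; have w0 : 0 <= wtc r' := wtc_ge0 _.
have a1 : 1 <= wtc r := wtc1 _; have a0 : 0 <= wtc r := wtc_ge0 _.
have d1 : 1 <= wtc (r - 1) := wtc1 _; have d0 : 0 <= wtc (r - 1) := wtc_ge0 _.
pose L := wtc r' ^+ 2 * (cc * K).
have L1 : 1 <= L by rewrite !mulr_ege1 ?exprn_ege1.
have L0 : 0 <= L := le_trans ler01 L1.
have F1 : 1 <= T * 4 * wtc r' by rewrite !mulr_ege1// ler1n.
have ME : M = (T * 4 * wtc r') * L * (wtc r * wtc (r - 1)).
  by rewrite /M /star_rate /L; ring.
have LM : T * 4 * wtc r' * L <= M by rewrite ME ler_peMr ?mulr_ege1// !mulr_ge0.
have ccM : wtc (r - 1) * (wtc r * cc) <= M.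
  rewrite (_ : M = (wtc (r - 1) * (wtc r * cc)) * (T * 4 * wtc r' * wtc r' ^+ 2 * K)); last first.
    by rewrite ME /L; ring.
  by rewrite ler_peMr ?mulr_ge0// !mulr_ege1// ?exprn_ege1// ler1n.
have ccM' : wtc r * cc <= M by apply: le_trans ccM; rewrite ler_peMl// mulr_ge0.
have M0 : 0 <= M by apply: le_trans ccM'; rewrite mulr_ge0.
have rhs0 : 0 <= wt r' (size w) * M ^+ size w * qn M phi *
    (wt r' (size u) * M ^+ size u * qn M psi).
  by rewrite !mulr_ge0 ?wt_ge0 ?exprn_ge0 ?qn_ge0.
have [bwu|wub] := leqP b (size w + size u); last first.
  by rewrite star_coef_gen_high// nu0// mulr0.
set s := size w in bwu rhs0 *; set t := size u in bwu rhs0 *.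
pose X := qn M phi * qn M psi * (L ^+ (s + t) * (wtc r' ^+ s * 2 ^+ s * wt r' s * wt r' t)).
have X0 : 0 <= X by rewrite !mulr_ge0 ?wt_ge0 ?exprn_ge0 ?qn_ge0.
have qq : qn (wtc r * cc) phi * qn (wtc (r - 1) * (wtc r * cc)) psi <= qn M phi * qn M psi.
  by apply: ler_pM; rewrite ?qn_ge0 ?mulr_ge0//; apply: qn_mono; rewrite ?mulr_ge0.
have A0 : 0 <= qn (wtc r * cc) phi * qn (wtc (r - 1) * (wtc r * cc)) psi.
  by rewrite mulr_ge0 ?qn_ge0 ?mulr_ge0.
have Sy (p : nat) (x : 'S_(size w)) :
    sym_pol (elem (fun g => phi g * lw (take p (permute x)) psi g)
                  (gutt_coef (drop p (permute x)) u (b - p))).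
  apply: sym_pol_elem => //; last exact: symk_is_sym (gutt_coef_symk _ _ _).
  by apply: entireM => //; exact: entire_word.
have term (p : 'I_s.+1) : (p <= b)%N ->
  nu cc ((('i%C ^- b : R[i]) / (p`! * (s - p)`!)%:R) *: \sum_(x : 'S_(size w))
      elem (fun g => phi g * lw (take p (permute x)) psi g)
           (gutt_coef (drop p (permute x)) u (b - p))) <= X.
  move=> pb; have ps : (p <= s)%N by rewrite -ltnS.
  apply: (le_trans (nuZ_le c_atlas c_unit r' _ c0 (sym_pol_sum c_atlas c_unit _ (fun x _ => Sy p x)))).
  have -> : cn ('i%C ^- b / (p`! * (s - p)`!)%:R) = ((p`! * (s - p)`!)%:R : R)^-1.
    rewrite cnM !cnV cnX cn_nat (_ : cn 'i%C = 1) ?expr1n ?invr1 ?mul1r//.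
    by rewrite /Normc.normc expr0n/= add0r expr1n sqrtr1.
  have f0 : (0 : R) < (p`! * (s - p)`!)%:R by rewrite ltr0n muln_gt0 !fact_gt0.
  rewrite ler_pdivrMl//.
  apply: (le_trans (nu_sum c_atlas c_unit r' _ c0 (fun x _ => Sy p x))).
  pose Y := qn M phi * qn M psi * (p`!%:R * (L ^+ (s + t) * (wt r' (s - p) * wt r' t))).
  apply: (@le_trans _ _ (\sum_(x : 'S_(size w)) Y)).
    apply: ler_sum => x _.
    have sd : size (drop p (permute x)) = (s - p)%N by rewrite size_drop size_permute.
    have [bst|stb] := leqP (b - p) (s - p + t); last first.
      rewrite /gutt_coef sd ifF ?elem0 ?nu0//; last by apply/negbTE; rewrite -ltnNge.
      by rewrite !mulr_ge0 ?wt_ge0 ?exprn_ge0 ?qn_ge0.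
    apply: (le_trans (nu_star_term c1 pE sE (p := p) _ _)).
    - by rewrite size_takel// size_permute.
    - by rewrite sd.
    rewrite sd -/L -/t; apply: ler_pM => //.
      by rewrite !mulr_ge0 ?wt_ge0 ?exprn_ge0.
    rewrite ler_wpM2l// ler_wpM2r ?mulr_ge0 ?wt_ge0//.
    by apply: ler_weXn2l => //; rewrite leq_add2r leq_subr.
  rewrite sumr_const card_Sn -/s -[leLHS]mulr_natl.
  rewrite (_ : (s`!%:R : R) = 'C(s, p)%:R * (p`! * (s - p)`!)%:R); last first.
    by rewrite -natrM bin_fact.
  rewrite mulrAC [leLHS]mulrC ler_pM2l// /Y /X mulrCA.
  rewrite ler_wpM2l ?mulr_ge0 ?qn_ge0//.
  rewrite (_ : 'C(s, p)%:R * _ = L ^+ (s + t) * ('C(s, p)%:R * (p`!%:R * wt r' (s - p)) * wt r' t)); last by ring.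
  rewrite ler_wpM2l ?exprn_ge0// ler_wpM2r ?wt_ge0//.
  rewrite [wtc r' ^+ s * _]mulrC -mulrA; apply: ler_pM => //.
  - by rewrite mulr_ge0 ?wt_ge0.
  - by rewrite -natrX ler_nat bin_le_pow2.
  have := wt_mul_le r' p (s - p); rewrite subnKC//; apply: le_trans.
  by rewrite ler_wpM2r ?wt_ge0// -wt1; exact: wt_mono.
have nuX : nu cc (star_coef_gen b w u phi psi) <= 2 ^+ s * X.
  apply: (le_trans (nu_sum c_atlas c_unit r' _ c0 _)).
    by move=> p _; apply: sym_polZ => //; apply: sym_pol_sum.
  apply: (@le_trans _ _ (\sum_(p < s.+1) X)).
    rewrite big_mkcond; apply: ler_sum => p _; case: ifP => // pb.
    exact: term.
  rewrite sumr_const card_ord -[leLHS]mulr_natl ler_wpM2r// -natrX ler_nat.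
  exact: ltn_expl.
(* As [b <= s + t], the factor [T ^ b] is absorbed by the geometric weights of the two degrees. *)
apply: (@le_trans _ _ (T ^+ (s + t) * (2 ^+ s * X))).
  apply: ler_pM => //; rewrite ?exprn_ge0 ?nu_ge0//; exact: ler_weXn2l.
rewrite (_ : wt r' s * _ * _ * _ = M ^+ (s + t) * (qn M phi * qn M psi * (wt r' s * wt r' t))); last first.
  by rewrite exprD; ring.
rewrite /X (_ : T ^+ (s + t) * _ = (T ^+ (s + t) * (2 ^+ s * 2 ^+ s) * wtc r' ^+ s * L ^+ (s + t)) *
  (qn M phi * qn M psi * (wt r' s * wt r' t))); last by ring.
rewrite ler_wpM2r ?mulr_ge0 ?qn_ge0 ?wt_ge0//.
apply: (@le_trans _ _ ((T * 4 * wtc r' * L) ^+ (s + t))); last first.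
  by rewrite lerXn2r ?nnegrE ?mulr_ge0.
rewrite [(T * 4 * wtc r' * L) ^+ _]exprMn [(T * 4 * wtc r') ^+ _]exprMn [(T * 4) ^+ _]exprMn.
rewrite ler_wpM2r ?exprn_ge0// -[2 ^+ s * 2 ^+ s]exprMn.
have -> : (2 * 2 : R) = 4 by ring.
apply: ler_pM; rewrite ?mulr_ge0 ?exprn_ge0//.
  by rewrite ler_wpM2l ?exprn_ge0// ler_weXn2l ?ler1n ?leq_addr.
by rewrite ler_weXn2l ?leq_addr.
Qed.

Lemma nu_star_coef (T cc : R) b P Q : 1 <= T -> 1 <= cc -> sym_pol P -> sym_pol Q ->
  T ^+ b * nu cc (star_coef b P Q) <= nu (star_rate T cc) P * nu (star_rate T cc) Q.
Proof.
move=> T1 c1 [[D PD] _ PE] [[E QE] _ Qe]; set M := star_rate T cc.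
have c0 : 0 <= cc := le_trans ler01 c1.
have T0 : 0 <= T := le_trans ler01 T1.
have K0 : 0 <= K := le_trans ler01 K1.
have M0 : 0 <= M by rewrite !mulr_ge0 ?exprn_ge0 ?wtc_ge0.
have Sg w u : sym_pol (star_coef_gen b w u (P w) (Q u)).
  apply: sym_pol_sum => // p _; apply: sym_polZ => //.
  apply: sym_pol_sum => // s _; apply: sym_pol_elem => //.
    by apply: entireM => //; exact: entire_word.
  exact: symk_is_sym (gutt_coef_symk _ _ _).
have Su w k : sym_pol (wsum k (fun u => star_coef_gen b w u (P w) (Q u))).
  by apply: sym_pol_wsum.
have Sw w : sym_pol (\sum_(l < E) wsum l (fun u => star_coef_gen b w u (P w) (Q u))).
  by apply: sym_pol_sum.
have E' k (F : W -> R) : wt r' k * M ^+ k * wsum k F =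
    wsum k (fun w => wt r' (size w) * M ^+ size w * F w).
  by rewrite -wsum_mull; apply: eq_wsum => w ->.
rewrite (star_coefE b PD QE) (nuE _ _ _ _ M0 PD) (nuE _ _ _ _ M0 QE).
rewrite mulr_suml; apply: (le_trans (ler_wpM2l _ (nu_sum c_atlas c_unit r' _ c0 _))).
- by rewrite exprn_ge0.
- by move=> k _; apply: sym_pol_wsum.
rewrite mulr_sumr; apply: ler_sum => k _.
apply: (le_trans (ler_wpM2l _ (nu_wsum c_atlas c_unit r' c0 _))); rewrite ?exprn_ge0//.
rewrite E' -wsum_mull -wsum_mulr; apply: ler_wsum => w _.
apply: (le_trans (ler_wpM2l _ (nu_sum c_atlas c_unit r' _ c0 _))); rewrite ?exprn_ge0//.
rewrite !mulr_sumr; apply: ler_sum => l _.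
apply: (le_trans (ler_wpM2l _ (nu_wsum c_atlas c_unit r' c0 _))); rewrite ?exprn_ge0//.
rewrite E' -!wsum_mull; apply: ler_wsum => u _.
exact: nu_star_coef_gen.
Qed.


End Bounds.
End StarProduct.

(** * Families of operators graded by powers of the deformation parameter *)

Section GradedFamilies.
Context (R : realType) (n : nat) (G : lieGroupType R n).
Context (c : chart R n G) (c_atlas : lie_atlas c) (c_unit : cdom c 1%g).
Context (B : 'M[R]_n) (r r' : R).
Local Notation C := (R[i]^o).
Local Notation W := (seq 'I_n).
Local Notation cn := (@Normc.normc R).
Local Notation nu := (nu c B r r').
Local Notation nuN := (nuN c B r r').
Local Notation sym_pol := (sym_pol c B r).
Implicit Types (P Q : pol G) (h : R[i]) (m : nat -> pol G).

Definition sym_linear (f : pol G -> pol G) := forall (a : R[i]) P Q,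
  sym_pol P -> sym_pol Q -> f (a *: P + Q) = a *: f P + f Q.

(** Coefficients of a power series in [hbar] whose values are operators. [N'] is chosen before [k]:
    measured by one norm, the coefficients decay faster than every geometric sequence. *)
Record linear_family (F : nat -> pol G -> pol G) : Prop := {
  lf_sym : forall k P, sym_pol P -> sym_pol (F k P);
  lf_linear : forall k, sym_linear (F k);
  lf_bound : forall N (T : R), 1 <= T -> exists N', forall k P, sym_pol P ->
    T ^+ k * nuN N (F k P) <= nuN N' P;
  lf_finite : forall P, sym_pol P -> exists D, forall k, (D <= k)%N -> F k P = 0
}.

Record bilinear_family (M : nat -> pol G -> pol G -> pol G) : Prop := {
  bf_sym : forall k P Q, sym_pol P -> sym_pol Q -> sym_pol (M k P Q);
  bf_linearr : forall k P, sym_pol P -> sym_linear (M k P);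
  bf_linearl : forall k Q, sym_pol Q -> sym_linear (M k ^~ Q);
  bf_bound : forall N (T : R), 1 <= T -> exists N', forall k P Q, sym_pol P -> sym_pol Q ->
    T ^+ k * nuN N (M k P Q) <= nuN N' P * nuN N' Q;
  bf_finite : forall P Q, sym_pol P -> sym_pol Q ->
    exists D, forall k, (D <= k)%N -> M k P Q = 0
}.

Lemma nuN_ge0 N P : 0 <= nuN N P.
Proof. exact: nu_ge0. Qed.

Lemma nuN_mono N N' P : sym_pol P -> (N <= N')%N -> nuN N P <= nuN N' P.
Proof. by move=> PS NN; apply: nu_mono => //; rewrite ler_nat. Qed.

Lemma sym_linear0 f : sym_linear f -> f 0 = 0.
Proof.
move=> fl; have := fl (-1) 0 0 (sym_pol0 c B r) (sym_pol0 c B r).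
by rewrite scaler0 addr0 scaleN1r addNr.
Qed.

Lemma sym_linear_sum f h m D : sym_linear f -> (forall k, sym_pol (m k)) ->
  f (\sum_(k < D) h ^+ k *: m k) = \sum_(k < D) h ^+ k *: f (m k).
Proof.
move=> fl mS; elim: D => [|D IH]; first by rewrite !big_ord0 sym_linear0.
rewrite !big_ord_recr /= addrC fl//; first by rewrite IH addrC.
by apply: sym_pol_sum => // k _; exact: sym_polZ.
Qed.

(** A relation, since the degree [D] at which the series stops depends on the element and is not
    canonical. *)
Definition evals m h (X : pol G) := exists D,
  (forall k, (D <= k)%N -> m k = 0) /\ X = \sum_(k < D) h ^+ k *: m k.

Lemma sum_finite m h D E : (forall k, (D <= k)%N -> m k = 0) -> (D <= E)%N ->
  \sum_(k < E) h ^+ k *: m k = \sum_(k < D) h ^+ k *: m k.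
Proof.
move=> mD /subnKC <-; rewrite big_split_ord /= [X in _ + X]big1 ?addr0// => i _.
by rewrite mD ?scaler0// leq_addr.
Qed.

Lemma evals_widen m h X D : (forall k, (D <= k)%N -> m k = 0) -> evals m h X ->
  X = \sum_(k < D) h ^+ k *: m k.
Proof.
move=> mD [E [mE ->]]; rewrite -(sum_finite _ mD (leq_maxl D E)).
by rewrite -(sum_finite _ mE (leq_maxr D E)).
Qed.

(** Coefficient of [hbar ^ k] when a series of operators is applied to a series in the same
    parameter. *)
Definition cauchy_prod (Op : nat -> pol G -> pol G) m k : pol G :=
  \sum_(b < k.+1) Op b (m (k - b)%N).

Lemma uniform_vanish (Op : nat -> pol G -> pol G) m D : (forall b, sym_linear (Op b)) ->
  (forall k, sym_pol (m k)) -> (forall k, (D <= k)%N -> m k = 0) ->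
  (forall Y, sym_pol Y -> exists E, forall b, (E <= b)%N -> Op b Y = 0) ->
  exists E, forall b k, (E <= b)%N -> Op b (m k) = 0.
Proof.
move=> Ol mS mD Of.
suff [E HE] : exists E, forall b k, (E <= b)%N -> (k < D)%N -> Op b (m k) = 0.
  exists E => b k Eb; have [kD|/mD ->] := ltnP k D; first exact: HE.
  exact: sym_linear0.
elim: D {mD} => [|D [E HE]]; first by exists 0%N.
have [E' HE'] := Of _ (mS D); exists (maxn E E') => b k; rewrite geq_max => /andP[Eb E'b].
rewrite ltnS leq_eqVlt => /predU1P[->|kD]; [exact: HE'|exact: HE].
Qed.

Lemma cauchy_finite (Op : nat -> pol G -> pol G) m : (forall b, sym_linear (Op b)) ->
  (forall k, sym_pol (m k)) -> (exists D, forall k, (D <= k)%N -> m k = 0) ->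
  (forall Y, sym_pol Y -> exists E, forall b, (E <= b)%N -> Op b Y = 0) ->
  exists D, forall k, (D <= k)%N -> cauchy_prod Op m k = 0.
Proof.
move=> Ol mS [D mD] Of; have [E HE] := uniform_vanish Ol mS mD Of.
exists (E + D)%N => k EDk; apply: big1 => b _.
have [Eb|bE] := leqP E b; first exact: HE.
by rewrite mD ?(sym_linear0 (Ol b))//; lia.
Qed.

(** The inner series is finite, so the operators act on it term by term, and the double sum can be
    sorted by the total power of [h]. *)
Lemma evals_cauchy (Op : nat -> pol G -> pol G) m h X Z : (forall b, sym_linear (Op b)) ->
  (forall k, sym_pol (m k)) ->
  (forall Y, sym_pol Y -> exists E, forall b, (E <= b)%N -> Op b Y = 0) ->
  evals m h X -> evals (Op ^~ X) h Z -> evals (cauchy_prod Op m) h Z.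
Proof.
move=> Ol mS Of mX OZ; have [D [mD XE]] := mX.
have [E HE] := uniform_vanish Ol mS mD Of.
have OX b : Op b X = \sum_(k < D) h ^+ k *: Op b (m k).
  by rewrite XE sym_linear_sum.
have OE b : (E <= b)%N -> Op b X = 0.
  by move=> Eb; rewrite OX big1// => k _; rewrite HE ?scaler0.
exists (E + D)%N; split.
  move=> k EDk; apply: big1 => b _.
  have [Eb|bE] := leqP E b; first exact: HE.
  by rewrite mD ?(sym_linear0 (Ol b))//; lia.
rewrite (evals_widen OE OZ).
transitivity (\sum_(k < E + D) \sum_(b < k.+1) h ^+ (b + (k - b)) *: Op b (m (k - b)%N)).
  rewrite (big_triangle (fun b k => h ^+ (b + k) *: Op b (m k))) big_split_ord /=.
  rewrite [X in _ = _ + X]big1 ?addr0 => [|b _]; last first.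
    by apply: big1 => k _; rewrite HE ?scaler0// leq_addr.
  apply: eq_bigr => b _; rewrite OX scaler_sumr.
  have -> : (E + D - b = D + (E - b))%N by have := ltn_ord b; lia.
  rewrite big_split_ord /= [X in _ = _ + X]big1 ?addr0 => [|k _].
    by apply: eq_bigr => k _; rewrite scalerA exprD.
  by rewrite mD ?leq_addr// (sym_linear0 (Ol b)) scaler0.
apply: eq_bigr => k _; rewrite scaler_sumr; apply: eq_bigr => b _.
by rewrite subnKC// -ltnS.
Qed.

(** The [k.+1 <= 2 ^ k] terms of a Cauchy product are paid for by using the factors at [2 * T]; this
    is possible because [T] is free. *)
Lemma cauchy_bound (T K : R) k (x : 'I_k.+1 -> R) : 1 <= T -> 0 <= K ->
  (forall b, (2 * T) ^+ k * x b <= K) -> T ^+ k * \sum_b x b <= K.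
Proof.
move=> T1 K0 H; have T0 : 0 < T := lt_le_trans ltr01 T1.
have p0 : 0 < (2 : R) ^+ k by rewrite exprn_gt0.
rewrite -(ler_pM2l p0) mulrA -exprMn mulr_sumr.
apply: (@le_trans _ _ (\sum_(b < k.+1) K)); first exact: ler_sum.
rewrite sumr_const card_ord -[leLHS]mulr_natl ler_wpM2r// -natrX ler_nat.
exact: ltn_expl.
Qed.

Lemma linear_sum_family (I : Type) (s : seq I) (f : I -> pol G -> pol G) :
  (forall i, sym_linear (f i)) -> sym_linear (fun P => \sum_(i <- s) f i P).
Proof.
move=> fl a P Q PS QS; rewrite scaler_sumr -big_split; apply: eq_bigr => i _.
exact: fl.
Qed.

Lemma bilinear_flip M : bilinear_family M -> bilinear_family (fun k P Q => M k Q P).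
Proof.
move=> [s lr ll b f]; split=> //.
- by move=> k P Q PS QS; exact: s.
- move=> N T T1; have [N' HN] := b N T T1; exists N' => k P Q PS QS.
  by rewrite mulrC -[leLHS]mulrC [leRHS]mulrC; exact: HN.
- by move=> P Q PS QS; exact: f.
Qed.

Lemma cauchy_right M F : bilinear_family M -> linear_family F ->
  bilinear_family (fun k P Q => cauchy_prod (M ^~ P) (F ^~ Q) k).
Proof.
move=> Mf Ff; split.
- move=> k P Q PS QS; apply: sym_pol_sum => // b _.
  by apply: (bf_sym Mf) => //; exact: (lf_sym Ff).
- move=> k P PS; apply: linear_sum_family => b a Q Q' QS QS'.
  by rewrite (lf_linear Ff)// (bf_linearr Mf)//; exact: (lf_sym Ff).
- move=> k Q QS; apply: linear_sum_family => b a P P' PS PS'.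
  by rewrite (bf_linearl Mf)//; exact: (lf_sym Ff).
- move=> N T T1; have T2 : 1 <= 2 * T by rewrite mulr_ege1// ler1n.
  have T0 : 0 <= 2 * T := le_trans ler01 T2.
  have [N1 H1] := bf_bound Mf N T2; have [N2 H2] := lf_bound Ff N1 T2.
  exists (maxn N1 N2) => k P Q PS QS.
  have S b d : sym_pol (M b P (F d Q)) by apply: (bf_sym Mf) => //; exact: (lf_sym Ff).
  apply: (@le_trans _ _ (T ^+ k * \sum_(b < k.+1) nuN N (M b P (F (k - b)%N Q)))).
    by rewrite ler_wpM2l ?exprn_ge0 ?(le_trans ler01 T1)//; apply: nu_sum.
  apply: cauchy_bound => // [|[b /= bk]]; first by rewrite mulr_ge0 ?nuN_ge0.
  rewrite ltnS in bk.
  rewrite -{1}(subnKC bk) exprD mulrAC.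
  have FS := lf_sym Ff (k - b) QS.
  apply: (le_trans (ler_wpM2r _ (H1 b _ _ PS FS))); first exact: exprn_ge0.
  rewrite -mulrA [_ * (2 * T) ^+ _]mulrC.
  apply: (le_trans (ler_wpM2l _ (H2 _ _ QS))); first exact: nuN_ge0.
  by rewrite ler_pM ?nuN_ge0// nuN_mono// ?leq_maxl ?leq_maxr.
- move=> P Q PS QS; apply: cauchy_finite.
  + by move=> b; exact: (bf_linearr Mf).
  + by move=> k; exact: (lf_sym Ff).
  + exact: (lf_finite Ff).
  + by move=> Y; exact: (bf_finite Mf).
Qed.

Lemma cauchy_left M F : bilinear_family M -> linear_family F ->
  bilinear_family (fun k P Q => cauchy_prod (fun b X => M b X Q) (F ^~ P) k).
Proof.
by move=> Mf Ff; exact: (bilinear_flip (cauchy_right (bilinear_flip Mf) Ff)).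
Qed.

Lemma cauchy_outer M F : bilinear_family M -> linear_family F ->
  bilinear_family (fun k P Q => cauchy_prod F (fun d => M d P Q) k).
Proof.
move=> Mf Ff; split.
- move=> k P Q PS QS; apply: sym_pol_sum => // b _.
  by apply: (lf_sym Ff); exact: (bf_sym Mf).
- move=> k P PS; apply: linear_sum_family => b a Q Q' QS QS'.
  by rewrite (bf_linearr Mf)// (lf_linear Ff)//; exact: (bf_sym Mf).
- move=> k Q QS; apply: linear_sum_family => b a P P' PS PS'.
  by rewrite (bf_linearl Mf)// (lf_linear Ff)//; exact: (bf_sym Mf).
- move=> N T T1; have T2 : 1 <= 2 * T by rewrite mulr_ege1// ler1n.
  have T0 : 0 <= 2 * T := le_trans ler01 T2.
  have [N1 H1] := lf_bound Ff N T2; have [N2 H2] := bf_bound Mf N1 T2.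
  exists N2 => k P Q PS QS.
  have S b d : sym_pol (F b (M d P Q)) by apply: (lf_sym Ff); exact: (bf_sym Mf).
  apply: (@le_trans _ _ (T ^+ k * \sum_(b < k.+1) nuN N (F b (M (k - b)%N P Q)))).
    by rewrite ler_wpM2l ?exprn_ge0 ?(le_trans ler01 T1)//; apply: nu_sum.
  apply: cauchy_bound => // [|[b /= bk]]; first by rewrite mulr_ge0 ?nuN_ge0.
  rewrite ltnS in bk.
  rewrite -{1}(subnKC bk) exprD mulrAC.
  have MS := bf_sym Mf (k - b) PS QS.
  apply: (le_trans (ler_wpM2r _ (H1 b _ MS))); first exact: exprn_ge0.
  by rewrite mulrC; exact: H2.
- move=> P Q PS QS; apply: cauchy_finite.
  + exact: (lf_linear Ff).
  + by move=> k; exact: (bf_sym Mf).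
  + exact: (bf_finite Mf).
  + exact: (lf_finite Ff).
Qed.

Lemma nat_ge (x : R) : 0 <= x -> exists N : nat, x <= N.+1%:R.
Proof. by move=> x0; exists (Num.trunc x); have /andP[_ /ltW] := truncn_itv x0. Qed.

Section NeumaierFamily.
Hypothesis rr : 1 <= r + r'.
Context (kappa : R).

Definition neumaier_term l P : pol G :=
  ((- ('i%C * kappa%:C%C)) ^+ l / l`!%:R : R[i]) *: Delta_pow c B l P.

Lemma neumaier_coefE h l :
  neumaier_coef kappa h l = h ^+ l * ((- ('i%C * kappa%:C%C)) ^+ l / l`!%:R).
Proof. by rewrite /neumaier_coef mulrA; congr (_ / _); rewrite -exprMn; congr (_ ^+ _); ring. Qed.

Lemma Delta_pow_high l D P : degree_lt D P -> (D <= l)%N -> Delta_pow c B l P = 0.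
Proof.
move=> PD Dl; apply/funext => u; rewrite /Delta_pow wsum_eq0 ?scaler0// => a al.
by rewrite PD ?lie_word_cst0// size_cat al (leq_trans Dl)// leq_addr.
Qed.

Lemma neumaier_evals h P : sym_pol P ->
  evals (neumaier_term ^~ P) h (neumaier c B kappa h P).
Proof.
move=> PS; have [[D PD] _ _] := PS; exists D; split.
  by move=> l Dl; rewrite /neumaier_term (Delta_pow_high PD Dl) scaler0.
rewrite /neumaier; under eq_fsbigr do rewrite (iter_DeltaE c_atlas c_unit _ PS).
rewrite -(fsbig_widen `I_D setT) => [||l [_ /= lD]] //.
  rewrite -fsbig_ord; apply: eq_bigr => l _.
  by rewrite neumaier_coefE /neumaier_term scalerA.
by rewrite (Delta_pow_high PD) ?scaler0// leqNgt; apply/negP.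
Qed.

Lemma neumaier_family : linear_family neumaier_term.
Proof.
split.
- by move=> l P PS; apply: sym_polZ => //; exact: sym_Delta_pow.
- move=> l a P Q PS QS; rewrite /neumaier_term (Delta_pow_linear c_atlas c_unit _ _ PS QS).
  by rewrite scalerDr !scalerA mulrC.
(* The powers of [kappa] are absorbed in the free geometric factor. *)
- move=> N T T1; pose T' := T * (1 + `|kappa|).
  have k1 : 1 <= 1 + `|kappa| by rewrite lerDl.
  have T'1 : 1 <= T' by rewrite mulr_ege1.
  have T0 : 0 <= T := le_trans ler01 T1.
  pose M := T' * 2 * wtc r' * wtc (r - 1) * N.+1%:R.
  have M0 : 0 <= M by rewrite !mulr_ge0 ?wtc_ge0// (le_trans ler01).
  have [N' HN'] := nat_ge M0; exists N' => l P PS.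
  have DS : sym_pol ((l`!%:R : R[i])^-1 *: Delta_pow c B l P).
    by apply: sym_polZ => //; exact: sym_Delta_pow.
  apply: (@le_trans _ _ (T' ^+ l * nuN N ((l`!%:R : R[i])^-1 *: Delta_pow c B l P))).
    rewrite /T' exprMn -mulrA ler_wpM2l ?exprn_ge0// /neumaier_term -scalerA.
    apply: (le_trans (nuZ_le c_atlas c_unit r' _ _ DS)) => //.
    rewrite ler_wpM2r ?nuN_ge0// cnX lerXn2r ?nnegrE ?cn_ge0//.
    rewrite cnN cnM cn_real (_ : cn 'i%C = 1) ?mul1r ?lerDr//.
    by rewrite /Normc.normc expr0n/= add0r expr1n sqrtr1.
  have N1 : 1 <= N.+1%:R :> R by rewrite ler1n.
  apply: (le_trans (nu_Delta_pow c_atlas c_unit l rr T'1 N1 PS)).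
  by apply: nu_mono.
- move=> P [[D PD] _ _]; exists D => l Dl.
  by rewrite /neumaier_term (Delta_pow_high PD Dl) scaler0.
Qed.

End NeumaierFamily.

Lemma sym_evals m h X : (forall k, sym_pol (m k)) -> evals m h X -> sym_pol X.
Proof.
by move=> mS [D [_ ->]]; apply: sym_pol_sum => // k _; exact: sym_polZ.
Qed.

Section StarFamily.
Context (K : R) (Cn : W -> W -> nat -> W -> C) (K1 : 1 <= K).
Hypothesis CnP : forall a b : W,
  [/\ forall k, (k <= size a + size b)%N -> symk (size a + size b - k) (Cn a b k),
      forall k, (k <= size a + size b)%N ->
        l1 (size a + size b - k) (Cn a b k) <= K ^+ (size a + size b) * k`!%:R
    & forall z : C, gutt (structure_const c B) z (vee R a) (vee R b) =
        \sum_(k < (size a + size b).+1) z ^+ k *: Cn a b k].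
Hypotheses (r0 : 0 <= r) (r'1 : 1 <= r').

Lemma star_coef_family : bilinear_family (star_coef c B Cn).
Proof.
split.
- by move=> k P Q PS QS; exact: sym_star_coef.
- by move=> k P PS a Q Q' QS QS'; exact: (star_coef_linr c_atlas c_unit _ _ _ PS QS QS').
- by move=> k Q QS a P P' PS PS'; exact: (star_coef_linl _ _ _ PS PS' QS).
- move=> N T T1; have rate0 : 0 <= star_rate r r' K T N.+1%:R.
    by rewrite !mulr_ge0 ?exprn_ge0 ?wtc_ge0// (le_trans ler01).
  have [N' HN'] := nat_ge rate0; exists N' => k P Q PS QS.
  have N1 : 1 <= N.+1%:R :> R by rewrite ler1n.
  apply: (le_trans (nu_star_coef c_atlas c_unit K1 CnP r0 r'1 k T1 N1 PS QS)).
  by rewrite ler_pM ?nu_ge0//; apply: nu_mono.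
- move=> P Q [[D PD] _ _] [[E QE] _ _]; exists (D + E)%N => k Dk.
  by apply: star_coef_high PD QE Dk.
Qed.

Lemma star_evals h P Q : sym_pol P -> sym_pol Q ->
  evals (fun k => star_coef c B Cn k P Q) h (star_std c B h P Q).
Proof.
move=> [[D PD] _ _] [[E QE] _ _]; exists (D + E)%N; split.
  by move=> k Dk; apply: star_coef_high PD QE Dk.
exact: (star_stdE K1 CnP h PD QE).
Qed.

(** Three Cauchy products in the same [hbar]: the Neumaier series in each argument of the
    standard-ordered product, and the one for [- kappa] outside. *)
Lemma star_kappa_expansion kappa : exists2 M, bilinear_family M &
  forall h P Q, sym_pol P -> sym_pol Q ->
    evals (fun k => M k P Q) h (star_kappa c B kappa h P Q).
Proof.
have rr : 1 <= r + r' by rewrite -[1]add0r lerD.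
have Nf := neumaier_family rr kappa; have Nf' := neumaier_family rr (- kappa).
have Sf := star_coef_family.
have Rf := cauchy_right Sf Nf; have Lf := cauchy_left Rf Nf.
refine (ex_intro2 _ _ _ (cauchy_outer Lf Nf') _).
move=> h P Q PS QS; rewrite /star_kappa.
have NS X : sym_pol X -> sym_pol (neumaier c B kappa h X).
  move=> XS; apply: sym_evals (neumaier_evals kappa h XS) => k; exact: (lf_sym Nf).
have NP := NS _ PS; have NQ := NS _ QS.
have E1 := evals_cauchy (fun b => bf_linearr Sf b NP) (fun k => lf_sym Nf k QS)
  (fun Y YS => bf_finite Sf NP YS) (neumaier_evals kappa h QS) (star_evals h NP NQ).
have E2 := evals_cauchy (fun b => bf_linearl Rf b QS) (fun k => lf_sym Nf k PS)
  (fun Y YS => bf_finite Rf YS QS) (neumaier_evals kappa h PS) E1.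
have XS := sym_evals (fun k => bf_sym Lf k PS QS) E2.
exact: (evals_cauchy (lf_linear Nf') (fun k => bf_sym Lf k PS QS) (lf_finite Nf') E2
  (neumaier_evals (- kappa) h XS)).
Qed.

End StarFamily.
End GradedFamilies.

(** * Completions of seminormed spaces *)

Section SeminormedCompletion.
Context (R : realType) (V : lmodType R[i]) (S : V -> Prop) (p : nat -> V -> R).
Context (H : tvsType R[i]) (j : V -> H).
Local Notation cn := (@Normc.normc R).
Implicit Types (P Q : V) (x y : H) (N : nat).

(** What remains of the completion of Pol after the Lie group is forgotten: an increasing sequence
    of seminorms on [S] and a dense linear map inducing their topology. *)
Record seminormed_completion : Prop := {
  sc_lin : forall (a : R[i]) P Q, S P -> S Q -> S (a *: P + Q);
  sc_zero : S 0;
  sc_ge0 : forall N P, 0 <= p N P;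
  sc_triangle : forall N P Q, S P -> S Q -> p N (P + Q) <= p N P + p N Q;
  sc_scale : forall N (a : R[i]) P, S P -> p N (a *: P) <= cn a * p N P;
  sc_mono : forall N N' P, S P -> (N <= N')%N -> p N P <= p N' P;
  sc_hausdorff : hausdorff_space H;
  sc_complete : tvs_complete H;
  sc_linear : forall (a : R[i]) P Q, S P -> S Q -> j (a *: P + Q) = a *: j P + j Q;
  sc_embedding : forall P, S P -> forall A : set V,
    (exists N (e : R), 0 < e /\ forall Q, S Q -> p N (Q - P) < e -> A Q) <->
    exists2 U : set H, nbhs (j P) U & forall Q, S Q -> U (j Q) -> A Q;
  sc_dense : dense (j @` [set P | S P])
}.

Hypothesis X : seminormed_completion.

Lemma sc_add P Q : S P -> S Q -> S (P + Q).
Proof. by move=> PS QS; rewrite -[P]scale1r; exact: (sc_lin X). Qed.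

Lemma sc_scal (a : R[i]) P : S P -> S (a *: P).
Proof. by move=> PS; rewrite -[_ *: _]addr0; apply: (sc_lin X) => //; exact: (sc_zero X). Qed.

Lemma sc_sub P Q : S P -> S Q -> S (P - Q).
Proof. by move=> PS QS; rewrite -scaleN1r addrC; exact: (sc_lin X). Qed.

Lemma j0 : j 0 = 0.
Proof.
have := sc_linear X 1 (sc_zero X) (sc_zero X).
by rewrite scaler0 addr0 scale1r => /(congr1 (fun z => z - j 0)); rewrite subrr addrK => /esym.
Qed.

Lemma jZ a P : S P -> j (a *: P) = a *: j P.
Proof.
by move=> PS; have := sc_linear X a PS (sc_zero X); rewrite j0 !addr0.
Qed.

Lemma jD P Q : S P -> S Q -> j (P + Q) = j P + j Q.
Proof. by move=> PS QS; have := sc_linear X 1 PS QS; rewrite !scale1r. Qed.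

Lemma jB P Q : S P -> S Q -> j (P - Q) = j P - j Q.
Proof.
by move=> PS QS; have := sc_linear X (-1) QS PS; rewrite !scaleN1r addrC [in RHS]addrC.
Qed.

Lemma dense_nbhs x (U : set H) : nbhs x U -> exists2 P, S P & U (j P).
Proof.
move=> xU; have [|y [/interior_subset yU [P PS Py]]] := sc_dense X _ (open_interior U).
  by exists x; exact: nbhs_singleton (nbhs_interior xU).
by exists P => //; rewrite Py.
Qed.

Definition cball N (e : R) : set H := closure (j @` [set P | S P /\ p N P <= e]).

(** Some neighbourhood [U] of 0 meets the image of [S] only within the ball; by density each
    interior point of [U] is a limit of such points. *)
Lemma cball_nbhs N e : 0 < e -> nbhs 0 (cball N e).
Proof.
move=> e0; have [|U U0 HU] := (sc_embedding X (sc_zero X) [set P | p N P <= e]).1.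
  by exists N, e; split=> // Q _; rewrite subr0; exact: ltW.
rewrite j0 in U0; apply: filterS (nbhs_interior U0) => x Ux B xB.
have [P PS [UP BP]] := dense_nbhs (filterI Ux xB).
by exists (j P); split=> //; exists P => //; split=> //; exact: HU.
Qed.

(** [H] is regular: [U] contains the closure of a smaller neighbourhood, whose trace on [S] contains
    a ball. *)
Lemma cball_small (U : set H) : nbhs 0 U -> exists N e, 0 < e /\ cball N e `<=` U.
Proof.
move=> U0; have [A A0 AU] := @uniform_regular H 0 U U0.
have [|N [e [e0 HN]]] := (sc_embedding X (sc_zero X) (j @^-1` A)).2.
  by exists A; rewrite ?j0.
exists N, (e / 2); split; first by rewrite divr_gt0.
apply: subset_trans AU; apply: closureS => _ [P [PS Pe] <-].
by apply: HN => //; rewrite subr0 (le_lt_trans Pe)// ltr_pdivrMr// ltr_pMr// ltr1n.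
Qed.

Lemma cballD N e e' x y : cball N e x -> cball N e' y -> cball N (e + e') (x + y).
Proof.
move=> xe ye A; move=> /(add_continuous (x, y)) [[A1 A2] /= [xA1 yA2] A12].
have [_ [[P [PS Pe] <-] PA]] := xe A1 xA1.
have [_ [[Q [QS Qe] <-] QA]] := ye A2 yA2.
exists (j P + j Q); split; last exact: (A12 (j P, j Q)).
exists (P + Q); last exact: jD.
by split; [exact: sc_add|apply: (le_trans (sc_triangle X _ PS QS)); exact: lerD].
Qed.

Lemma scale_contl (a : R[i]) x (A : set H) : nbhs (a *: x) A -> nbhs x [set y | A (a *: y)].
Proof.
move=> /(@scale_continuous _ _ (a, x)) [[A1 A2] /= [aA1 xA2] A12].
apply: filterS xA2 => y yA2; apply: (A12 (a, y)); split=> //=.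
by case: aA1 => e e0; apply; rewrite /= subrr normr0.
Qed.

Lemma cballZ N e (a : R[i]) x : cball N e x -> cball N (cn a * e) (a *: x).
Proof.
move=> xe A /scale_contl /xe [_ [[P [PS Pe] <-] PA]].
exists (a *: j P); split=> //; exists (a *: P); last exact: jZ.
split; first exact: sc_scal.
by apply: (le_trans (sc_scale X _ a PS)); rewrite ler_wpM2l ?cn_ge0.
Qed.

Lemma cball_mono N N' e e' : (N <= N')%N -> e <= e' -> cball N' e `<=` cball N e'.
Proof.
move=> NN ee; apply: closureS => _ [P [PS Pe] <-]; exists P => //; split=> //.
exact: le_trans (sc_mono X PS NN) (le_trans Pe ee).
Qed.

Lemma cball_j N e P : S P -> p N P <= e -> cball N e (j P).
Proof. by move=> PS Pe; apply: subset_closure; exists P. Qed.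

(** Closing in [H] does not enlarge the balls of [S], because [H] induces on [S] the topology of the
    seminorms. *)
Lemma cball_jP N e P : S P -> cball N e (j P) -> p N P <= e.
Proof.
move=> PS jPe; apply/ler_addgt0Pr => d d0.
have [|U PU HU] := (sc_embedding X PS [set Q | p N (Q - P) < d]).1.
  by exists N, d; split.
have [_ [[Q [QS Qe] <-] /(HU _ QS) QP]] := jPe U PU.
have PE : P = (-1) *: (Q - P) + Q by rewrite scaleN1r opprB subrK.
rewrite PE; have QPS := sc_sub QS PS; apply: (le_trans (sc_triangle X _ (sc_scal _ QPS) QS)).
rewrite addrC lerD//; apply: (le_trans (sc_scale X _ _ QPS)).
by rewrite cnN Normc.normc1 mul1r ltW.
Qed.

(* Closures of the images of balls are a base of neighborhoods of 0 in [H], so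
   their gauges extend the seminorms [p N] and generate the topology. *)
Definition hn N x : R := inf [set e | 0 <= e /\ cball N e x].

Lemma hn_nonempty N x : [set e | 0 <= e /\ cball N e x] !=set0.
Proof.
have /(nbhsT x) xU := cball_nbhs N (@ltr01 R).
have [P PS [y y1 yP]] := dense_nbhs xU.
exists (cn (-1) * 1 + p N P); split; first by rewrite addr_ge0 ?mulr_ge0 ?cn_ge0 ?(sc_ge0 X).
have -> : x = (-1) *: y + j P by rewrite -yP scaleN1r addrCA addNr addr0.
by apply: cballD; [exact: cballZ|exact: cball_j].
Qed.

Lemma hn_le N e x : 0 <= e -> cball N e x -> hn N x <= e.
Proof. by move=> e0 xe; apply: ge_inf => //; exists 0 => d []. Qed.

Lemma hn_ltP N e x : hn N x < e -> cball N e x.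
Proof.
move=> /(inf_lt (hn_nonempty N x)) [d [_ xd] de].
by apply: cball_mono xd => //; exact: ltW.
Qed.

Lemma hn_ge0 N x : 0 <= hn N x.
Proof. by apply: lb_le_inf; [exact: hn_nonempty|move=> e []]. Qed.

Lemma hn_cball N e x : hn N x <= e -> forall d, 0 < d -> cball N (e + d) x.
Proof. by move=> xe d d0; apply: hn_ltP; rewrite (le_lt_trans xe)// ltrDl. Qed.

Lemma hnD N x y : hn N (x + y) <= hn N x + hn N y.
Proof.
apply/ler_addgt0Pr => d d0; have d2 : 0 < d / 2 by rewrite divr_gt0.
have -> : hn N x + hn N y + d = (hn N x + d / 2) + (hn N y + d / 2).
  by rewrite addrACA -splitr.
apply: hn_le; first by rewrite !addr_ge0 ?hn_ge0// ltW.
by apply: cballD; exact: hn_cball.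
Qed.

Lemma hnZ N a x : hn N (a *: x) <= cn a * hn N x.
Proof.
apply/ler_addgt0Pr => d d0; pose e := d / (cn a + 1).
have a1 : 0 < cn a + 1 by rewrite ltr_wpDl ?cn_ge0.
have e0 : 0 < e by rewrite divr_gt0.
apply: (@le_trans _ _ (cn a * (hn N x + e))).
  apply: hn_le; first by rewrite mulr_ge0 ?addr_ge0 ?cn_ge0 ?hn_ge0// ltW.
  by apply: cballZ; exact: hn_cball.
rewrite mulrDr lerD2l /e mulrCA ger_pMr// ler_pdivrMr// mul1r.
by rewrite lerDl.
Qed.

Lemma hn0 N : hn N 0 = 0.
Proof.
apply/eqP; rewrite eq_le hn_ge0 andbT -[X in hn _ X](scale0r (0 : H)).
by rewrite (le_trans (hnZ _ _ _))// cn0 mul0r.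
Qed.

Lemma hnN N x : hn N (- x) = hn N x.
Proof.
have le y : hn N (- y) <= hn N y.
  by rewrite -scaleN1r (le_trans (hnZ _ _ _))// cnN Normc.normc1 mul1r.
by apply/eqP; rewrite eq_le le -{1}[x]opprK le.
Qed.

Lemma hn_split N x y z : hn N (x - z) <= hn N (x - y) + hn N (y - z).
Proof. by rewrite -{1}(subrK y x) -addrA hnD. Qed.

Lemma hn_mono N N' x : (N <= N')%N -> hn N x <= hn N' x.
Proof.
move=> NN; apply: lb_le_inf; first exact: hn_nonempty.
by move=> e [e0 xe]; apply: hn_le => //; exact: cball_mono xe.
Qed.

Lemma hn_j N P : S P -> hn N (j P) = p N P.
Proof.
move=> PS; apply/eqP; rewrite eq_le; apply/andP; split.
  by apply: hn_le; [exact: (sc_ge0 X)|exact: cball_j].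
by apply: lb_le_inf; [exact: hn_nonempty|move=> e [_]; exact: cball_jP].
Qed.

Lemma hn_sum N (I : Type) (s : seq I) (f : I -> H) :
  hn N (\sum_(i <- s) f i) <= \sum_(i <- s) hn N (f i).
Proof.
elim: s => [|i s IH]; first by rewrite !big_nil hn0.
by rewrite !big_cons (le_trans (hnD _ _ _))// lerD2l.
Qed.

Lemma nbhs_hn x (U : set H) :
  nbhs x U <-> exists N e, 0 < e /\ forall y, hn N (y - x) < e -> U y.
Proof.
split=> [xU|[N [e [e0 HU]]]].
  have := nbhsB (- x) xU; rewrite addNr => /cball_small[N [e [e0 eU]]].
  exists N, e; split=> // y /hn_ltP/eU [z zU] /eqP.
  by rewrite addrC (inj_eq (addIr _)) => /eqP <-.
have e2 : 0 < e / 2 by rewrite divr_gt0.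
apply: filterS (nbhsT x (cball_nbhs N e2)) => _ [y ye <-].
apply: HU; rewrite addrC addKr (le_lt_trans (hn_le (ltW e2) ye))//.
by rewrite ltr_pdivrMr// ltr_pMr// ltr1n.
Qed.

Lemma hn_eq0 x : (forall N, hn N x <= 0) -> x = 0.
Proof.
move=> x0; apply: (sc_hausdorff X) => A B /nbhs_hn[N [e [e0 HA]]] B0.
exists 0; split; last exact: nbhs_singleton.
by apply: HA; rewrite sub0r hnN (le_lt_trans (x0 N)).
Qed.

Lemma approx x N e : 0 < e -> exists2 P, S P & hn N (x - j P) < e.
Proof.
move=> e0; have [|P PS Pe] := @dense_nbhs x [set y | hn N (x - y) < e].
  by apply/nbhs_hn; exists N, e; split=> // y; rewrite -hnN opprB.
by exists P.
Qed.

Definition hcvg (s : nat -> H) x := forall N e, 0 < e ->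
  exists k0, forall k, (k0 <= k)%N -> hn N (s k - x) < e.

Lemma hcvg_cvg s x : hcvg s x -> s @ \oo --> x.
Proof.
move=> sx A /nbhs_hn[N [e [e0 HA]]]; have [k0 Hk] := sx N e e0.
by exists k0 => // k /= /Hk /HA.
Qed.

Lemma hcvg_cauchy s : (forall N e, 0 < e -> exists k0, forall k l, (k0 <= k)%N ->
  (k0 <= l)%N -> hn N (s k - s l) < e) -> exists x, hcvg s x.
Proof.
move=> sC; have [|x sx] := sc_complete X (F := s @ \oo) _.
  move=> U /nbhs_hn[N [e [e0 HU]]]; have [k0 Hk] := sC N e e0.
  exists [set y | exists2 k, (k0 <= k)%N & y = s k]; first by exists k0 => // k /= kk; exists k.
  by move=> _ _ [k kk ->] [l ll ->]; apply: HU; rewrite subr0; exact: Hk.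
exists x => N e e0; have [|k0 _ Hk] := sx [set y | hn N (y - x) < e].
  by apply/nbhs_hn; exists N, e.
by exists k0 => k /Hk.
Qed.

Lemma hcvg_unique s x y : hcvg s x -> hcvg s y -> x = y.
Proof.
move=> sx sy; apply/eqP; rewrite -subr_eq0; apply/eqP/hn_eq0 => N.
apply/ler_addgt0Pr => d d0; have d2 : 0 < d / 2 by rewrite divr_gt0.
have [k Hk] := sx N _ d2; have [l Hl] := sy N _ d2.
rewrite add0r (le_trans (hn_split N x (s (maxn k l)) y))// [leRHS]splitr lerD//.
  by rewrite -hnN opprB ltW// Hk// leq_maxl.
by rewrite ltW// Hl// leq_maxr.
Qed.

Lemma hcvg_lin a s t x y : hcvg s x -> hcvg t y ->
  hcvg (fun k => a *: s k + t k) (a *: x + y).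
Proof.
move=> sx ty N e e0; have e2 : 0 < e / 2 by rewrite divr_gt0.
have a1 : 0 < cn a + 1 by rewrite ltr_wpDl ?cn_ge0.
have [k Hk] := sx N (e / 2 / (cn a + 1)) (divr_gt0 e2 a1).
have [l Hl] := ty N _ e2; exists (maxn k l) => m; rewrite geq_max => /andP[/Hk km /Hl lm].
have -> : a *: s m + t m - (a *: x + y) = a *: (s m - x) + (t m - y).
  by rewrite scalerBr opprD addrACA.
rewrite (le_lt_trans (hnD _ _ _))// [ltRHS]splitr ler_ltD//.
apply: (le_trans (hnZ _ _ _)); move: km; rewrite ltr_pdivlMr// => /ltW; apply: le_trans.
by rewrite mulrC ler_wpM2l ?hn_ge0// lerDl.
Qed.

Lemma hcvg_le s x N M : hcvg s x -> (forall k, hn N (s k) <= M) -> hn N x <= M.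
Proof.
move=> sx sM; apply/ler_addgt0Pr => d d0; have [k Hk] := sx N d d0.
rewrite -(subrK (s k) x) (le_trans (hnD _ _ _))// addrC lerD//.
by rewrite -hnN opprB ltW// Hk.
Qed.

Lemma hcvg_cst x : hcvg (fun=> x) x.
Proof. by move=> N e e0; exists 0%N => k _; rewrite subrr hn0. Qed.

Lemma hcvg_near s t x : (exists k0, forall k, (k0 <= k)%N -> s k = t k) -> hcvg s x -> hcvg t x.
Proof.
move=> [k0 st] sx N e e0; have [k1 Hk] := sx N e e0; exists (maxn k0 k1) => k.
by rewrite geq_max => /andP[/st <- /Hk].
Qed.

(** ** Extension of linear maps *)

Definition S_linear (L : V -> H) :=
  forall (a : R[i]) P Q, S P -> S Q -> L (a *: P + Q) = a *: L P + L Q.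

Definition bounded_by (L : V -> H) N N' (K : R) :=
  0 <= K /\ forall P, S P -> hn N (L P) <= K * p N' P.

Definition bounded (L : V -> H) := forall N, exists N' K, bounded_by L N N' K.

Definition hlinear (F : H -> H) := forall (a : R[i]) x y, F (a *: x + y) = a *: F x + F y.

Lemma approx_seq_ex x : exists s : nat -> V,
  forall k, S (s k) /\ hn k (x - j (s k)) < k.+1%:R^-1.
Proof.
have /choice[s Hs] : forall k, exists P, S P /\ hn k (x - j P) < k.+1%:R^-1.
  by move=> k; have [|P PS HP] := @approx x k k.+1%:R^-1; [rewrite invr_gt0|exists P].
by exists s.
Qed.

(** The [k]-th term is close in the [k]-th seminorm; as the seminorms increase, one sequence
    converges for all of them. *)
Definition approx_seq x : nat -> V :=
  xget (fun=> 0) [set s | forall k, S (s k) /\ hn k (x - j (s k)) < k.+1%:R^-1].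

Lemma approx_seqP x k : S (approx_seq x k) /\ hn k (x - j (approx_seq x k)) < k.+1%:R^-1.
Proof.
by have [s Hs] := approx_seq_ex x; rewrite /approx_seq; case: xgetP => [? _|/(_ s)//]; exact.
Qed.

Lemma approx_seq_cvg x : hcvg (fun k => j (approx_seq x k)) x.
Proof.
move=> N e e0; exists (maxn N (Num.trunc e^-1)) => k; rewrite geq_max => /andP[Nk ek].
rewrite -hnN opprB (le_lt_trans (hn_mono _ Nk))//.
have [_ /lt_le_trans] := approx_seqP x k; apply.
rewrite -[leRHS]invrK lef_pV2 ?posrE ?invr_gt0//.
have /andP[_ /ltW] := truncn_itv (ltW (eqbRL (invr_gt0 e) e0)).
by move=> /le_trans; apply; rewrite ler_nat.
Qed.

Definition ext (L : V -> H) x : H := xget 0 [set y | hcvg (fun k => L (approx_seq x k)) y].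

Lemma S_linearB L P Q : S_linear L -> S P -> S Q -> L (P - Q) = L P - L Q.
Proof.
by move=> Ll PS QS; have := Ll (-1) Q P QS PS; rewrite !scaleN1r addrC [in RHS]addrC.
Qed.

Lemma ext_approx L x : S_linear L -> bounded L -> hcvg (fun k => L (approx_seq x k)) (ext L x).
Proof.
move=> Ll Lb; rewrite /ext; case: xgetP => [//|noy].
have [|y /noy//] := @hcvg_cauchy (fun k => L (approx_seq x k)).
move=> N e e0; have [N' [K [K0 HK]]] := Lb N.
have K1 : 0 < K + 1 by rewrite ltr_wpDl.
have d0 : 0 < e / (K + 1) / 2 by rewrite !divr_gt0.
have [k0 Hk] := approx_seq_cvg x N' d0; exists k0 => k l kk ll.
have [kS _] := approx_seqP x k; have [lS _] := approx_seqP x l.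
have klS := sc_sub kS lS.
rewrite -S_linearB// (le_lt_trans (HK _ klS))//.
apply: (@le_lt_trans _ _ ((K + 1) * p N' (approx_seq x k - approx_seq x l))).
  by rewrite ler_wpM2r ?(sc_ge0 X)// lerDl.
rewrite mulrC -ltr_pdivlMr// -hn_j// jB// (le_lt_trans (hn_split _ _ x _))//.
by rewrite [ltRHS]splitr ltrD ?Hk// -hnN opprB Hk.
Qed.

(** Independence of the approximating sequence: the difference of two such sequences tends to 0, and
    so do its images. *)
Lemma ext_cvg L (s : nat -> V) x : S_linear L -> bounded L -> (forall k, S (s k)) ->
  hcvg (fun k => j (s k)) x -> hcvg (fun k => L (s k)) (ext L x).
Proof.
move=> Ll Lb sS sx.
have D : hcvg (fun k => L (s k - approx_seq x k)) 0.
  move=> N e e0; have [N' [K [K0 HK]]] := Lb N.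
  have K1 : 0 < K + 1 by rewrite ltr_wpDl.
  have d0 : 0 < e / (K + 1) by rewrite divr_gt0.
  have [k0 Hk] := hcvg_lin (-1) (approx_seq_cvg x) sx N' d0.
  exists k0 => k kk; have := Hk k kk; rewrite !scaleN1r addNr !subr0 => kd.
  have [aS _] := approx_seqP x k; have dS := sc_sub (sS k) aS.
  rewrite (le_lt_trans (HK _ dS))//.
  apply: (@le_lt_trans _ _ ((K + 1) * p N' (s k - approx_seq x k))).
    by rewrite ler_wpM2r ?(sc_ge0 X)// lerDl.
  by rewrite mulrC -ltr_pdivlMr// -hn_j// jB// addrC.
have := hcvg_lin 1 D (ext_approx x Ll Lb); rewrite scaler0 add0r.
apply: hcvg_near; exists 0%N => k _.
by rewrite scale1r S_linearB ?subrK//; have [] := approx_seqP x k.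
Qed.

Lemma ext_linear L : S_linear L -> bounded L -> hlinear (ext L).
Proof.
move=> Ll Lb a x y.
have aS z k : S (approx_seq z k) by have [] := approx_seqP z k.
pose s k := a *: approx_seq x k + approx_seq y k.
have sS k : S (s k) by apply: (sc_lin X).
have sx : hcvg (fun k => j (s k)) (a *: x + y).
  apply: hcvg_near (hcvg_lin a (approx_seq_cvg x) (approx_seq_cvg y)).
  by exists 0%N => k _; rewrite (sc_linear X).
apply: hcvg_unique (ext_cvg Ll Lb sS sx) _.
apply: hcvg_near (hcvg_lin a (ext_approx x Ll Lb) (ext_approx y Ll Lb)).
by exists 0%N => k _; rewrite Ll.
Qed.

Lemma ext_j L P : S_linear L -> bounded L -> S P -> ext L (j P) = L P.
Proof.
move=> Ll Lb PS; have := ext_cvg (s := fun=> P) Ll Lb (fun=> PS) (hcvg_cst (j P)).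
by move=> /hcvg_unique; apply; exact: hcvg_cst.
Qed.

(** [K] must not be weakened, since it is [T ^- k] for the [k]-th coefficient of a family; the
    [K + 1] in the proof only avoids a division by 0. *)
Lemma ext_bound L N N' K x : S_linear L -> bounded L -> bounded_by L N N' K ->
  hn N (ext L x) <= K * hn N' x.
Proof.
move=> Ll Lb [K0 HK]; apply/ler_addgt0Pr => d d0.
have K1 : 0 < K + 1 by rewrite ltr_wpDl.
have d2 : 0 < d / 2 by rewrite divr_gt0.
have [k1 Hk1] := ext_approx x Ll Lb N d2.
have [k2 Hk2] := approx_seq_cvg x N' (divr_gt0 d2 K1).
set k := maxn k1 k2; have {}Hk1 := Hk1 k (leq_maxl _ _); have {}Hk2 := Hk2 k (leq_maxr _ _).
have [aS _] := approx_seqP x k.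
rewrite -(subrK (L (approx_seq x k)) (ext L x)) (le_trans (hnD _ _ _))//.
rewrite [X in _ <= _ + X](splitr d) addrCA lerD//.
  by rewrite -hnN opprB ltW.
apply: (le_trans (HK _ aS)).
rewrite -hn_j// -[j _](subrK x) (le_trans (ler_wpM2l K0 (hnD _ _ _)))//.
rewrite mulrDr [leRHS]addrC lerD2r.
move: Hk2; rewrite ltr_pdivlMr// => /ltW; apply: le_trans.
by rewrite mulrC ler_wpM2l ?hn_ge0// lerDl.
Qed.

Lemma hlinear_continuous (F : H -> H) : hlinear F ->
  (forall N, exists N' K, 0 <= K /\ forall x, hn N (F x) <= K * hn N' x) -> continuous F.
Proof.
move=> Fl Fb x A /nbhs_hn[N [e [e0 HA]]]; apply/nbhs_hn.
have [N' [K [K0 HK]]] := Fb N; have K1 : 0 < K + 1 by rewrite ltr_wpDl.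
exists N', (e / (K + 1)); split; first by rewrite divr_gt0.
move=> y; rewrite ltr_pdivlMr// => xy; apply: HA.
have -> : F y - F x = F (y - x).
  by have := Fl (-1) x y; rewrite !scaleN1r addrC [in RHS]addrC => ->.
apply: (le_lt_trans (HK _)); apply: le_lt_trans xy.
by rewrite mulrC ler_wpM2l ?hn_ge0// lerDl.
Qed.

(** ** Extension of bilinear maps *)

Definition bounded2_by (M : V -> V -> H) N N' (K : R) :=
  0 <= K /\ forall P Q, S P -> S Q -> hn N (M P Q) <= K * (p N' P * p N' Q).

Definition bounded2 (M : V -> V -> H) := forall N, exists N' K, bounded2_by M N N' K.

Definition S_bilinear (M : V -> V -> H) :=
  (forall P, S P -> S_linear (M P)) /\ (forall Q, S Q -> S_linear (M^~ Q)).

Definition ext2 (M : V -> V -> H) x y : H := ext (fun P => ext (M P) y) x.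

Lemma bounded2_bounded M P N N' K : bounded2_by M N N' K -> S P ->
  bounded_by (M P) N N' (K * p N' P).
Proof.
move=> [K0 HK] PS; split; first by rewrite mulr_ge0 ?(sc_ge0 X).
by move=> Q QS; rewrite -mulrA; exact: HK.
Qed.

Lemma bounded2r M P : bounded2 M -> S P -> bounded (M P).
Proof.
move=> Mb PS N; have [N' [K HK]] := Mb N; exists N', (K * p N' P).
exact: bounded2_bounded.
Qed.

Lemma ext_bounded2 M y N N' K : S_bilinear M -> bounded2 M -> bounded2_by M N N' K ->
  bounded_by (fun P => ext (M P) y) N N' (K * hn N' y).
Proof.
move=> [Mr _] Mb HK; split; first by rewrite mulr_ge0 ?hn_ge0//; have [] := HK.
move=> P PS; rewrite mulrAC; apply: ext_bound; [exact: Mr|exact: bounded2r|].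
exact: bounded2_bounded.
Qed.

Lemma ext_bounded2' M y : S_bilinear M -> bounded2 M -> bounded (fun P => ext (M P) y).
Proof.
move=> Ml Mb N; have [N' [K HK]] := Mb N; exists N', (K * hn N' y).
exact: ext_bounded2.
Qed.

Lemma ext_S_linear M y : S_bilinear M -> bounded2 M -> S_linear (fun P => ext (M P) y).
Proof.
move=> Ml Mb a P Q PS QS; have [Mr Mll] := Ml; have aPQ := sc_lin X a PS QS.
have aS k : S (approx_seq y k) by have [] := approx_seqP y k.
apply: hcvg_unique (ext_approx y (Mr _ aPQ) (bounded2r Mb aPQ)) _.
apply: hcvg_near (hcvg_lin a (ext_approx y (Mr _ PS) (bounded2r Mb PS))
  (ext_approx y (Mr _ QS) (bounded2r Mb QS))).
by exists 0%N => k _; rewrite (Mll _ (aS k)).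
Qed.

Lemma ext2_bound M N N' K x y : S_bilinear M -> bounded2 M -> bounded2_by M N N' K ->
  hn N (ext2 M x y) <= K * (hn N' x * hn N' y).
Proof.
move=> Ml Mb HK; rewrite [hn _ x * _]mulrC mulrA.
apply: ext_bound; [exact: ext_S_linear|exact: ext_bounded2'|exact: ext_bounded2].
Qed.

Lemma ext2_j M P Q : S_bilinear M -> bounded2 M -> S P -> S Q ->
  ext2 M (j P) (j Q) = M P Q.
Proof.
move=> Ml Mb PS QS; rewrite /ext2 ext_j//; [|exact: ext_S_linear|exact: ext_bounded2'].
by apply: ext_j => //; [have [Mr _] := Ml; exact: Mr|exact: bounded2r].
Qed.

Lemma ext2_linearl M y : S_bilinear M -> bounded2 M -> hlinear (fun x => ext2 M x y).
Proof.
by move=> Ml Mb; apply: ext_linear; [exact: ext_S_linear|exact: ext_bounded2'].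
Qed.

Lemma ext2_linearr M x : S_bilinear M -> bounded2 M -> hlinear (ext2 M x).
Proof.
move=> Ml Mb a y z; have [Mr Mll] := Ml.
have aS k : S (approx_seq x k) by have [] := approx_seqP x k.
have cv w := ext_approx x (ext_S_linear w Ml Mb) (ext_bounded2' w Ml Mb).
apply: hcvg_unique (cv _) _.
apply: hcvg_near (hcvg_lin a (cv y) (cv z)); exists 0%N => k _.
by rewrite ext_linear//; [exact: Mr|exact: bounded2r].
Qed.

Lemma hbilinear_continuous (M : H -> H -> H) : (forall x, hlinear (M x)) ->
  (forall y, hlinear (M^~ y)) ->
  (forall N, exists N' K, 0 <= K /\ forall x y, hn N (M x y) <= K * (hn N' x * hn N' y)) ->
  continuous (fun z : H * H => M z.1 z.2).
Proof.
move=> Mr Ml Mb [x y] A /= /nbhs_hn[N [e [e0 HA]]].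
have [N' [K [K0 HK]]] := Mb N.
(* For increments below [d <= 1] the three terms of the difference add up to at most
   [K * d * (hn N' x + hn N' y + 1)], strictly less than [d * c]. *)
pose c := (K + 1) * (hn N' x + hn N' y + 2).
have xy0 : 0 <= hn N' x + hn N' y by rewrite addr_ge0 ?hn_ge0.
have c0 : 0 < c by rewrite mulr_gt0 ?ltr_wpDl.
pose d := Num.min 1 (e / c).
have d0 : 0 < d by rewrite lt_min ltr01 divr_gt0.
have dd : nbhs x [set z | hn N' (z - x) < d] by apply/nbhs_hn; exists N', d.
have dd' : nbhs y [set z | hn N' (z - y) < d] by apply/nbhs_hn; exists N', d.
exists ([set z | hn N' (z - x) < d], [set z | hn N' (z - y) < d]); first by split.
move=> [x' y'] [/= xd yd]; apply: HA.
have d1 : d <= 1 by rewrite ge_min lexx.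
have de : d * c <= e by rewrite -ler_pdivlMr// ge_min lexx orbT.
have BM1 u v w : M (u - v) w = M u w - M v w.
  by have := Ml w (-1) v u; rewrite !scaleN1r addrC [in RHS]addrC.
have BM2 w u v : M w (u - v) = M w u - M w v.
  by have := Mr w (-1) v u; rewrite !scaleN1r addrC [in RHS]addrC.
have -> : M x' y' - M x y = M (x' - x) (y' - y) + (M (x' - x) y + M x (y' - y)).
  by rewrite BM2 addrA subrK BM1 BM2 addrA subrK.
set a := hn N' (x' - x) in xd *; set b := hn N' (y' - y) in yd *.
have a0 : 0 <= a by exact: hn_ge0. have b0 : 0 <= b by exact: hn_ge0.
apply: (@le_lt_trans _ _ (K * (a * b) + (K * (a * hn N' y) + K * (hn N' x * b)))).
  by do 2 (apply: (le_trans (hnD _ _ _)); apply: lerD => //).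
apply: (@le_lt_trans _ _ (K * (d * (hn N' x + hn N' y + 1)))).
  rewrite -!mulrDr ler_wpM2l// [leRHS]mulrC !mulrDl mul1r.
  rewrite [X in _ <= X]addrC lerD//.
    by rewrite -[leRHS]mulr1 ler_pM// ltW// (lt_le_trans yd).
  by rewrite addrC [hn N' y * d]mulrC lerD ?ler_wpM2l ?ler_wpM2r ?hn_ge0// ltW.
apply: lt_le_trans de; rewrite mulrCA ltr_pM2l// /c.
apply: (@le_lt_trans _ _ ((K + 1) * (hn N' x + hn N' y + 1))).
  by rewrite ler_wpM2r ?addr_ge0 ?hn_ge0// lerDl.
by rewrite ltr_pM2l ?ltrD2l ?ltr1n// ltr_wpDl.
Qed.

(** ** Sums of rapidly decreasing power series *)

(** Infinite radius of convergence in every seminorm. *)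
Definition rapid (m : nat -> H) := forall N (T : R), 1 <= T ->
  exists K, forall n, T ^+ n * hn N (m n) <= K.

Definition hsum (m : nat -> H) (z : R[i]) : H :=
  xget 0 [set x | hcvg (fun l => \sum_(n < l) z ^+ n *: m n) x].

Lemma sum_half_shift l d : \sum_(i < d) (2^-1 : R) ^+ (l + i) <= 2 * 2^-1 ^+ l.
Proof.
under eq_bigr do rewrite exprD; rewrite -mulr_sumr mulrC ler_wpM2r ?exprn_ge0//.
suff -> : \sum_(i < d) (2^-1 : R) ^+ i = 2 - 2 * 2^-1 ^+ d by rewrite gerBl mulr_ge0 ?exprn_ge0.
elim: d => [|d IH]; first by rewrite big_ord0 expr0 mulr1 subrr.
by rewrite big_ord_recr /= IH exprS; field.
Qed.

(** Growth [T ^ n] against decay [(2 * T) ^- n] leaves [2 ^- n]. The scalars [c n] are general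
    because they are powers of [z] in one use and Taylor remainders in another. *)
Lemma hn_tail (c : nat -> R[i]) (m : nat -> H) N (A T K : R) l d : 0 <= A -> 0 < T ->
  (forall n, cn (c n) <= A * T ^+ n) -> (forall n, (2 * T) ^+ n * hn N (m n) <= K) ->
  hn N (\sum_(i < d) c (l + i)%N *: m (l + i)%N) <= 2 * A * K * 2^-1 ^+ l.
Proof.
move=> A0 T0 Hc Hm; have K0 : 0 <= K by apply: le_trans (Hm 0%N); rewrite mulr_ge0 ?hn_ge0.
apply: (le_trans (hn_sum _ _ _)).
apply: (@le_trans _ _ (\sum_(i < d) A * K * 2^-1 ^+ (l + i))).
  apply: ler_sum => i _; apply: (le_trans (hnZ _ _ _)).
  apply: (le_trans (ler_wpM2r (hn_ge0 _ _) (Hc _))).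
  rewrite -!mulrA ler_wpM2l// exprVn ler_pdivlMr ?exprn_gt0//.
  by rewrite mulrC mulrA -exprMn.
by rewrite -mulr_sumr [2 * A]mulrC -!mulrA ler_wpM2l// mulrCA ler_wpM2l// sum_half_shift.
Qed.

Lemma hsumP m z : rapid m -> hcvg (fun l => \sum_(n < l) z ^+ n *: m n) (hsum m z).
Proof.
move=> mr; rewrite /hsum; case: xgetP => [//|nox].
have [|x /nox//] := @hcvg_cauchy (fun l => \sum_(n < l) z ^+ n *: m n).
move=> N e e0; pose T := cn z + 1.
have T0 : 0 < T by rewrite ltr_wpDl ?cn_ge0.
have [|K HK] := mr N (2 * T).
  by rewrite mulr_ege1 ?ler1n// lerDr cn_ge0.
have Hc n : cn (z ^+ n) <= 1 * T ^+ n.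
  by rewrite mul1r cnX lerXn2r ?nnegrE ?cn_ge0 ?(ltW T0)// lerDl.
have K0 : 0 <= K by apply: le_trans (HK 0%N); rewrite mulr_ge0 ?hn_ge0.
have K1 : 0 < 2 * (K + 1) by rewrite mulr_gt0// ltr_wpDl.
have [k0 Hk0] : exists k0, 2 * (K + 1) * 2^-1 ^+ k0 < e.
  exists (Num.trunc (2 * (K + 1) / e)).+1.
  rewrite exprVn ltr_pdivrMr ?exprn_gt0// [ltRHS]mulrC -ltr_pdivrMr//.
  have /andP[_ /lt_trans] := truncn_itv (ltW (divr_gt0 K1 e0)); apply.
  by rewrite -natrX ltr_nat ltn_expl.
have D k l : (k0 <= k)%N -> (k <= l)%N ->
    hn N (\sum_(n < l) z ^+ n *: m n - \sum_(n < k) z ^+ n *: m n) < e.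
  move=> kk kl; rewrite -(subnKC kl) big_split_ord /= [X in hn _ (X - _)]addrC addrK.
  apply: (le_lt_trans (hn_tail _ _ ler01 T0 Hc HK)).
  rewrite mulr1; apply: le_lt_trans Hk0; rewrite ler_pM ?mulr_ge0 ?exprn_ge0//.
    by rewrite ler_wpM2l// lerDl.
  by apply: ler_wiXn2l => //; rewrite invf_le1// ler1n.
exists k0 => k l kk ll; have [kl|/ltnW lk] := leqP k l; last exact: D.
by rewrite -hnN opprB D.
Qed.

Lemma hsum_bound m z N (T K : R) : rapid m -> 0 < T -> cn z <= T ->
  (forall n, (2 * T) ^+ n * hn N (m n) <= K) -> hn N (hsum m z) <= 2 * K.
Proof.
move=> mr T0 zT HK; apply: hcvg_le (hsumP z mr) _ => l.
have Hc n : cn (z ^+ n) <= 1 * T ^+ n.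
  by rewrite mul1r cnX lerXn2r ?nnegrE ?cn_ge0 ?(ltW T0).
have := hn_tail 0 l ler01 T0 Hc HK; rewrite expr0 !mulr1.
by under eq_bigr do rewrite add0n.
Qed.

Lemma hsum_lin a m m' z : rapid m -> rapid m' -> rapid (fun n => a *: m n + m' n) ->
  hsum (fun n => a *: m n + m' n) z = a *: hsum m z + hsum m' z.
Proof.
move=> mr m'r mmr; apply: hcvg_unique (hsumP z mmr) _.
apply: hcvg_near (hcvg_lin a (hsumP z mr) (hsumP z m'r)); exists 0%N => l _.
rewrite scaler_sumr -big_split /=; apply: eq_bigr => n _.
by rewrite scalerDr !scalerA mulrC.
Qed.

Lemma hsum_finite m z D : (forall n, (D <= n)%N -> m n = 0) -> rapid m ->
  hsum m z = \sum_(n < D) z ^+ n *: m n.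
Proof.
move=> mD mr; apply: hcvg_unique (hsumP z mr) _.
apply: hcvg_near (hcvg_cst _); exists D => l Dl.
rewrite -(subnKC Dl) big_split_ord /= [X in _ = _ + X]big1 ?addr0// => i _.
by rewrite mD ?scaler0// leq_addr.
Qed.

(** The remainder for [n.+1] is [z + h] times the one for [n], plus [h ^ 2] times the derivative of
    [z ^ n]; each part is at most [T] times the bound for [n]. *)
Lemma cn_taylor (z h : R[i]) (T : R) n : 1 <= T -> cn z <= T -> cn (z + h) <= T ->
  cn ((z + h) ^+ n - z ^+ n - h * (n%:R * z ^+ n.-1)) <= cn h ^+ 2 * (4 * T) ^+ n.
Proof.
move=> T1 zT zhT; have T0 : 0 <= T := le_trans ler01 T1.
elim: n => [|n IH].
  by rewrite !expr0 subrr mul0r mulr0 subrr cn0 mulr1 exprn_ge0 ?cn_ge0.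
have -> : (z + h) ^+ n.+1 - z ^+ n.+1 - h * (n.+1%:R * z ^+ n.+1.-1) =
    (z + h) * ((z + h) ^+ n - z ^+ n - h * (n%:R * z ^+ n.-1)) + h ^+ 2 * (n%:R * z ^+ n.-1).
  case: n {IH} => [|n] /=; first by rewrite !expr0 !expr1; ring.
  by rewrite !exprS -[n.+2]addn1 natrD; ring.
apply: (le_trans (cnD _ _)).
have -> : cn (h ^+ 2 * (n%:R * z ^+ n.-1)) = cn h ^+ 2 * (n%:R * cn z ^+ n.-1).
  by rewrite [LHS]cnM cnX [cn (n%:R * _)]cnM cn_nat cnX.
rewrite [cn ((z + h) * _)]cnM.
apply: (@le_trans _ _ (T * (cn h ^+ 2 * (4 * T) ^+ n) + cn h ^+ 2 * ((4 * T) ^+ n * T))).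
  apply: lerD; first by rewrite ler_pM ?cn_ge0.
  rewrite ler_wpM2l ?exprn_ge0 ?cn_ge0// exprMn -mulrA ler_pM ?exprn_ge0 ?cn_ge0//.
    by rewrite -natrX ler_nat ltnW// ltn_expl.
  rewrite -exprSr; apply: (@le_trans _ _ (T ^+ n.-1)).
    by rewrite lerXn2r ?nnegrE ?cn_ge0.
  by rewrite ler_weXn2l// (leq_trans (leq_pred _)).
rewrite [(4 * T) ^+ n.+1]exprS.
have : 0 <= cn h ^+ 2 * (4 * T) ^+ n * T.
  by rewrite !mulr_ge0 ?exprn_ge0 ?mulr_ge0 ?cn_ge0.
by move=> ?; lra.
Qed.

Lemma rapid_deriv m : rapid m -> rapid (fun n => n.+1%:R *: m n.+1).
Proof.
move=> mr N T T1; have T0 : 0 <= T := le_trans ler01 T1.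
have [|K HK] := mr N (2 * T); first by rewrite mulr_ege1 ?ler1n.
exists K => n; apply: le_trans (HK n.+1).
apply: (@le_trans _ _ (T ^+ n * (n.+1%:R * hn N (m n.+1)))).
  by rewrite ler_wpM2l ?exprn_ge0// (le_trans (hnZ _ _ _))// cn_nat.
rewrite mulrA ler_wpM2r ?hn_ge0// mulrC exprMn ler_pM ?exprn_ge0//.
  by rewrite -natrX ler_nat ltnW// ltn_expl.
by rewrite ler_weXn2l.
Qed.

(** The termwise Taylor remainders are quadratic in [h] with coefficients of geometric growth, which
    the rapid decrease of [m] outweighs. *)
Lemma entire_hsum m : rapid m -> entire (hsum m : R[i]^o -> H).
Proof.
move=> mr z; pose m' n := n.+1%:R *: m n.+1.
have m'r : rapid m' := rapid_deriv mr.
exists (hsum m' z) => A /nbhs_hn[N [e [e0 HA]]].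
pose T := cn z + 1; have T1 : 1 <= T by rewrite lerDr cn_ge0.
have T0 : 0 < T := lt_le_trans ltr01 T1.
have [|K HK] := mr N (2 * (4 * T)); first by rewrite !mulr_ege1 ?ler1n.
have K0 : 0 <= K by apply: le_trans (HK 0%N); rewrite mulr_ge0 ?hn_ge0.
have K1 : 0 < 2 * K + 1 by rewrite ltr_wpDl ?mulr_ge0.
have bound (h : R[i]) : cn h <= 1 ->
    hn N (hsum m (z + h) - hsum m z - h *: hsum m' z) <= 2 * (cn h ^+ 2) * K.
  move=> h1.
  have zT : cn z <= T by rewrite lerDl.
  have zhT : cn (z + h) <= T by rewrite (le_trans (cnD _ _))// lerD2l.
  pose s l := \sum_(n < l) ((z + h) ^+ n - z ^+ n - h * (n%:R * z ^+ n.-1)) *: m n.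
  (* The shift by one aligns the partial sums: [l] terms of the derived series come from the first
     [l.+1] terms of [m]. *)
  have sc : hcvg (fun l => s l.+1) (hsum m (z + h) - hsum m z - h *: hsum m' z).
    have shift t x : hcvg t x -> hcvg (fun l => t l.+1) x.
      by move=> tx M d d0; have [k0 Hk] := tx M d d0; exists k0 => k kk; rewrite Hk// ltnW.
    have c1 := shift _ _ (hsumP (z + h) mr); have c2 := shift _ _ (hsumP z mr).
    have c3 := hcvg_lin (- h) (hsumP z m'r) (hcvg_lin (-1) c2 c1).
    have -> : hsum m (z + h) - hsum m z - h *: hsum m' z =
        - h *: hsum m' z + (-1 *: hsum m z + hsum m (z + h)).
      by rewrite scaleNr scaleN1r [RHS]addrC [- hsum m z + _]addrC.
    apply: hcvg_near c3; exists 0%N => l _; rewrite /s.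
    under [RHS]eq_bigr do rewrite !scalerBl.
    rewrite !sumrB scaleN1r [LHS]addrC [- (\sum_(n < l.+1) _) + _]addrC scaleNr; congr (_ - _).
    rewrite big_ord_recl mul0r mulr0 scale0r add0r scaler_sumr; apply: eq_bigr => n _.
    by rewrite /m' lift0 /= !scalerA [z ^+ n * _]mulrC mulrA.
  apply: hcvg_le sc _ => l.
  have := @hn_tail (fun n => (z + h) ^+ n - z ^+ n - h * (n%:R * z ^+ n.-1)) m N
    (cn h ^+ 2) (4 * T) K 0 l.+1 _ _ _ HK.
  rewrite expr0 mulr1 exprn_ge0 ?cn_ge0// mulr_gt0//.
  under eq_bigr do rewrite add0n.
  by apply=> // n; exact: cn_taylor.
pose d := Num.min 1 (e / (2 * K + 1)).
have d0 : 0 < d by rewrite lt_min ltr01 divr_gt0.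
have dC : (0 : R[i]) < d%:C%C by rewrite ltcR.
have near0 := @dnbhs0_lt _ (R[i]^o : normedModType R[i]) _ dC.
have ne : \forall h \near (0 : R[i]^o)^', h != 0 by exact: nbhs_dnbhs_neq.
apply: (@filterS _ (0 : R[i]^o)^' _ _ _ _ (filterI ne near0)) => h [h0 hd]; apply: HA.
have {}hd : cn h < d by rewrite -ltcR; exact: hd.
have h1 : cn h <= 1 by rewrite (le_trans (ltW hd))// ge_min lexx.
have hh : cn h != 0 by apply: contra_neq h0 => /Normc.eq0_normc.
have -> : (h^-1 : R[i]) *: (hsum m (z + h) - hsum m z) - hsum m' z =
    (h^-1 : R[i]) *: (hsum m (z + h) - hsum m z - h *: hsum m' z).
  by rewrite [in RHS]scalerBr scalerA [X in X *: hsum m' z](mulVf h0) scale1r.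
rewrite (le_lt_trans (hnZ _ _ _))// cnV.
apply: (@le_lt_trans _ _ (cn h * (2 * K))).
  apply: (le_trans (ler_wpM2l _ (bound h h1))); first by rewrite invr_ge0 cn_ge0.
  by rewrite [2 * _]mulrC expr2 -!mulrA mulKf.
have := hd; rewrite lt_min => /andP[_]; rewrite ltr_pdivlMr//; apply: le_lt_trans.
by rewrite ler_wpM2l ?cn_ge0// lerDl.
Qed.

End SeminormedCompletion.

(** * Extension to the completion *)

Section Completion.
Context (R : realType) (n : nat) (G : lieGroupType R n).
Context (c : chart R n G) (c_atlas : lie_atlas c) (c_unit : cdom c 1%g).
Context (B : 'M[R]_n) (r r' : R).
Context (H : tvsType R[i]) (j : pol G -> H).
Hypothesis H_completion : is_completion c B r r' j.
Local Notation C := (R[i]^o).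
Local Notation cn := (@Normc.normc R).
Local Notation S := (sym_pol c B r).
Local Notation p := (nuN c B r r').
Local Notation is_polP := (is_polP c_atlas c_unit B r).
Local Notation pext := (ext S p j).
Local Notation pext2 := (ext2 S p j).
Local Notation phn := (hn S p j).
Local Notation psum := (hsum S p j).
Local Notation rapid := (rapid S p j).
Implicit Types (P Q : pol G) (h : R[i]) (x y : H).

Lemma pol_completion : seminormed_completion S p j.
Proof.
split.
- by move=> a P Q PS QS; apply: sym_polD => //; exact: sym_polZ.
- exact: sym_pol0.
- by move=> N P; exact: nuN_ge0.
- by move=> N P Q PS QS; exact: nuD.
- by move=> N a P PS; exact: nuZ_le.
- by move=> N N' P PS; exact: nuN_mono.
- exact: (compl_hausdorff H_completion).
- exact: (compl_complete H_completion).
- by move=> a P Q /is_polP PS /is_polP QS; exact: (compl_linear H_completion).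
- move=> P PS A; rewrite -(pol_nbhsP c_atlas c_unit r' A PS).
  rewrite (compl_embedding H_completion) ?is_polP//.
  by split=> -[U PU HU]; exists U => // Q /is_polP; exact: HU.
- move=> O O0 Oo; have [x [Ox [P /is_polP PS Px]]] := compl_dense H_completion O0 Oo.
  by exists x; split=> //; exists P.
Qed.

Let X := pol_completion.

(** The topology of Pol is induced by [j], so continuity of the extension restricts to Pol. *)
Lemma extends_to_continuous f F : extends_to c B r j f F -> continuous_pol c B r r' f.
Proof.
move=> [fm Fc _ Fj] P PS A /(compl_embedding H_completion (fm P PS))[U PU HU].
apply/(compl_embedding H_completion PS); exists (F @^-1` U).
  by apply: Fc; rewrite Fj.
by move=> Q QS; rewrite /= Fj// => /HU; apply; exact: fm.
Qed.

Section LinearFamily.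
Context (F : nat -> pol G -> pol G) (Ff : linear_family c B r r' F).

Lemma lf_S_linear k : S_linear S (j \o F k).
Proof.
move=> a P Q PS QS; rewrite /= (lf_linear Ff)// (sc_linear X)//; exact: (lf_sym Ff).
Qed.

Lemma lf_bounded_by N (T : R) : 1 <= T ->
  exists N', forall k, bounded_by S p j (j \o F k) N N' (T ^- k).
Proof.
move=> T1; have T0 : 0 < T := lt_le_trans ltr01 T1.
have [N' HN'] := lf_bound Ff N T1; exists N' => k; split; first by rewrite invr_ge0 exprn_ge0 ?ltW.
move=> P PS; rewrite /= (hn_j X); last exact: (lf_sym Ff).
by rewrite mulrC ler_pdivlMr ?exprn_gt0// mulrC; exact: HN'.
Qed.

Lemma lf_bounded k : bounded S p j (j \o F k).
Proof. by move=> N; have [N' HN'] := lf_bounded_by N (lexx 1); exists N', (1 ^- k). Qed.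

Lemma lf_ext_bound N (T : R) : 1 <= T -> exists N', forall k x,
  T ^+ k * phn N (pext (j \o F k) x) <= phn N' x.
Proof.
move=> T1; have T0 : 0 < T := lt_le_trans ltr01 T1.
have [N' HN'] := lf_bounded_by N T1; exists N' => k x.
have := ext_bound X x (lf_S_linear k) (lf_bounded k) (HN' k).
by rewrite mulrC ler_pdivlMr ?exprn_gt0// mulrC.
Qed.

Lemma lf_rapid x : rapid (fun k => pext (j \o F k) x).
Proof.
by move=> N T T1; have [N' HN'] := lf_ext_bound N T1; exists (phn N' x) => k; exact: HN'.
Qed.

Definition lf_sum h x : H := psum (fun k => pext (j \o F k) x) h.

Lemma lf_sum_linear h : Clinear (lf_sum h).
Proof.
move=> a x y; rewrite /lf_sum -(hsum_lin X h (lf_rapid x) (lf_rapid y)).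
  congr (psum _ h); apply/funext => k.
  exact: (ext_linear X (lf_S_linear k) (lf_bounded k)).
have := lf_rapid (a *: x + y); congr rapid; apply/funext => k.
exact: (ext_linear X (lf_S_linear k) (lf_bounded k)).
Qed.

Lemma lf_sum_continuous h : continuous (lf_sum h).
Proof.
apply: (hlinear_continuous X (lf_sum_linear h)) => N.
have T1 : 1 <= cn h + 1 by rewrite lerDr cn_ge0.
have T2 : 1 <= 2 * (cn h + 1) by rewrite mulr_ege1// ler1n.
have [N' HN'] := lf_ext_bound N T2; exists N', 2; split=> // x.
apply: (hsum_bound X (lf_rapid x) (lt_le_trans ltr01 T1)) => [|k]; last exact: HN'.
by rewrite lerDl.
Qed.

Lemma lf_sum_j f h P : S P -> evals (F ^~ P) h (f P) -> lf_sum h (j P) = j (f P).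
Proof.
move=> PS [D [FD ->]]; rewrite /lf_sum.
have E k : pext (j \o F k) (j P) = j (F k P).
  exact: (ext_j X (lf_S_linear k) (lf_bounded k) PS).
rewrite (@hsum_finite _ _ _ _ _ _ X _ _ D) => [||]; last exact: lf_rapid.
  under eq_bigr do rewrite E.
  elim: D {FD} => [|D IH]; first by rewrite !big_ord0 (j0 X).
  have FS k := lf_sym Ff k PS.
  rewrite !big_ord_recr /= IH (jD X) ?(jZ X)//; last exact: (sc_scal X).
  by apply: sym_pol_sum => // k _; exact: sym_polZ.
by move=> k /FD kD; rewrite E kD (j0 X).
Qed.

Lemma lf_sum_extends f h : (forall P, S P -> evals (F ^~ P) h (f P)) ->
  extends_to c B r j f (lf_sum h).
Proof.
move=> Ff'; split.
- move=> P /is_polP PS; apply/is_polP; apply: sym_evals (Ff' P PS) => // k.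
  exact: (lf_sym Ff).
- exact: lf_sum_continuous.
- exact: lf_sum_linear.
- by move=> P /is_polP PS; apply: lf_sum_j => //; exact: Ff'.
Qed.

Lemma lf_sum_series h x :
  series (fun k => h ^+ k *: pext (j \o F k) x) @ \oo --> lf_sum h x.
Proof.
apply: (hcvg_cvg X); have := hsumP X h (lf_rapid x).
by congr hcvg; apply/funext => l; rewrite /series /= big_mkord.
Qed.

Lemma lf_sum_entire x : entire (fun h : C => lf_sum h x).
Proof. exact: (entire_hsum X (lf_rapid x)). Qed.

End LinearFamily.

Section BilinearFamily.
Context (M : nat -> pol G -> pol G -> pol G) (Mf : bilinear_family c B r r' M).

Lemma bf_S_bilinear k : S_bilinear S (fun P Q => j (M k P Q)).
Proof.
split=> [P PS a Q Q' QS QS'|Q QS a P P' PS PS'] /=.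
  by rewrite (bf_linearr Mf)// (sc_linear X)//; exact: (bf_sym Mf).
by rewrite (bf_linearl Mf)// (sc_linear X)//; exact: (bf_sym Mf).
Qed.

Lemma bf_bounded_by N (T : R) : 1 <= T ->
  exists N', forall k, bounded2_by S p j (fun P Q => j (M k P Q)) N N' (T ^- k).
Proof.
move=> T1; have T0 : 0 < T := lt_le_trans ltr01 T1.
have [N' HN'] := bf_bound Mf N T1; exists N' => k; split; first by rewrite invr_ge0 exprn_ge0 ?ltW.
move=> P Q PS QS; rewrite (hn_j X); last exact: (bf_sym Mf).
by rewrite mulrC ler_pdivlMr ?exprn_gt0// mulrC; exact: HN'.
Qed.

Lemma bf_bounded k : bounded2 S p j (fun P Q => j (M k P Q)).
Proof. by move=> N; have [N' HN'] := bf_bounded_by N (lexx 1); exists N', (1 ^- k). Qed.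

Lemma bf_ext_bound N (T : R) : 1 <= T -> exists N', forall k x y,
  T ^+ k * phn N (pext2 (fun P Q => j (M k P Q)) x y) <= phn N' x * phn N' y.
Proof.
move=> T1; have T0 : 0 < T := lt_le_trans ltr01 T1.
have [N' HN'] := bf_bounded_by N T1; exists N' => k x y.
have := ext2_bound X x y (bf_S_bilinear k) (bf_bounded k) (HN' k).
by rewrite mulrC ler_pdivlMr ?exprn_gt0// mulrC.
Qed.

Lemma bf_rapid x y : rapid (fun k => pext2 (fun P Q => j (M k P Q)) x y).
Proof.
move=> N T T1; have [N' HN'] := bf_ext_bound N T1.
by exists (phn N' x * phn N' y) => k; exact: HN'.
Qed.

Definition bf_sum h x y : H := psum (fun k => pext2 (fun P Q => j (M k P Q)) x y) h.

Lemma bf_sum_linearr h x : Clinear (bf_sum h x).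
Proof.
move=> a y z; rewrite /bf_sum -(hsum_lin X h (bf_rapid x y) (bf_rapid x z)).
  congr (psum _ h); apply/funext => k.
  exact: (ext2_linearr X x (bf_S_bilinear k) (bf_bounded k)).
have := bf_rapid x (a *: y + z); congr rapid; apply/funext => k.
exact: (ext2_linearr X x (bf_S_bilinear k) (bf_bounded k)).
Qed.

Lemma bf_sum_linearl h y : Clinear (bf_sum h ^~ y).
Proof.
move=> a x z; rewrite /bf_sum -(hsum_lin X h (bf_rapid x y) (bf_rapid z y)).
  congr (psum _ h); apply/funext => k.
  exact: (ext2_linearl X y (bf_S_bilinear k) (bf_bounded k)).
have := bf_rapid (a *: x + z) y; congr rapid; apply/funext => k.
exact: (ext2_linearl X y (bf_S_bilinear k) (bf_bounded k)).
Qed.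

Lemma bf_sum_continuous h : continuous (fun z : H * H => bf_sum h z.1 z.2).
Proof.
apply: (hbilinear_continuous X (bf_sum_linearr h) (bf_sum_linearl h)) => N.
have T1 : 1 <= cn h + 1 by rewrite lerDr cn_ge0.
have T2 : 1 <= 2 * (cn h + 1) by rewrite mulr_ege1// ler1n.
have [N' HN'] := bf_ext_bound N T2; exists N', 2; split=> // x y.
apply: (hsum_bound X (bf_rapid x y) (lt_le_trans ltr01 T1)) => [|k]; last exact: HN'.
by rewrite lerDl.
Qed.

Lemma bf_sum_j f h P Q : S P -> S Q -> evals (fun k => M k P Q) h (f P Q) ->
  bf_sum h (j P) (j Q) = j (f P Q).
Proof.
move=> PS QS [D [MD ->]]; rewrite /bf_sum.
have E k : pext2 (fun P Q => j (M k P Q)) (j P) (j Q) = j (M k P Q).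
  exact: (ext2_j X (bf_S_bilinear k) (bf_bounded k) PS QS).
rewrite (@hsum_finite _ _ _ _ _ _ X _ _ D) => [||]; last exact: bf_rapid.
  under eq_bigr do rewrite E.
  elim: D {MD} => [|D IH]; first by rewrite !big_ord0 (j0 X).
  have MS k := bf_sym Mf k PS QS.
  rewrite !big_ord_recr /= IH (jD X) ?(jZ X)//; last exact: (sc_scal X).
  by apply: sym_pol_sum => // k _; exact: sym_polZ.
by move=> k /MD kD; rewrite E kD (j0 X).
Qed.

Lemma bf_sum_extends f h : (forall P Q, S P -> S Q -> evals (fun k => M k P Q) h (f P Q)) ->
  extends_to2 c B r j f (bf_sum h).
Proof.
move=> Mf'; split.
- move=> P Q /is_polP PS /is_polP QS; apply/is_polP.
  by apply: sym_evals (Mf' P Q PS QS) => // k; exact: (bf_sym Mf).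
- exact: bf_sum_continuous.
- by split; [exact: bf_sum_linearr|exact: bf_sum_linearl].
- by move=> P Q /is_polP PS /is_polP QS; apply: bf_sum_j => //; exact: Mf'.
Qed.

Lemma bf_sum_entire x y : entire (fun h : C => bf_sum h x y).
Proof. exact: (entire_hsum X (bf_rapid x y)). Qed.

End BilinearFamily.

Section DeltaExtension.
Hypothesis rr : 1 <= r + r'.

Lemma Delta_S_linear l : S_linear S (j \o Delta_pow c B l).
Proof.
move=> a P Q PS QS.
rewrite /= (Delta_pow_linear c_atlas c_unit l a PS QS) (sc_linear X)//; exact: sym_Delta_pow.
Qed.

Lemma Delta_bounded l : bounded S p j (j \o Delta_pow c B l).
Proof.
move=> N; have M0 : 0 <= 1 * 2 * wtc r' * wtc (r - 1) * N.+1%:R.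
  by rewrite !mulr_ge0 ?wtc_ge0.
have [N' HN'] := nat_ge M0; exists N', (l`!%:R); split=> // P PS.
have DS : S (Delta_pow c B l P) by exact: sym_Delta_pow.
have DS' : S ((l`!%:R : R[i])^-1 *: Delta_pow c B l P) by exact: sym_polZ.
rewrite /= (hn_j X)//.
apply: (@le_trans _ _ (l`!%:R * p N ((l`!%:R : R[i])^-1 *: Delta_pow c B l P))).
  have := nuZ_le c_atlas c_unit r' (l`!%:R : C) (ler0n R N.+1) DS'.
  by rewrite cn_nat scalerA mulfV ?fact_neq0// scale1r.
rewrite ler_wpM2l//; have N1 : 1 <= N.+1%:R :> R by rewrite ler1n.
have := nu_Delta_pow c_atlas c_unit l rr (lexx 1) N1 PS.
by rewrite expr1n mul1r => /le_trans; apply; apply: nu_mono.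
Qed.

Lemma Delta_extends l : extends_to c B r j (iter l (neumaier_Delta c B))
  (pext (j \o Delta_pow c B l)).
Proof.
have L := ext_linear X (Delta_S_linear l) (Delta_bounded l); split=> //.
- move=> P /is_polP PS; apply/is_polP.
  by rewrite (iter_DeltaE c_atlas c_unit l PS); exact: sym_Delta_pow.
- apply: (hlinear_continuous X L) => N; have [N' [K HK]] := Delta_bounded l N.
  exists N', K; split=> [|x]; first by case: HK.
  exact: (ext_bound X x (Delta_S_linear l) (Delta_bounded l)).
- move=> P /is_polP PS; rewrite (iter_DeltaE c_atlas c_unit l PS).
  exact: (ext_j X (Delta_S_linear l) (Delta_bounded l) PS).
Qed.

(** Turns the coefficients of the abstract power series into multiples of the extended powers of
    [neumaier_Delta], so that the sum becomes the exponential series. *)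
Lemma neumaier_term_ext kappa l x : pext (j \o neumaier_term c B kappa l) x =
  ((- ('i%C * kappa%:C%C)) ^+ l / l`!%:R : R[i]) *: pext (j \o Delta_pow c B l) x.
Proof.
have Nf := neumaier_family c_atlas c_unit B rr kappa.
apply: (hcvg_unique X (ext_approx X x (lf_S_linear Nf l) (lf_bounded Nf l))).
set a := (_ / _).
have := hcvg_lin X a (ext_approx X x (Delta_S_linear l) (Delta_bounded l)) (hcvg_cst X 0).
rewrite addr0; congr hcvg; apply/funext => k; rewrite addr0 /= /neumaier_term (jZ X)//.
by apply: sym_Delta_pow => //; have [] := approx_seqP X x k.
Qed.

End DeltaExtension.
End Completion.

Theorem proposition6p7 (R : realType) (n : nat) (G : lieGroupType R n)
    (G_connected : connected [set: G])
    (c : chart R n G) (c_atlas : lie_atlas c) (c_unit : cdom c 1%g)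
    (B : 'M[R]_n) (B_basis : B \in unitmx)
    (kappa r r' : R) (r_r' : 1 <= r + r')
    (H : tvsType R[i]) (j : pol G -> H)
    (H_completion : is_completion c B r r' j) :
  (forall hbar : R[i]^o,
     maps_pol c B r (neumaier c B kappa hbar) /\
     continuous_pol c B r r' (neumaier c B kappa hbar)) /\
  (exists (Delta_ext : nat -> H -> H) (N_ext : R[i]^o -> H -> H),
     [/\ forall l, extends_to c B r j (iter l (neumaier_Delta c B))
                     (Delta_ext l),
         forall hbar, extends_to c B r j (neumaier c B kappa hbar)
                        (N_ext hbar),
         forall hbar (P : H),
           series (fun l => (neumaier_coef kappa hbar l : R[i]) *:
                              Delta_ext l P) @ \oo --> N_ext hbar P &
         forall P : H, entire (fun hbar => N_ext hbar P)]) /\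
  (0 <= r -> 1 <= r' ->
   exists star_ext : R[i]^o -> H -> H -> H,
     (forall hbar, extends_to2 c B r j (star_kappa c B kappa hbar)
                     (star_ext hbar)) /\
     (forall P Q : H, entire (fun hbar => star_ext hbar P Q))).
Proof.
have Nf := neumaier_family c_atlas c_unit B r_r' kappa.
have Next h : extends_to c B r j (neumaier c B kappa h)
    (lf_sum c B r r' j (neumaier_term c B kappa) h).
  apply: (lf_sum_extends c_atlas c_unit H_completion Nf) => P PS.
  exact: (neumaier_evals c_atlas c_unit kappa h PS).
split.
  move=> h; split; first by have [] := Next h.
  exact: (extends_to_continuous H_completion (Next h)).
split.
  exists (fun l => ext (sym_pol c B r) (nuN c B r r') j (j \o Delta_pow c B l)).
  exists (lf_sum c B r r' j (neumaier_term c B kappa)); split=> //.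
  - by move=> l; exact: Delta_extends.
  - move=> h x; have E : (fun l => (neumaier_coef kappa h l : R[i]) *:
        ext (sym_pol c B r) (nuN c B r r') j (j \o Delta_pow c B l) x) =
      (fun l => h ^+ l *:
        ext (sym_pol c B r) (nuN c B r r') j (j \o neumaier_term c B kappa l) x).
      apply/funext => l; rewrite neumaier_coefE.
      by rewrite (neumaier_term_ext c_atlas c_unit H_completion r_r')// scalerA.
    by rewrite E; exact: (lf_sum_series c_atlas c_unit H_completion Nf).
  - by move=> x; exact: lf_sum_entire.
move=> r0 r'1.
have [K K1 [Cn CnP]] := gutt_expansion (pbw_pairing c_atlas c_unit B_basis).
have [M Mf ME] := star_kappa_expansion c_atlas c_unit K1 CnP r0 r'1 kappa.
exists (bf_sum c B r r' j M); split=> [h|x y]; last exact: bf_sum_entire.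
by apply: bf_sum_extends => // P Q PS QS; exact: ME.
Qed.
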